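(* The truncated Fourier–Plancherel operator $\mathscr{F}_{\mathbb{R}^{+}}$ is unitarily equivalent to the multiplication operator $\mathcal{M}_F$ on $\mathfrak{M}$: the operator $U:L^2(\mathbb{R}^{+})\to\mathfrak{M}$ is unitary and $$\mathscr{F}_{\mathbb{R}^{+}}=U^{-1}\mathcal{M}_F\,U.$$
   Context: $\mathbb{R}^{+}=(0,\infty)$; $\Gamma$ is Euler's Gamma function; $\xi^{\zeta}=e^{\zeta\ln\xi}$ with real $\ln\xi$. The truncated Fourier–Plancherel operator $\mathscr{F}_{\mathbb{R}^{+}}:L^2(\mathbb{R}^{+})\to L^2(\mathbb{R}^{+})$ is $P_{\mathbb{R}^{+}}\mathscr{F}|_{L^2(\mathbb{R}^{+})}$, where $\mathscr{F}$ is the unitary Fourier–Plancherel operator on $L^2(\mathbb{R})$, $(\mathscr{F}x)(t)=\frac{1}{\sqrt{2\pi}}\int_{\mathbb{R}}x(\xi)e^{it\xi}d\xi$, and $P_{\mathbb{R}^{+}}$ is multiplication by the indicator of $\mathbb{R}^{+}$; for integrable $x$, $(\mathscr{F}_{\mathbb{R}^{+}}x)(t)=\frac{1}{\sqrt{2\pi}}\int_{\mathbb{R}^{+}}x(\xi)e^{it\xi}d\xi$. The model space $\mathfrak{M}$ consists of columns $\begin{bmatrix}\varphi_+\\ \varphi_-\end{bmatrix}$, $\varphi_\pm\in L^2(\mathbb{R}^{+})$, with inner product $\langle\varphi_+,\psi_+\rangle_{L^2(\mathbb{R}^{+})}+\langle\varphi_-,\psi_-\rangle_{L^2(\mathbb{R}^{+})}$.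 The operator $U$ is defined on $\mathcal{D}=\{x\in L^2(\mathbb{R}^{+}):\int_{\mathbb{R}^{+}}|x(\xi)|\xi^{-1/2}d\xi<\infty\}$ by $(Ux)_{\pm}(\mu)=\frac{1}{\sqrt{2\pi}}\int_{\mathbb{R}^{+}}x(\xi)\xi^{-1/2}\xi^{\pm i\mu}d\xi$, $\mu>0$, is isometric there, and is extended by continuity to $L^2(\mathbb{R}^{+})$. For $\mu>0$ let $F(\mu)=\begin{bmatrix}0&F_{+-}(\mu)\\ F_{-+}(\mu)&0\end{bmatrix}$ with $F_{+-}(\mu)=\frac{1}{\sqrt{2\pi}}e^{i\pi/4}e^{-\pi\mu/2}\Gamma(\tfrac12+i\mu)$ and $F_{-+}(\mu)=\frac{1}{\sqrt{2\pi}}e^{i\pi/4}e^{\pi\mu/2}\Gamma(\tfrac12-i\mu)$. The multiplication operator $\mathcal{M}_F$ on $\mathfrak{M}$ is $(\mathcal{M}_Fy)(\mu)=F(\mu)y(\mu)$. *)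

(* Defs.v *)
From mathcomp Require Import all_boot all_order all_algebra.
From mathcomp Require Import all_classical all_reals all_analysis.
From mathcomp Require Import complex.
Set Implicit Arguments. Unset Strict Implicit. Unset Printing Implicit Defensive.
Import Order.TTheory GRing.Theory Num.Theory.
Local Open Scope classical_set_scope.
Local Open Scope ring_scope.

Section Defs.
Variable R : realType.

Definition leb : set R -> \bar R := @lebesgue_measure R.

Definition Rpos : set R := `]0, +oo[%classic.

Definition RtoC (r : R) : R[i] := Complex r 0.

Definition cabs2 (z : R[i]) : R := complex.Re z ^+ 2 + complex.Im z ^+ 2.

Definition cexpi (a : R) : R[i] := Complex (cos a) (sin a).

(* xi^z = e^{z ln xi}, with real ln xi (used for xi > 0) *)
Definition cpow (xi : R) (z : R[i]) : R[i] :=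
  RtoC (expR (complex.Re z * ln xi)) * cexpi (complex.Im z * ln xi).

Definition Cintegrable (D : set R) (f : R -> R[i]) : Prop :=
  leb.-integrable D (fun x => (complex.Re (f x))%:E) /\
  leb.-integrable D (fun x => (complex.Im (f x))%:E).

Definition Cint (D : set R) (f : R -> R[i]) : R[i] :=
  Complex (Rintegral leb D (fun x => complex.Re (f x))) (Rintegral leb D (fun x => complex.Im (f x))).

(* Euler's Gamma function, Gamma z = int_0^oo t^(z-1) e^(-t) dt  (Re z > 0) *)
Definition CGamma (z : R[i]) : R[i] :=
  Cint Rpos (fun t => cpow t (z - 1) * RtoC (expR (- t))).

(* L^2(R^+): functions considered on (0,+oo) only *)
Definition L2pos (f : R -> R[i]) : Prop :=
  measurable_fun Rpos (fun x => complex.Re (f x)) /\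
  measurable_fun Rpos (fun x => complex.Im (f x)) /\
  leb.-integrable Rpos (fun x => (cabs2 (f x))%:E).

Definition norm2 (f : R -> R[i]) : R := Rintegral leb Rpos (fun x => cabs2 (f x)).

Definition aeeq (f g : R -> R[i]) : Prop :=
  {ae leb, forall x, Rpos x -> f x = g x}.

(* the model space M = L^2(R^+) (+) L^2(R^+), elements (phi_+, phi_-) *)
Definition Mspace (y : (R -> R[i]) * (R -> R[i])) : Prop :=
  L2pos y.1 /\ L2pos y.2.

Definition normM2 (y : (R -> R[i]) * (R -> R[i])) : R := norm2 y.1 + norm2 y.2.

Definition aeeqM (y z : (R -> R[i]) * (R -> R[i])) : Prop :=
  aeeq y.1 z.1 /\ aeeq y.2 z.2.

Definition isqrt2pi : R := (Num.sqrt (2 * pi))^-1.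

Definition Fformula (x : R -> R[i]) (t : R) : R[i] :=
  RtoC isqrt2pi * Cint Rpos (fun xi => x xi * cexpi (t * xi)).

Definition Udom (x : R -> R[i]) : Prop :=
  L2pos x /\ leb.-integrable Rpos (fun xi => (Num.sqrt (cabs2 (x xi)) * powR xi (- 2^-1))%:E).

(* formula for (U x)_+ (s = 1) and (U x)_- (s = -1) *)
Definition Uformula (s : R) (x : R -> R[i]) (mu : R) : R[i] :=
  RtoC isqrt2pi *
  Cint Rpos (fun xi => x xi * RtoC (powR xi (- 2^-1)) * cpow xi (Complex 0 (s * mu))).

(* F_{R+} : the bounded linear operator on L^2(R^+) (continuous extension)
   which coincides with the integral formula on integrable elements of L^2(R^+) *)
Definition is_truncFourier (Fop : (R -> R[i]) -> (R -> R[i])) : Prop :=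
  [/\ (forall x, L2pos x -> L2pos (Fop x)),
      (forall x y, L2pos x -> L2pos y -> aeeq x y -> aeeq (Fop x) (Fop y)),
      (forall (a : R[i]) x y, L2pos x -> L2pos y ->
          aeeq (Fop (fun t => a * x t + y t)) (fun t => a * Fop x t + Fop y t)),
      (exists c : R, forall x, L2pos x -> norm2 (Fop x) <= c * norm2 x) &
      (forall x, L2pos x -> Cintegrable Rpos x ->
          forall t, Rpos t -> Fop x t = Fformula x t)].

(* U : the bounded linear operator L^2(R^+) -> M (continuous extension)
   which coincides with the integral formula on D *)
Definition is_Uop (Uop : (R -> R[i]) -> (R -> R[i]) * (R -> R[i])) : Prop :=
  [/\ (forall x, L2pos x -> Mspace (Uop x)),
      (forall x y, L2pos x -> L2pos y -> aeeq x y -> aeeqM (Uop x) (Uop y)),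
      (forall (a : R[i]) x y, L2pos x -> L2pos y ->
          aeeqM (Uop (fun t => a * x t + y t))
                ((fun t => a * (Uop x).1 t + (Uop y).1 t),
                 (fun t => a * (Uop x).2 t + (Uop y).2 t))),
      (exists c : R, forall x, L2pos x -> normM2 (Uop x) <= c * norm2 x) &
      (forall x, Udom x -> forall mu, Rpos mu ->
          (Uop x).1 mu = Uformula 1 x mu /\ (Uop x).2 mu = Uformula (-1) x mu)].

Definition Fpm (mu : R) : R[i] :=
  RtoC isqrt2pi * cexpi (pi / 4) * RtoC (expR (- (pi * mu) / 2)) * CGamma (Complex 2^-1 mu).
Definition Fmp (mu : R) : R[i] :=
  RtoC isqrt2pi * cexpi (pi / 4) * RtoC (expR ((pi * mu) / 2)) * CGamma (Complex 2^-1 (- mu)).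

(* M_F y (mu) = F(mu) y(mu), F(mu) = [[0, F_{+-}], [F_{-+}, 0]] *)
Definition MF (y : (R -> R[i]) * (R -> R[i])) : (R -> R[i]) * (R -> R[i]) :=
  (fun mu => Fpm mu * y.2 mu, fun mu => Fmp mu * y.1 mu).

End Defs.

(* Main.v *)
(* In the logarithmic variable [xi = e^s] the map [x |-> x(e^s) e^{s/2}] is
   unitary from L^2(R^+) onto L^2(R), and it turns [U] into the Fourier
   transform on the line, the two components of [U x] being its restrictions
   to the two half-lines.  So unitarity of [U] is Plancherel's theorem: damping
   [FT g] by [e^{-e|m|}] and transforming back gives the Poisson smoothing of
   [g], which yields that [FT] is a contraction on L^1 /\ L^2, isometric on bounded
   continuous functions, hence isometric by density; surjectivity follows from
   the adjunction between [FT] and its reflection.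

   For the intertwining relation take [x] of compact support in the variable
   [s].  Damping [F x] by [e^{-e t}] legitimates Fubini's theorem in
   [U (e^{-e t} F x)], where the inner integral is
   [int_0^oo t^{-1/2 + i m} e^{-(e - i xi) t} dt
     = Gamma(1/2 + i m) (e - i xi)^{-1/2 - i m}].
   This evaluation is a rotation of the contour, done here by differentiating
   under the integral sign in the angle.  Letting [e] go to 0 gives
   [U (F x) = M_F (U x)] for such [x], and L^2 continuity extends it. *)
Require Import Defs.
From HB Require Import structures.
From mathcomp Require Import all_boot all_order all_algebra.
From mathcomp Require Import all_classical all_reals all_analysis.
From mathcomp Require Import measurable_realfun complex ring lra.
Set Implicit Arguments. Unset Strict Implicit. Unset Printing Implicit Defensive.
Import Order.TTheory GRing.Theory Num.Theory.
Import numFieldNormedType.Exports.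
Local Open Scope classical_set_scope.
Local Open Scope ring_scope.

(** Operators act on representatives and are specified by an integral formula on a subspace, by
    boundedness, and up to null sets. The transform on L^2 is therefore a graph [is_FT], closed and
    stable under a.e. changes, and every [Uop] meeting the specification is shown to have this
    graph. The two components of an element of the model space are glued into one function on the
    line. Since [Fmp m] is [Fpm (- m)], both rows of M_F become the single relation h'(m) = Fpm(m)
    h(-m). With the constant bound [CGamma_bounded] on Gamma, the factor exp(-pi m / 2) is
    uncontrolled as m tends to -oo, so limits are taken after multiplication by a positive weight.
    The constants of [Fpm] come from the polar form of e - i xi. For e > 0 its argument stays
    strictly above -pi / 2, where the rotated integrand is absolutely integrable; as e tends to 0
    the argument tends to -pi / 2, and (e - i xi)^(-1/2 - i m) produces exp(-pi m / 2) and exp(i pi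
    / 4). *)

Local Notation Re := complex.Re.
Local Notation Im := complex.Im.

(** * Complex-valued functions and integrals *)
Section ComplexAlgebra.
Context {R : realType}.
Implicit Types (z w : R[i]) (a b r : R).

Lemma complex_ext z w : Re z = Re w -> Im z = Im w -> z = w.
Proof. by case: z w => ? ? [? ?] /= -> ->. Qed.

Lemma cReD z w : Re (z + w) = Re z + Re w. Proof. by case: z w => ? ? []. Qed.
Lemma cImD z w : Im (z + w) = Im z + Im w. Proof. by case: z w => ? ? []. Qed.
Lemma cReN z : Re (- z) = - Re z. Proof. by case: z. Qed.
Lemma cImN z : Im (- z) = - Im z. Proof. by case: z. Qed.
Lemma cReM z w : Re (z * w) = Re z * Re w - Im z * Im w.
Proof. by case: z w => ? ? []. Qed.
Lemma cImM z w : Im (z * w) = Re z * Im w + Im z * Re w.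
Proof. by case: z w => ? ? [? ?] /=; rewrite [_ * _ + _]addrC addrC. Qed.
Lemma cRe0 : Re (0 : R[i]) = 0. Proof. by []. Qed.
Lemma cIm0 : Im (0 : R[i]) = 0. Proof. by []. Qed.
Lemma cRe1 : Re (1 : R[i]) = 1. Proof. by []. Qed.
Lemma cIm1 : Im (1 : R[i]) = 0. Proof. by []. Qed.

Definition cReIm := (cReD, cImD, cReN, cImN, cReM, cImM, cRe0, cIm0, cRe1, cIm1).

Definition cconj z : R[i] := Complex (Re z) (- Im z).
Definition cabs z : R := Num.sqrt (cabs2 z).

Lemma cconjM z w : cconj (z * w) = cconj z * cconj w.
Proof. by apply: complex_ext; rewrite ?cReIm /= ?cReIm /=; ring. Qed.

Lemma RtoCM a b : RtoC (a * b) = RtoC a * RtoC b.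
Proof. by apply: complex_ext; rewrite ?cReIm /=; ring. Qed.

Lemma RtoCD a b : RtoC (a + b) = RtoC a + RtoC b.
Proof. by apply: complex_ext; rewrite ?cReIm /=; ring. Qed.

Lemma RtoC1 : RtoC (1 : R) = 1. Proof. by []. Qed.

Lemma cconjR r : cconj (RtoC r) = RtoC r.
Proof. by apply: complex_ext; rewrite /= ?oppr0. Qed.

Lemma cexpiD a b : cexpi (a + b) = cexpi a * cexpi b.
Proof. by apply: complex_ext; rewrite ?cReIm /= ?cosD ?sinD; ring. Qed.

Lemma cexpiN a : cexpi (- a) = cconj (cexpi a).
Proof. by apply: complex_ext; rewrite /= ?cosN ?sinN. Qed.

Lemma cabs2_ge0 z : 0 <= cabs2 z.
Proof. by rewrite addr_ge0 ?sqr_ge0. Qed.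

Lemma cabs2M z w : cabs2 (z * w) = cabs2 z * cabs2 w.
Proof. by rewrite /cabs2 !cReIm; ring. Qed.

Lemma cabs2R r : cabs2 (RtoC r) = r ^+ 2.
Proof. by rewrite /cabs2 /= expr0n addr0. Qed.

Lemma cabs2_expi a : cabs2 (cexpi a) = 1.
Proof. by rewrite /cabs2 /= cos2Dsin2. Qed.

Lemma cabs2_conj z : cabs2 (cconj z) = cabs2 z.
Proof. by rewrite /cabs2 /= sqrrN. Qed.

Lemma cabs2N z : cabs2 (- z) = cabs2 z.
Proof. by rewrite /cabs2 !cReIm !sqrrN. Qed.

Lemma cabs20 : cabs2 (0 : R[i]) = 0.
Proof. by rewrite /cabs2 /= expr0n addr0. Qed.

Lemma cabs2_eq0 z : cabs2 z = 0 -> z = 0.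
Proof.
move/eqP; rewrite paddr_eq0 ?sqr_ge0// !sqrf_eq0 => /andP[/eqP zr /eqP zi].
exact: complex_ext.
Qed.

(** Parallelogram law: the difference of the two sides is |z - w|^2. *)
Lemma cabs2D_le z w : cabs2 (z + w) <= 2 * cabs2 z + 2 * cabs2 w.
Proof.
rewrite /cabs2 !cReIm -subr_ge0.
set x := (X in 0 <= X).
have -> : x = (Re z - Re w) ^+ 2 + (Im z - Im w) ^+ 2 by rewrite /x; ring.
by rewrite addr_ge0 ?sqr_ge0.
Qed.

Lemma cabs_ge0 z : 0 <= cabs z. Proof. exact: sqrtr_ge0. Qed.

Lemma cabs_sqr z : cabs z ^+ 2 = cabs2 z.
Proof. by rewrite sqr_sqrtr// cabs2_ge0. Qed.

Lemma cabsM z w : cabs (z * w) = cabs z * cabs w.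
Proof. by rewrite /cabs cabs2M sqrtrM// cabs2_ge0. Qed.

Lemma cabsR r : cabs (RtoC r) = `|r|.
Proof. by rewrite /cabs cabs2R sqrtr_sqr. Qed.

Lemma cabs_expi a : cabs (cexpi a) = 1.
Proof. by rewrite /cabs cabs2_expi sqrtr1. Qed.

Lemma cabs_conj z : cabs (cconj z) = cabs z.
Proof. by rewrite /cabs cabs2_conj. Qed.

Lemma cabs0 : cabs (0 : R[i]) = 0.
Proof. by rewrite /cabs cabs20 sqrtr0. Qed.

Lemma normRe_le z : `|Re z| <= cabs z.
Proof. by rewrite -sqrtr_sqr ler_wsqrtr// lerDl sqr_ge0. Qed.

Lemma normIm_le z : `|Im z| <= cabs z.
Proof. by rewrite -sqrtr_sqr ler_wsqrtr// lerDr sqr_ge0. Qed.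

Lemma cabs_le z : cabs z <= `|Re z| + `|Im z|.
Proof.
rewrite -(@ler_sqr _ _ _) ?nnegrE ?cabs_ge0 ?addr_ge0// cabs_sqr /cabs2.
rewrite sqrrD !real_normK ?num_real//.
have : 0 <= `|Re z| * `|Im z| *+ 2 by rewrite mulrn_wge0// mulr_ge0.
lra.
Qed.

End ComplexAlgebra.

Section ComplexMeasurable.
Context {R : realType} d (T : measurableType d).
Implicit Types (f g : T -> R[i]).

Definition cmeasurable f :=
  measurable_fun setT (fun x => Re (f x)) /\
  measurable_fun setT (fun x => Im (f x)).

Lemma cmeasurableD f g : cmeasurable f -> cmeasurable g ->
  cmeasurable (fun x => f x + g x).
Proof.
move=> [fr fi] [gr gi]; split.
  by under eq_fun do rewrite cReD; exact: measurable_funD.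
by under eq_fun do rewrite cImD; exact: measurable_funD.
Qed.

Lemma cmeasurableN f : cmeasurable f -> cmeasurable (fun x => - f x).
Proof.
move=> [fr fi]; split.
  by under eq_fun do rewrite cReN; exact: measurableT_comp.
by under eq_fun do rewrite cImN; exact: measurableT_comp.
Qed.

Lemma cmeasurableM f g : cmeasurable f -> cmeasurable g ->
  cmeasurable (fun x => f x * g x).
Proof.
move=> [fr fi] [gr gi]; split.
  under eq_fun do rewrite cReM.
  by apply: measurable_funB; exact: measurable_funM.
under eq_fun do rewrite cImM.
by apply: measurable_funD; exact: measurable_funM.
Qed.

Lemma cmeasurable_cst z : cmeasurable (fun=> z).
Proof. by split; exact: measurable_cst. Qed.

Lemma cmeasurable_conj f : cmeasurable f -> cmeasurable (fun x => cconj (f x)).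
Proof. by move=> [fr fi]; split => //=; exact: measurableT_comp. Qed.

Lemma cmeasurable_RtoC (h : T -> R) : measurable_fun setT h ->
  cmeasurable (fun x => RtoC (h x)).
Proof. by move=> mh; split => //=; exact: measurable_cst. Qed.

Lemma cmeasurable_expi (h : T -> R) : measurable_fun setT h ->
  cmeasurable (fun x => cexpi (h x)).
Proof.
move=> mh; split => /=; (apply: measurableT_comp => //).
  by apply: continuous_measurable_fun; exact: continuous_cos.
by apply: continuous_measurable_fun; exact: continuous_sin.
Qed.

Lemma measurable_cabs2 f : cmeasurable f ->
  measurable_fun setT (fun x => cabs2 (f x)).
Proof.
by move=> [fr fi]; apply: measurable_funD; exact: measurable_funX.
Qed.

Lemma measurable_cabs f : cmeasurable f ->
  measurable_fun setT (fun x => cabs (f x)).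
Proof.
move=> mf; apply: (measurableT_comp (f := @Num.sqrt R)).
  by apply: continuous_measurable_fun; exact: sqrt_continuous.
exact: measurable_cabs2.
Qed.

End ComplexMeasurable.

Lemma cmeasurable_comp {R : realType} d d' (T : measurableType d)
    (T' : measurableType d') (f : T' -> R[i]) (h : T -> T') :
  cmeasurable f -> measurable_fun setT h -> cmeasurable (fun x => f (h x)).
Proof.
by move=> [fr fi] mh; split;
  [exact: (measurableT_comp fr)|exact: (measurableT_comp fi)].
Qed.

Section ComplexIntegral.
Context {R : realType}.
Local Notation mu := (@lebesgue_measure R).
Implicit Types (f g : R -> R[i]) (h k : R -> R).

Definition integrableR h := mu.-integrable setT (fun x => (h x)%:E).

Lemma integrableR_le h k : measurable_fun setT h ->
  (forall x, `|h x| <= k x) -> integrableR k -> integrableR h.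
Proof.
move=> mh hk ik; apply: le_integrable ik => //.
  exact/measurable_EFinP.
by move=> x _ /=; rewrite lee_fin (le_trans (hk x))// ler_norm.
Qed.

Lemma integrableRD h k : integrableR h -> integrableR k ->
  integrableR (fun x => h x + k x).
Proof. by move=> ih ik; exact: (integrableD measurableT ih ik). Qed.

Lemma integrableRZ a h : integrableR h -> integrableR (fun x => a * h x).
Proof. by move=> ih; exact: (integrableZl measurableT a ih). Qed.

Lemma integrableRN h : integrableR h -> integrableR (fun x => - h x).
Proof.
by move=> ih; have := integrableRZ (-1) ih; under eq_fun do rewrite mulN1r.
Qed.

Lemma integrableR_measurable h : integrableR h -> measurable_fun setT h.
Proof. by move=> /measurable_int/measurable_EFinP. Qed.

Lemma eq_integrableR h k : h =1 k -> integrableR h -> integrableR k.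
Proof. by move=> /funext ->. Qed.

Definition cintegrable f :=
  integrableR (fun x => Re (f x)) /\ integrableR (fun x => Im (f x)).

Definition cint f : R[i] :=
  Complex (Rintegral mu setT (fun x => Re (f x)))
          (Rintegral mu setT (fun x => Im (f x))).

Lemma cintegrable_measurable f : cintegrable f -> cmeasurable f.
Proof.
by move=> [fr fi]; split;
  [exact: (integrableR_measurable fr)|exact: (integrableR_measurable fi)].
Qed.

Lemma cintegrable_le f k : cmeasurable f -> (forall x, cabs (f x) <= k x) ->
  integrableR k -> cintegrable f.
Proof.
move=> [fr fi] fk ik; split.
  by apply: (integrableR_le fr _ ik) => x; exact: le_trans (normRe_le _) _.
by apply: (integrableR_le fi _ ik) => x; exact: le_trans (normIm_le _) _.
Qed.

Lemma integrable_cabs f : cintegrable f ->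
  integrableR (fun x => cabs (f x)).
Proof.
move=> [fr fi]; apply: (@integrableR_le _ (fun x => `|Re (f x)| + `|Im (f x)|)).
- by apply: measurable_cabs; exact: cintegrable_measurable.
- by move=> x; rewrite ger0_norm ?cabs_ge0// cabs_le.
- by apply: integrableRD; exact: integrable_norm.
Qed.

Lemma cintegrableD f g : cintegrable f -> cintegrable g ->
  cintegrable (fun x => f x + g x).
Proof.
move=> [fr fi] [gr gi]; split.
  by under eq_fun do rewrite cReD; exact: (integrableRD fr gr).
by under eq_fun do rewrite cImD; exact: (integrableRD fi gi).
Qed.

Lemma cintegrableZ z f : cintegrable f ->
  cintegrable (fun x => z * f x).
Proof.
move=> itf; apply: (@cintegrable_le _ (fun x => cabs z * cabs (f x))).
- apply: cmeasurableM; first exact: cmeasurable_cst.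
  exact: cintegrable_measurable.
- by move=> x; rewrite cabsM.
- exact/integrableRZ/integrable_cabs.
Qed.

Lemma eq_cint f g : f =1 g -> cint f = cint g.
Proof. by move=> /funext ->. Qed.

Lemma cintD f g : cintegrable f -> cintegrable g ->
  cint (fun x => f x + g x) = cint f + cint g.
Proof.
move=> [fr fi] [gr gi]; apply: complex_ext; rewrite ?cReIm /=.
  by under eq_Rintegral do rewrite cReD; rewrite RintegralD.
by under eq_Rintegral do rewrite cImD; rewrite RintegralD.
Qed.

Lemma cintZ z f : cintegrable f ->
  cint (fun x => z * f x) = z * cint f.
Proof.
move=> [fr fi]; apply: complex_ext; rewrite ?cReIm /=.
  under eq_Rintegral do rewrite cReM.
  rewrite RintegralB//; first by rewrite !RintegralZl.
    exact: integrableRZ.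
  exact: integrableRZ.
under eq_Rintegral do rewrite cImM.
rewrite RintegralD//; first by rewrite !RintegralZl.
  exact: integrableRZ.
exact: integrableRZ.
Qed.

Lemma cint_conj f : cintegrable f ->
  cint (fun x => cconj (f x)) = cconj (cint f).
Proof.
move=> [fr fi]; rewrite /cint /cconj /=; congr Complex.
transitivity (Rintegral mu setT (fun x => -1 * Im (f x))).
  by apply: eq_Rintegral => x _; rewrite mulN1r.
by rewrite RintegralZl// mulN1r.
Qed.

(** Positive and negative parts have measurable partial integrals by Tonelli, and [fine], itself
    measurable, turns their difference into the real integral, default values included. *)
Lemma measurable_parametric_Rintegral (F : R * R -> R) :
  measurable_fun setT F ->
  measurable_fun setT (fun x => Rintegral mu setT (fun y => F (x, y))).
Proof.
move=> mF; rewrite /Rintegral.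
have mE : measurable_fun setT (EFin \o F) by exact/measurable_EFinP.
apply: (measurableT_comp (f := fine)); first exact: fine_measurable.
under eq_fun do rewrite integralE.
apply: emeasurable_funB.
  have := measurable_fun_fubini_tonelli_F (m2 := mu) ((EFin \o F)^\+)%E
    (measurable_funepos mE) (funepos_ge0 _).
  congr measurable_fun; apply/funext => x; apply: eq_integral => y _.
  by rewrite !funeposE.
have := measurable_fun_fubini_tonelli_F (m2 := mu) ((EFin \o F)^\-)%E
  (measurable_funeneg mE) (funeneg_ge0 _).
congr measurable_fun; apply/funext => x; apply: eq_integral => y _.
by rewrite !funenegE.
Qed.

Lemma cmeasurable_parametric_Cint (F : R * R -> R[i]) : cmeasurable F ->
  cmeasurable (fun x => cint (fun y => F (x, y))).
Proof.
move=> [mr mi]; split => /=.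
  exact: (measurable_parametric_Rintegral mr).
exact: (measurable_parametric_Rintegral mi).
Qed.

(** A separable majorant reduces the double integral of |F| to a product of two finite integrals.
    The complex kernels exchanged below through [cint_fubini] are bounded in this form. *)
Lemma integrable_prod_le (F : R * R -> R) h k : measurable_fun setT F ->
  (forall x y, `|F (x, y)| <= h x * k y) -> integrableR h -> integrableR k ->
  ((mu \x mu)%E).-integrable setT (EFin \o F).
Proof.
move=> mF Fhk ih ik.
have h0 x : 0 <= `|h x| by [].
have k0 y : 0 <= `|k y| by [].
apply/integrable12ltyP; first exact/measurable_EFinP.
have mh := integrableR_measurable ih; have mk := integrableR_measurable ik.
have kfin : (\int[mu]_y (`|k y|)%:E < +oo)%E.
  by case/integrableP : ik.
have hfin : (\int[mu]_y (`|h y|)%:E < +oo)%E.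
  by case/integrableP : ih.
set K := (\int[mu]_y (`|k y|)%:E)%E in kfin.
have K0 : (0 <= K)%E by apply: integral_ge0 => y _; rewrite lee_fin.
apply: (@le_lt_trans _ _ (\int[mu]_x (K * (`|h x|)%:E))%E).
  apply: ge0_le_integral => //.
  - by move=> x _; exact: integral_ge0.
  - have := measurable_fun_fubini_tonelli_F (m2 := mu) (abse \o (EFin \o F)).
    apply; last by move=> ?; exact: abse_ge0.
    by apply: measurableT_comp => //; exact/measurable_EFinP.
  - apply: measurable_funeM; apply/measurable_EFinP.
    exact: measurableT_comp.
  - move=> x _; rewrite muleC -ge0_integralZl//; last first.
      by apply/measurable_EFinP; exact: measurableT_comp.
    apply: ge0_le_integral => //.
    + apply: measurableT_comp => //; apply/measurable_EFinP.
      by apply: (measurableT_comp mF); exact: pair1_measurable.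
    + apply: measurable_funeM; apply/measurable_EFinP.
      exact: measurableT_comp.
    + move=> y _; rewrite /= -EFinM lee_fin.
      by rewrite -normrM (le_trans (Fhk _ _))// ler_norm.
rewrite ge0_integralZl//; last first.
  by apply/measurable_EFinP; exact: measurableT_comp.
by rewrite lte_mul_pinfty// ge0_fin_numE.
Qed.

(** The separable majorant also makes each inner integral finite for every value of the outer
    variable, not just almost every one, so [fine] can be removed pointwise before Fubini's theorem
    is applied. *)
Lemma Rintegral_fubini (F : R * R -> R) h k : measurable_fun setT F ->
  (forall x y, `|F (x, y)| <= h x * k y) -> integrableR h -> integrableR k ->
  Rintegral mu setT (fun x => Rintegral mu setT (fun y => F (x, y))) =
  Rintegral mu setT (fun y => Rintegral mu setT (fun x => F (x, y))).
Proof.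
move=> mF Fhk ih ik; have iF := integrable_prod_le mF Fhk ih ik.
have mh := integrableR_measurable ih; have mk := integrableR_measurable ik.
rewrite /Rintegral.
transitivity (fine (\int[mu]_x \int[mu]_y (F (x, y))%:E)%E).
  congr fine; apply: eq_integral => x _; rewrite fineK//.
  apply: integrable_fin_num => //.
  apply: (@integrableR_le (fun y => F (x, y)) (fun y => h x * k y)) => //.
    by apply: (measurableT_comp mF); exact: pair1_measurable.
  exact: integrableRZ.
transitivity (fine (\int[mu]_y \int[mu]_x (F (x, y))%:E)%E).
  by congr fine; exact: (Fubini iF).
congr fine; apply: eq_integral => y _; rewrite fineK//.
apply: integrable_fin_num => //.
apply: (@integrableR_le (fun x => F (x, y)) (fun x => k y * h x)) => //.
- by apply: (measurableT_comp mF); exact: pair2_measurable.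
- by move=> x; rewrite mulrC.
- exact: integrableRZ.
Qed.

Lemma cint_fubini (F : R * R -> R[i]) h k : cmeasurable F ->
  (forall x y, cabs (F (x, y)) <= h x * k y) ->
  integrableR h -> integrableR k ->
  cint (fun x => cint (fun y => F (x, y))) =
  cint (fun y => cint (fun x => F (x, y))).
Proof.
move=> [mr mi] Fhk ih ik; apply: complex_ext => /=.
  apply: (Rintegral_fubini mr _ ih ik) => x y.
  exact: le_trans (normRe_le _) (Fhk _ _).
apply: (Rintegral_fubini mi _ ih ik) => x y.
exact: le_trans (normIm_le _) (Fhk _ _).
Qed.

(** The factor 2 comes from bounding real and imaginary parts separately; it is harmless in the
    finiteness and domination bounds drawn from it. *)
Lemma cabs_cint_le f k : cmeasurable f -> (forall x, cabs (f x) <= k x) ->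
  integrableR k -> cabs (cint f) <= 2 * Rintegral mu setT k.
Proof.
move=> mf fk ik; have [ir ii] := cintegrable_le mf fk ik.
rewrite (le_trans (cabs_le _))//= mulrDl mul1r lerD//.
  rewrite (le_trans (le_normr_Rintegral _ ir))// le_Rintegral//.
    exact: integrable_norm.
  by move=> x _; exact: le_trans (normRe_le _) _.
rewrite (le_trans (le_normr_Rintegral _ ii))// le_Rintegral//.
  exact: integrable_norm.
by move=> x _; exact: le_trans (normIm_le _) _.
Qed.

Lemma integrableR_ge0 h : integrableR h -> (forall x, 0 <= h x) ->
  (\int[mu]_x (h x)%:E = (Rintegral mu setT h)%:E)%E.
Proof.
by move=> ih h0; rewrite /Rintegral fineK//; exact: integrable_fin_num.
Qed.

Lemma Rintegral_dominated_cvg (h_ : nat -> R -> R) h k :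
  (forall n, measurable_fun setT (h_ n)) ->
  (forall x, h_ n x @[n --> \oo] --> h x) ->
  (forall n x, `|h_ n x| <= k x) -> integrableR k ->
  Rintegral mu setT (h_ n) @[n --> \oo] --> Rintegral mu setT h.
Proof.
move=> mh hh hk ik.
have mhl : measurable_fun setT h.
  by apply: (measurable_fun_cvg (h := h_)) => // x _; exact: hh.
have hlk x : `|h x| <= k x.
  have hnx : `|h_ n x| @[n --> \oo] --> `|h x| by exact: cvg_norm (hh x).
  rewrite -(cvg_lim (@Rhausdorff R) hnx); apply: limr_le.
    by apply/cvg_ex; exists `|h x|.
  by apply: nearW => n; exact: hk.
have ih n := integrableR_le (mh n) (hk n) ik.
have ihl := integrableR_le mhl hlk ik.
apply: fine_cvg; rewrite fineK; last exact: integrable_fin_num.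
apply: (@dominated_cvg _ _ _ mu setT measurableT
  (fun n x => (h_ n x)%:E) (fun x => (h x)%:E) (EFin \o k)) => //.
- by move=> n; exact: (measurable_int mu (ih n)).
- by move=> x _; apply: cvg_EFin; [exact: nearW|exact: hh].
- by move=> n x _; rewrite /= lee_fin.
Qed.

End ComplexIntegral.


(** * Change of variables *)
Section Substitution.
Context {R : realType}.
Local Notation mu := (@lebesgue_measure R).
Implicit Types (phi w h : R -> R) (D : set R).

(** The map [phi] carries the line to [D] with Jacobian [w]. The form for nonnegative extended-real
    functions yields both the equality of real integrals and the transfer of integrability. *)
Definition substitution phi w D := forall f : R -> \bar R,
  measurable_fun setT f -> (forall x, 0 <= f x)%E ->
  (\int[mu]_s (f (phi s) * (w s)%:E) = \int[mu]_(x in D) f x)%E.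

Import HBNNSimple.

(** It is enough to compare measures of sets: the formula passes to simple functions by linearity,
    then to nonnegative measurable functions by monotone convergence along [nnsfun_approx]. *)
Lemma substitution_of_measure phi w D :
  measurable_fun setT phi -> measurable_fun setT w -> (forall s, 0 <= w s) ->
  measurable D ->
  (forall A, measurable A ->
    (\int[mu]_(s in phi @^-1` A) (w s)%:E = mu (A `&` D))%E) ->
  substitution phi w D.
Proof.
move=> mphi mw w0 mD phiD f mf f0.
pose f_ := @nnsfun_approx _ (measurableTypeR R) R setT measurableT f mf.
have f_f x : EFin (f_ n x) @[n --> \oo] --> f x.
  by apply: (@cvg_nnsfun_approx _ (measurableTypeR R)) => //.
have mf_ n : @measurable_fun _ _ (measurableTypeR R) _ setT (f_ n).
  exact: measurable_funP.
have nd x m n : (m <= n)%N -> f_ m x <= f_ n x.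
  by move=> mn; exact/lefP/nd_nnsfun_approx.
have -> : (\int[mu]_(x in D) f x =
    limn (fun n => \int[mu]_(x in D) (f_ n x)%:E))%E.
  rewrite -monotone_convergence//.
  - by apply: eq_integral => x _; apply/esym/cvg_lim => //; exact: f_f.
  - by move=> n; apply/measurable_EFinP/measurable_funTS; exact: mf_.
  - by move=> n x _; rewrite lee_fin.
  - by move=> x _ m n mn; rewrite lee_fin; exact: nd.
have -> : (\int[mu]_s (f (phi s) * (w s)%:E) =
    limn (fun n => \int[mu]_s ((f_ n (phi s))%:E * (w s)%:E)))%E.
  rewrite -monotone_convergence//.
  - apply: eq_integral => x _; apply/esym/cvg_lim => //.
    by apply: cvgeZr => //; exact: f_f.
  - move=> n; apply: emeasurable_funM; apply/measurable_EFinP => //.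
    exact: (measurableT_comp (mf_ n)).
  - by move=> n x _; rewrite mule_ge0 ?lee_fin.
  - move=> x _ m n mn; rewrite lee_wpmul2r ?lee_fin//.
    exact: nd.
congr (limn _); apply/funext => n.
have mfn r : @measurable _ R (f_ n @^-1` [set r]).
  by rewrite -[_ @^-1` _]setTI; exact: mf_.
have mphifn r : @measurable _ R (phi @^-1` (f_ n @^-1` [set r])).
  by rewrite -[_ @^-1` _]setTI; exact: mphi.
have mind r : measurable_fun setT (\1_(f_ n @^-1` [set r]) : R -> R).
  exact: measurable_indic.
have fE x : ((f_ n x)%:E =
    \sum_(r \in range (f_ n)) (r * \1_(f_ n @^-1` [set r]) x)%:E)%E.
  by rewrite fsumEFin// -fimfunE.
have ge0 r x : 0 <= r * \1_(f_ n @^-1` [set r]) x.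
  by have := nnfun_muleindic_ge0 (f_ n) r x; rewrite -EFinM lee_fin.
transitivity (\sum_(r \in range (f_ n))
    \int[mu]_s ((r * \1_(f_ n @^-1` [set r]) (phi s))%:E * (w s)%:E))%E.
  rewrite -ge0_integral_fsum//; last 2 first.
  - move=> r; apply: emeasurable_funM; apply/measurable_EFinP => //.
    by apply: measurable_funM => //; exact: (measurableT_comp (mind r)).
  - by move=> r s _; rewrite mule_ge0 ?lee_fin ?ge0.
  apply: eq_integral => s _; rewrite fE ge0_mule_fsuml// => r.
  by rewrite lee_fin ge0.
transitivity (\sum_(r \in range (f_ n))
    \int[mu]_(x in D) (r * \1_(f_ n @^-1` [set r]) x)%:E)%E; last first.
  rewrite -ge0_integral_fsum//; last 2 first.
  - move=> r; apply/measurable_EFinP/measurable_funTS.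
    exact: measurable_funM.
  - by move=> r s _; rewrite lee_fin ge0.
  by apply: eq_integral => s _; rewrite fE.
apply: eq_fsbigr => r _.
(* A nonnegative simple function has empty fibres over negative values; for r >= 0 the scalar can
   leave the integral. *)
have [r0|r0] := ltP r 0.
  rewrite preimage_nnfun0// !integral0_eq//.
  - by move=> x _; rewrite indic0 mulr0.
  - by move=> x _; rewrite indic0 mulr0 mul0e.
transitivity (r%:E * mu (f_ n @^-1` [set r] `&` D))%E.
  rewrite -phiD// -ge0_integralZl//=; last 3 first.
  - exact: mphifn.
  - by apply/measurable_funTS/measurable_EFinP.
  - by move=> x _; rewrite lee_fin.
  rewrite [RHS]integral_mkcond.
  apply: eq_integral => s _; rewrite patchE indicE; case: ifPn => sA.
    rewrite mem_set ?mulr1//; exact: (set_mem sA).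
  rewrite memNset ?mulr0 ?mul0e// => H; move/negP: sA; apply.
  exact/mem_set.
under [RHS]eq_integral do rewrite EFinM.
rewrite ge0_integralZl//; last first.
  by apply/measurable_EFinP/measurable_funTS; exact: mind.
by rewrite integral_indic.
Qed.


(** Positive and negative parts are transformed separately as extended integrals, so the real
    integrals agree whether or not these are finite. *)
Lemma Rintegral_substitution phi w D h :
  substitution phi w D -> (forall s, 0 <= w s) -> measurable_fun setT h ->
  Rintegral mu setT (fun s => h (phi s) * w s) = Rintegral mu D h.
Proof.
move=> sub w0 mh; rewrite /Rintegral; apply: (congr1 fine).
rewrite integralE [RHS]integralE.
have mE : measurable_fun setT (EFin \o h) by exact/measurable_EFinP.
rewrite -(sub _ (measurable_funepos mE) (funepos_ge0 _)).
rewrite -(sub _ (measurable_funeneg mE) (funeneg_ge0 _)).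
congr (_ - _)%E; apply: eq_integral => s _.
  rewrite [LHS]funeposE [X in _ = (X * _)%E]funeposE /= -!EFin_max -EFinM.
  by rewrite maxr_pMl ?w0// mul0r.
rewrite [LHS]funenegE [X in _ = (X * _)%E]funenegE /= -!EFin_max -EFinM.
by rewrite maxr_pMl ?w0// mul0r mulNr.
Qed.

Lemma integrable_substitution phi w D h :
  substitution phi w D -> (forall s, 0 <= w s) -> measurable_fun setT phi ->
  measurable_fun setT w -> measurable D -> measurable_fun setT h ->
  integrableR (fun s => h (phi s) * w s) <->
  mu.-integrable D (fun x => (h x)%:E).
Proof.
move=> sub w0 mphi mw mD mh.
have mhp : measurable_fun setT (fun s => h (phi s)).
  exact: (measurableT_comp mh).
have -> : integrableR (fun s => h (phi s) * w s) <->
    (\int[mu]_s (`|h (phi s)|%:E * (w s)%:E) < +oo)%E.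
  split=> [/integrableP[_]|H].
    by under eq_integral do rewrite /= normrM (ger0_norm (w0 _)) EFinM.
  apply/integrableP; split.
    by apply/measurable_EFinP; exact: measurable_funM.
  by under eq_integral do rewrite /= normrM (ger0_norm (w0 _)) EFinM.
rewrite (sub (fun x => `|h x|%:E)); last 2 first.
- by apply/measurable_EFinP; exact: measurableT_comp.
- by move=> x; rewrite lee_fin.
split=> [H|/integrableP[]//].
by apply/integrableP; split => //; apply/measurable_EFinP/measurable_funTS.
Qed.

(** The image of Lebesgue measure, scaled by |a|, gives each []x, y]] its length, and Lebesgue
    measure is unique with this property. For a < 0 the preimage is closed on the other side, with
    the same length. *)
Lemma substitution_affine a b : a != 0 ->
  substitution (fun s => a * s + b) (fun=> `|a|) setT.
Proof.
move=> a0; have a0' : 0 < `|a| by rewrite normr_gt0.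
have maff : measurable_fun setT (fun s : R => a * s + b).
  apply: continuous_measurable_fun => s.
  by apply: cvgD; [apply: cvgM; [exact: cvg_cst|exact: cvg_id]|exact: cvg_cst].
apply: substitution_of_measure => // A mA; rewrite setIT.
pose na : {nonneg R} := NngNum (ltW a0').
rewrite integral_cst//=; last by rewrite -[_ @^-1` _]setTI; exact: maff.
have := @lebesgue_measure_unique R (mscale na (pushforward mu
  ((fun s => a * s + b) : measurableTypeR R -> measurableTypeR R))).
move=> /(_ maff) H; apply/esym/H => // _ [[x y] _ <-].
transitivity (`|a|%:E * mu ((fun s : R => (a * s + b)%R) @^-1` `]x, y]%classic))%E;
  last by [].
have [a_gt0|a_le0] := ltP 0 a.
  have -> : (fun s => a * s + b) @^-1` `]x, y] = `](x - b) / a, (y - b) / a]%classic.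
    apply/seteqP; split => s /=; rewrite !in_itv /= ltr_pdivrMr// ler_pdivlMr//.
      by rewrite -ltrBlDr -lerBrDr [s * a]mulrC.
    by rewrite -ltrBlDr -lerBrDr [s * a]mulrC.
  rewrite !lebesgue_measure_itv /= !lte_fin ltr_pM2r ?invr_gt0// ltrD2r.
  case: ifP => _; last by rewrite mule0.
  rewrite -!EFinB -EFinM gtr0_norm//; congr EFin.
  by field; rewrite gt_eqF.
have a_lt0 : a < 0 by rewrite lt_neqAle a0.
have -> : (fun s => a * s + b) @^-1` `]x, y] = `[(y - b) / a, (x - b) / a[%classic.
  apply/seteqP; split => s /=; rewrite !in_itv /= ler_ndivrMr// ltr_ndivlMr//.
    by rewrite -ltrBlDr -lerBrDr [s * a]mulrC andbC.
  by rewrite -ltrBlDr -lerBrDr [s * a]mulrC andbC.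
rewrite !lebesgue_measure_itv /= !lte_fin ltr_nM2r ?invr_lt0// ltrD2r.
case: ifP => _; last by rewrite mule0.
rewrite -!EFinB -EFinM ltr0_norm//; congr EFin.
by field; rewrite lt_eqF.
Qed.

(** * The substitution t = exp s, by uniqueness of measures *)

Definition exp_measure (A : set (measurableTypeR R)) : \bar R :=
  (\int[mu]_(s in A) (expR s)%:E)%E.

Let exp_measure0 : exp_measure set0 = 0%E.
Proof. by rewrite /exp_measure integral_set0. Qed.

Let exp_measure_ge0 A : (0 <= exp_measure A)%E.
Proof. by apply: integral_ge0 => s _; rewrite lee_fin expR_ge0. Qed.

Let exp_measure_sigma_additive : semi_sigma_additive exp_measure.
Proof.
move=> /= F mF tF mUF; rewrite /exp_measure; apply: cvg_toP.
  apply: ereal_nondecreasing_is_cvgn => m n mn.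
  apply: lee_sum_nneg_natr => // k _ _.
  by apply: integral_ge0 => /= x Fkx; rewrite lee_fin expR_ge0.
rewrite ge0_integral_bigcup//=.
by apply: measurable_funTS; apply/measurable_EFinP; exact: measurable_expR.
Qed.

HB.instance Definition _ := isMeasure.Build _ _ _ exp_measure
  exp_measure0 exp_measure_ge0 exp_measure_sigma_additive.

Lemma continuous_FTC2_everywhere (f F : R -> R) (a b : R) : a <= b ->
  continuous f -> (forall x : R, is_derive x 1 F (f x)) ->
  (\int[mu]_(x in `[a, b]) (f x)%:E = (F b)%:E - (F a)%:E)%E.
Proof.
rewrite le_eqVlt => /predU1P[<- cf dF|ab cf dF].
  by rewrite set_itv1 integral_set1 subee.
have cF : continuous F.
  by move=> x; apply/differentiable_continuous/derivable1_diffP; apply: ex_derive.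
apply: continuous_FTC2 => //.
- exact: continuous_subspaceT.
- split.
  + by move=> x _; exact: ex_derive.
  + exact: (cvg_at_right_filter (cF a)).
  + exact: (cvg_at_left_filter (cF b)).
- by move=> x _; rewrite derive1E; exact: derive_val.
Qed.

Lemma Rpos_measurable : measurable (@Rpos R).
Proof. exact: measurable_itv. Qed.

(** The density exp gives []x, y]] the mass exp y - exp x, the length of the set of t > 0 with ln t
    in []x, y]]; [Rpos] excludes the points where [ln] has a default value. The sets []-k, k]] cover
    the line and have finite mass, so the two measures coincide. *)
Lemma exp_measureE (A : set R) : measurable A ->
  exp_measure A = mu (@ln R @^-1` A `&` @Rpos R).
Proof.
move=> mA; have mln : @measurable_fun _ _ (measurableTypeR R) (measurableTypeR R)
  setT (@ln R) by exact: measurable_ln.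
have := @measure_unique _ R (measurableTypeR R) (@ocitv R)
  (fun k => `](- k%:R), k%:R]%classic) erefl.
move=> /(_ (@ocitvI R)) H; have {}H := H (fun k => is_ocitv _ _).
have cover : \bigcup_k `](- k%:R), k%:R]%classic = [set: measurableTypeR R].
  rewrite -subTset => x _; exists (Num.trunc `|x|).+1 => //=.
  by rewrite in_itv /=; have := truncnS_gt `|x|; rewrite ltr_norml => /andP[-> /ltW].
have {cover}H := H cover exp_measure
  (pushforward (mrestr mu Rpos_measurable)
    (@ln R : measurableTypeR R -> measurableTypeR R)).
have {}H := H mln.
suff : exp_measure A = pushforward (mrestr mu Rpos_measurable) (@ln R) A by [].
apply: H => //.
- move=> _ [[x y] _ <-] /=; rewrite /pushforward /mrestr.
  have [xy|yx] := ltP x y; last first.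
    rewrite set_itv_ge ?bnd_simp -?leNgt// exp_measure0 preimage_set0 set0I.
    by rewrite measure0.
  transitivity (mu `](expR x), (expR y)]%classic).
    rewrite lebesgue_measure_itv /= lte_fin ltr_expR xy.
    rewrite /exp_measure integral_itv_obnd_cbnd; last first.
      by apply/measurable_funTS/measurable_EFinP; exact: measurable_expR.
    apply: continuous_FTC2_everywhere; first exact: ltW.
    exact: continuous_expR.
  congr (mu _); apply/seteqP; split => z /=; rewrite /Rpos /= !in_itv /= ?andbT.
    move=> /andP[xz zy]; have z0 : 0 < z by rewrite (lt_trans _ xz) ?expR_gt0.
    by rewrite -ltr_expR -ler_expR lnK ?posrE// xz zy.
  by move=> [/andP[xz zy] z0]; move: xz zy; rewrite -ltr_expR -ler_expR lnK ?posrE// => -> ->.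
- move=> k; rewrite /= /exp_measure integral_itv_obnd_cbnd; last first.
    by apply/measurable_funTS/measurable_EFinP; exact: measurable_expR.
  rewrite (@continuous_FTC2_everywhere _ expR) ?ltry//.
  + by rewrite (@le_trans _ _ 0)// oppr_le0.
  + exact: continuous_expR.
Qed.

Lemma substitution_exp : substitution expR expR (@Rpos R).
Proof.
apply: substitution_of_measure => //.
- exact: Rpos_measurable.
- move=> A mA; have := @exp_measureE (expR @^-1` A).
  rewrite /exp_measure => ->; last by rewrite -[_ @^-1` _]setTI; exact: measurable_expR.
  congr (mu _); apply/seteqP; split => z /=; rewrite /Rpos /= in_itv /= andbT.
    by move=> [Az z0]; rewrite lnK in Az.
  by move=> [Az z0]; rewrite lnK.
Qed.

End Substitution.



(** * Square-integrable functions on the line *)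
Section SquareIntegrable.
Context {R : realType}.
Local Notation mu := (@lebesgue_measure R).
Implicit Types (f g h : R -> R[i]) (fs gs : nat -> R -> R[i]) (z : R[i]).

Lemma ae_imp (P Q : R -> Prop) : (forall x, P x -> Q x) ->
  {ae mu, forall x, P x} -> {ae mu, forall x, Q x}.
Proof.
move=> PQ [N [mN N0 sub]]; exists N; split => // x nQ; apply: sub => Px.
exact/nQ/PQ.
Qed.

Lemma ae_and (P Q : R -> Prop) : {ae mu, forall x, P x} ->
  {ae mu, forall x, Q x} -> {ae mu, forall x, P x /\ Q x}.
Proof.
move=> [N [mN N0 subN]] [M [mM M0 subM]]; exists (N `|` M); split.
- exact: measurableU.
- by rewrite null_set_setU.
- move=> x /= nPQ; apply: contrapT => /not_orP[nN nM]; apply: nPQ.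
  split; apply: contrapT; [move/subN|move/subM]; exact.
Qed.

Definition L2R f := cmeasurable f /\ integrableR (fun x => cabs2 (f x)).

(** The square of the L^2 norm. Estimates stay quadratic: [n2D_le_eps] and its case [n2D_le] take
    the place of the triangle inequality. *)
Definition n2 f : R := Rintegral mu setT (fun x => cabs2 (f x)).

Lemma n2_ge0 f : 0 <= n2 f.
Proof. by apply: Rintegral_ge0 => x _; exact: cabs2_ge0. Qed.

Lemma eq_n2_le f g : f =1 g -> n2 f <= n2 g.
Proof. by move=> /funext ->. Qed.

Lemma L2R_n2 f : L2R f -> (\int[mu]_x (cabs2 (f x))%:E = (n2 f)%:E)%E.
Proof. by move=> [_ fi]; apply: (integrableR_ge0 fi) => x; exact: cabs2_ge0. Qed.

Lemma L2R_le f (k : R -> R) : cmeasurable f -> (forall x, cabs2 (f x) <= k x) ->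
  integrableR k -> L2R f.
Proof.
move=> mf fk ik; split => //; apply: (integrableR_le _ _ ik).
  exact: measurable_cabs2.
by move=> x; rewrite ger0_norm ?cabs2_ge0.
Qed.

Lemma n2_le f (k : R -> R) : L2R f -> (forall x, cabs2 (f x) <= k x) ->
  integrableR k -> n2 f <= Rintegral mu setT k.
Proof. by move=> [_ fi] fk ik; exact: le_Rintegral. Qed.

Lemma L2RD f g : L2R f -> L2R g -> L2R (fun x => f x + g x).
Proof.
move=> [mf fi] [mg gi].
apply: (@L2R_le _ (fun x => 2 * cabs2 (f x) + 2 * cabs2 (g x))).
- exact: cmeasurableD.
- by move=> x; exact: cabs2D_le.
- by apply: integrableRD; exact: integrableRZ.
Qed.

Lemma L2RN f : L2R f -> L2R (fun x => - f x).
Proof.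
move=> [mf fi]; split; first exact: cmeasurableN.
by under eq_fun do rewrite cabs2N.
Qed.

Lemma L2RB f g : L2R f -> L2R g -> L2R (fun x => f x - g x).
Proof. by move=> lf lg; exact: (L2RD lf (L2RN lg)). Qed.

Lemma L2RZ z f : L2R f -> L2R (fun x => z * f x).
Proof.
move=> [mf fi]; split.
  by apply: cmeasurableM => //; exact: cmeasurable_cst.
by under eq_fun do rewrite cabs2M; exact: integrableRZ.
Qed.

Lemma n2Z z f : L2R f -> n2 (fun x => z * f x) = cabs2 z * n2 f.
Proof.
move=> [mf fi]; rewrite /n2; under eq_Rintegral do rewrite cabs2M.
by rewrite RintegralZl.
Qed.

Lemma n2N f : n2 (fun x => - f x) = n2 f.
Proof. by rewrite /n2; under eq_Rintegral do rewrite cabs2N. Qed.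

Lemma n2C f g : n2 (fun x => f x - g x) = n2 (fun x => g x - f x).
Proof. by rewrite -n2N; congr n2; apply/funext => x; rewrite opprB. Qed.

(** The difference of the two sides is e |z - w / e|^2. A small [e] brings the constant before |z|^2
    close to 1, as the continuity of [n2] requires. *)
Lemma cabs2D_le_eps (e : R) z (w : R[i]) : 0 < e ->
  cabs2 (z + w) <= (1 + e) * cabs2 z + (1 + e^-1) * cabs2 w.
Proof.
move=> e0; rewrite -subr_ge0 /cabs2 !cReIm.
set a := Re z; set b := Im z; set c := Re w; set d := Im w.
have -> : (1 + e) * (a ^+ 2 + b ^+ 2) + (1 + e^-1) * (c ^+ 2 + d ^+ 2) -
    ((a + c) ^+ 2 + (b + d) ^+ 2) =
    e * ((a - e^-1 * c) ^+ 2 + (b - e^-1 * d) ^+ 2).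
  by field; rewrite gt_eqF.
by rewrite mulr_ge0 ?addr_ge0 ?sqr_ge0// ltW.
Qed.

Lemma n2D_le_eps (e : R) f g : 0 < e -> L2R f -> L2R g ->
  n2 (fun x => f x + g x) <= (1 + e) * n2 f + (1 + e^-1) * n2 g.
Proof.
move=> e0 lf lg; have [_ fi] := lf; have [_ gi] := lg.
rewrite -!RintegralZl// -RintegralD//; last 2 first.
  exact: integrableRZ.
  exact: integrableRZ.
apply: n2_le; first exact: L2RD.
  by move=> x; exact: cabs2D_le_eps.
by apply: integrableRD; exact: integrableRZ.
Qed.

Lemma n2D_le f g : L2R f -> L2R g ->
  n2 (fun x => f x + g x) <= 2 * n2 f + 2 * n2 g.
Proof. by move=> lf lg; have := n2D_le_eps ltr01 lf lg; rewrite invr1. Qed.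

Lemma n2_triangle_le f g h : L2R f -> L2R g -> L2R h ->
  n2 (fun x => f x - h x) <=
  2 * n2 (fun x => f x - g x) + 2 * n2 (fun x => g x - h x).
Proof.
move=> lf lg lh; apply: le_trans (n2D_le (L2RB lf lg) (L2RB lg lh)).
by apply: eq_n2_le => x; rewrite addrA subrK.
Qed.

Lemma n2_eq0 f : L2R f -> n2 f = 0 -> {ae mu, forall x, f x = 0}.
Proof.
move=> lf f0; have [mf fi] := lf.
have := L2R_n2 lf; rewrite f0 => H.
have : (\int[mu]_x `|(cabs2 (f x))%:E| = 0)%E.
  by rewrite -[RHS]H; apply: eq_integral => x _; rewrite gee0_abs// lee_fin cabs2_ge0.
have mc : measurable_fun setT (fun x => (cabs2 (f x))%:E).
  by apply/measurable_EFinP; exact: measurable_cabs2.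
move/(ae_eq_integral_abs mu measurableT mc).1.
by apply: ae_imp => x /= /(_ I) [] /cabs2_eq0.
Qed.

Lemma ae_n2_eq0 f : cmeasurable f -> {ae mu, forall x, f x = 0} -> n2 f = 0.
Proof.
move=> mf f0; rewrite /n2 /Rintegral.
rewrite (ae_eq_integral (cst 0%E))//.
- by rewrite integral_cst//= mul0e.
- by apply/measurable_EFinP; exact: measurable_cabs2.
- by apply: ae_imp f0 => x /= -> _; rewrite cabs20.
Qed.

Lemma ae_n2_eq f g : cmeasurable f -> cmeasurable g ->
  {ae mu, forall x, f x = g x} -> n2 f = n2 g.
Proof.
move=> mf mg fg; rewrite /n2 /Rintegral; congr fine.
apply: ae_eq_integral => //.
- by apply/measurable_EFinP; exact: measurable_cabs2.
- by apply/measurable_EFinP; exact: measurable_cabs2.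
- by apply: ae_imp fg => x /= -> _.
Qed.

Lemma ae_L2R f g : cmeasurable f -> cmeasurable g ->
  {ae mu, forall x, f x = g x} -> L2R f -> L2R g.
Proof.
move=> mf mg fg [_ fi]; split => //.
apply/integrableP; split.
  by apply/measurable_EFinP; exact: measurable_cabs2.
case/integrableP : fi => _; congr (_ < _)%E.
apply: ae_eq_integral => //.
- apply: measurableT_comp => //.
  by apply/measurable_EFinP; exact: measurable_cabs2.
- apply: measurableT_comp => //.
  by apply/measurable_EFinP; exact: measurable_cabs2.
- by apply: ae_imp fg => x /= -> _.
Qed.

Definition n2_cvg (fs : nat -> R -> R[i]) f :=
  n2 (fun x => fs n x - f x) @[n --> \oo] --> 0.

Lemma n2_cvg_uniq fs f g : (forall n, L2R (fs n)) -> L2R f -> L2R g ->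
  n2_cvg fs f -> n2_cvg fs g -> n2 (fun x => f x - g x) = 0.
Proof.
move=> lf_ lf lg ff fg; apply/eqP; rewrite eq_le n2_ge0 andbT.
have H : 2 * n2 (fun x => fs n x - f x) + 2 * n2 (fun x => fs n x - g x)
    @[n --> \oo] --> 2 * (0 : R) + 2 * 0.
  by apply: cvgD; apply: cvgM => //; exact: cvg_cst.
rewrite mulr0 addr0 in H.
rewrite -(cvg_lim (@Rhausdorff R) H); apply: limr_ge.
  by apply/cvg_ex; eexists; exact: H.
apply: nearW => n; rewrite [X in _ <= 2 * X + _]n2C.
exact: n2_triangle_le.
Qed.

Lemma n2_cvgD fs gs f g : (forall n, L2R (fs n)) -> (forall n, L2R (gs n)) ->
  L2R f -> L2R g -> n2_cvg fs f -> n2_cvg gs g ->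
  n2_cvg (fun n x => fs n x + gs n x) (fun x => f x + g x).
Proof.
move=> lf_ lg_ lf lg ff gg.
have H : 2 * n2 (fun x => fs n x - f x) + 2 * n2 (fun x => gs n x - g x)
    @[n --> \oo] --> 2 * (0 : R) + 2 * 0.
  by apply: cvgD; apply: cvgM => //; exact: cvg_cst.
rewrite mulr0 addr0 in H.
apply: squeeze_cvgr (cvg_cst 0) H.
apply: nearW => n; rewrite n2_ge0 /=.
apply: le_trans (n2D_le (L2RB (lf_ n) lf) (L2RB (lg_ n) lg)).
by apply: eq_n2_le => x; rewrite opprD addrACA.
Qed.

Lemma n2_cvgZ z fs f : (forall n, L2R (fs n)) -> L2R f -> n2_cvg fs f ->
  n2_cvg (fun n x => z * fs n x) (fun x => z * f x).
Proof.
move=> lf_ lf ff; rewrite /n2_cvg.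
have -> : (fun n => n2 (fun x => z * fs n x - z * f x)) =
    (fun n => cabs2 z * n2 (fun x => fs n x - f x)).
  apply/funext => n; rewrite -n2Z; last exact: L2RB.
  by congr n2; apply/funext => x; rewrite mulrBr.
by rewrite -(mulr0 (cabs2 z)); apply: cvgM => //; exact: cvg_cst.
Qed.

Lemma n2_cvg_le fs f (u : nat -> R) : u n @[n --> \oo] --> 0 ->
  (forall n, n2 (fun x => fs n x - f x) <= u n) -> n2_cvg fs f.
Proof.
move=> u0 fu; apply: squeeze_cvgr (cvg_cst 0) u0.
by apply: nearW => n; rewrite n2_ge0 fu.
Qed.

(** [n2D_le_eps], used in both directions, bounds the difference of the two squared norms by d times
    a bounded quantity plus (1 + 1 / d) times a quantity tending to 0. *)
Lemma cvg_n2 fs f : (forall n, L2R (fs n)) -> L2R f -> n2_cvg fs f ->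
  n2 (fs n) @[n --> \oo] --> n2 f.
Proof.
move=> lf_ lf ff; apply/cvgrPdist_le => e e0.
have n0 := n2_ge0 f.
pose d := Num.min 1 (e / (2 * (n2 f + e + 1))).
(* The sum n2 f + e appears in the denominator because [d] also multiplies n2 (fs n), for which n2 f
   + e is the bound obtained first. *)
have D0 : 0 < 2 * (n2 f + e + 1) by rewrite mulr_gt0// -addrA ltr_wpDl// addr_gt0.
have d0 : 0 < d by rewrite lt_min ltr01 /= divr_gt0.
have dle : d * (2 * (n2 f + e + 1)) <= e.
  by rewrite -ler_pdivlMr// ge_min lexx orbT.
have C0 : 0 < 1 + d^-1 by rewrite addr_gt0 ?invr_gt0.
pose c := e / (2 * (1 + d^-1)) .
have c0 : 0 < c by rewrite divr_gt0// mulr_gt0.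
have c1 : (1 + d^-1) * c = e / 2 by rewrite /c; move: C0; set k := 1 + _ => k0; field; rewrite gt_eqF.
have /cvgrPdist_le /(_ _ c0) := ff; apply: filterS => n.
rewrite sub0r normrN ger0_norm ?n2_ge0// => Hn.
have lfn := lf_ n; have ld := L2RB lfn lf.
have H1 : n2 (fs n) <= (1 + d) * n2 f + (1 + d^-1) * n2 (fun x => fs n x - f x).
  apply: le_trans (n2D_le_eps d0 lf ld); apply: eq_n2_le => x.
  by rewrite addrCA subrr addr0.
have H2 : n2 f <= (1 + d) * n2 (fs n) + (1 + d^-1) * n2 (fun x => fs n x - f x).
  rewrite n2C; apply: le_trans (n2D_le_eps d0 lfn (L2RB lf lfn)).
  by apply: eq_n2_le => x; rewrite addrCA subrr addr0.
have H3 : (1 + d^-1) * n2 (fun x => fs n x - f x) <= e / 2.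
  by rewrite -c1 ler_pM2l.
have d1 : d <= 1 by rewrite ge_min lexx.
have H4 : d * n2 f <= e / 2.
  nra.
have H5 : n2 (fs n) <= n2 f + e by lra.
have H6 : d * n2 (fs n) <= e / 2.
  have : d * n2 (fs n) <= d * (n2 f + e + 1) by rewrite ler_pM2l//; lra.
  lra.
by rewrite ler_norml; apply/andP; split; lra.
Qed.

(** Real part of the L^2 inner product, which is all that the expansion of |f - g|^2 involves.
    Polarization expresses it by [n2], whence its continuity. *)
Definition rip f g : R := Rintegral mu setT (fun x => Re (f x * cconj (g x))).

Lemma rip_polarization f g : L2R f -> L2R g ->
  rip f g = (n2 (fun x => f x + g x) - n2 f - n2 g) / 2.
Proof.
move=> lf lg; have [_ fi] := lf; have [_ gi] := lg.
have [_ fgi] := L2RD lf lg.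
rewrite /n2 -RintegralB// -RintegralB//; last first.
  exact: (integrableRD fgi (integrableRN fi)).
rewrite mulrC -RintegralZl//.
  apply: eq_Rintegral => x _; rewrite /cabs2 !cReIm /=.
  by field.
exact: (integrableRD (integrableRD fgi (integrableRN fi)) (integrableRN gi)).
Qed.

Lemma n2B f g : L2R f -> L2R g ->
  n2 (fun x => f x - g x) = n2 f + n2 g - 2 * rip f g.
Proof.
move=> lf lg; have := rip_polarization lf (L2RN lg); rewrite n2N.
have -> : rip f (fun x => - g x) = - rip f g.
  rewrite /rip -mulN1r -RintegralZl//.
    by apply: eq_Rintegral => x _; rewrite !cReIm /= !cReIm; ring.
  have [_ fi] := lf; have [_ gi] := lg; have [_ fgi] := L2RD lf lg.
  apply: eq_integrableR (integrableRZ 2^-1 (integrableRD (integrableRD fgi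
    (integrableRN fi)) (integrableRN gi))) => x.
  by rewrite /cabs2 !cReIm /=; field.
by move=> H; lra.
Qed.

Lemma rip_self f : rip f f = n2 f.
Proof.
by apply: eq_Rintegral => x _; rewrite /cabs2 !cReIm /=; ring.
Qed.

Lemma cvg_rip fs gs f g : (forall n, L2R (fs n)) -> (forall n, L2R (gs n)) ->
  L2R f -> L2R g -> n2_cvg fs f -> n2_cvg gs g ->
  rip (fs n) (gs n) @[n --> \oo] --> rip f g.
Proof.
move=> lf_ lg_ lf lg ff gg.
rewrite rip_polarization//.
under eq_fun do rewrite rip_polarization//.
apply: cvgM; last exact: cvg_cst.
apply: cvgB; last exact: cvg_n2.
apply: cvgB; last exact: cvg_n2.
apply: cvg_n2 => [n||]; [exact: L2RD|exact: L2RD|exact: n2_cvgD].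
Qed.

(** Componentwise, so that real limit theorems apply directly. *)
Definition ccvg (u : nat -> R[i]) z :=
  Re (u n) @[n --> \oo] --> Re z /\ Im (u n) @[n --> \oo] --> Im z.

Lemma ccvg_cst z : ccvg (fun=> z) z.
Proof. by split; exact: cvg_cst. Qed.

Lemma ccvgD (u v : nat -> R[i]) z w : ccvg u z -> ccvg v w ->
  ccvg (fun n => u n + v n) (z + w).
Proof.
move=> [ur ui] [vr vi]; split.
  by under eq_fun do rewrite cReD; rewrite cReD; exact: cvgD.
by under eq_fun do rewrite cImD; rewrite cImD; exact: cvgD.
Qed.

Lemma ccvgN (u : nat -> R[i]) z : ccvg u z -> ccvg (fun n => - u n) (- z).
Proof.
move=> [ur ui]; split.
  by under eq_fun do rewrite cReN; rewrite cReN; exact: cvgN.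
by under eq_fun do rewrite cImN; rewrite cImN; exact: cvgN.
Qed.

Lemma ccvgM (u v : nat -> R[i]) z w : ccvg u z -> ccvg v w ->
  ccvg (fun n => u n * v n) (z * w).
Proof.
move=> [ur ui] [vr vi]; split.
  rewrite (cReM z w); under eq_fun do rewrite cReM.
  by apply: cvgB; exact: cvgM.
rewrite (cImM z w); under eq_fun do rewrite cImM.
by apply: cvgD; exact: cvgM.
Qed.

Lemma cvg_cabs2 (u : nat -> R[i]) z : ccvg u z ->
  cabs2 (u n) @[n --> \oo] --> cabs2 z.
Proof.
move=> [ur ui]; rewrite /cabs2; under eq_fun do rewrite !expr2.
by rewrite !expr2; apply: cvgD; exact: cvgM.
Qed.

Lemma ccvg_RtoC (u : nat -> R) (r : R) : u n @[n --> \oo] --> r ->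
  ccvg (fun n => RtoC (u n)) (RtoC r).
Proof. by move=> ur; split => //=; exact: cvg_cst. Qed.

Lemma cint_dominated_cvg fs f (k : R -> R) : (forall n, cmeasurable (fs n)) ->
  (forall x, ccvg (fs ^~ x) (f x)) -> (forall n x, cabs (fs n x) <= k x) ->
  integrableR k -> ccvg (fun n => cint (fs n)) (cint f).
Proof.
move=> mf ff fk ik; split => /=.
  apply: (Rintegral_dominated_cvg _ _ _ ik).
  - by move=> n; case: (mf n).
  - by move=> x; case: (ff x).
  - by move=> n x; exact: le_trans (normRe_le _) (fk n x).
apply: (Rintegral_dominated_cvg _ _ _ ik).
- by move=> n; case: (mf n).
- by move=> x; case: (ff x).
- by move=> n x; exact: le_trans (normIm_le _) (fk n x).
Qed.

Lemma cmeasurable_ccvg fs f : (forall n, cmeasurable (fs n)) ->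
  (forall x, ccvg (fs ^~ x) (f x)) -> cmeasurable f.
Proof.
move=> mf ff; split.
  apply: (@measurable_fun_cvg _ _ _ _ (fun n x => Re (fs n x))).
    by move=> n; case: (mf n).
  by move=> x _; case: (ff x).
apply: (@measurable_fun_cvg _ _ _ _ (fun n x => Im (fs n x))).
  by move=> n; case: (mf n).
by move=> x _; case: (ff x).
Qed.

Lemma n2_dominated_cvg fs f (k : R -> R) : (forall n, cmeasurable (fs n)) ->
  (forall x, ccvg (fs ^~ x) (f x)) ->
  (forall n x, cabs2 (fs n x - f x) <= k x) -> integrableR k -> n2_cvg fs f.
Proof.
move=> mf ff fk ik; rewrite /n2_cvg.
have mfl := cmeasurable_ccvg mf ff.
have -> : (0 : R) = Rintegral mu setT (cst 0).
  by rewrite Rintegral_cst// mul0r.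
apply: (Rintegral_dominated_cvg (k := k)) => //.
- by move=> n; apply: measurable_cabs2; apply: cmeasurableD => //; exact: cmeasurableN.
- move=> x; rewrite -(cabs20 (R := R)) -(subrr (f x)); apply: cvg_cabs2.
  by apply: ccvgD => //; apply: ccvgN; exact: ccvg_cst.
- by move=> n x; rewrite ger0_norm ?cabs2_ge0.
Qed.

Lemma n2_fatou fs f (c : R) : (forall n, L2R (fs n)) ->
  {ae mu, forall x, ccvg (fs ^~ x) (f x)} -> cmeasurable f ->
  (\forall n \near \oo, n2 (fs n) <= c) -> L2R f /\ n2 f <= c.
Proof.
move=> lf ff mf fc.
have mc n : measurable_fun setT (fun x => (cabs2 (fs n x))%:E).
  by apply/measurable_EFinP; apply: measurable_cabs2; case: (lf n).
have mcf : measurable_fun setT (fun x => (cabs2 (f x))%:E).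
  by apply/measurable_EFinP; exact: measurable_cabs2.
have H : (\int[mu]_x (cabs2 (f x))%:E <= c%:E)%E.
  have -> : (\int[mu]_x (cabs2 (f x))%:E =
      \int[mu]_x limn_einf (fun n => (cabs2 (fs n x))%:E))%E.
    apply: ae_eq_integral => //.
      under eq_fun do rewrite -[limn_einf _]oppeK -limn_esupN.
      apply: measurableT_comp => //; apply: measurable_fun_limn_esup => n.
      by apply: (measurableT_comp (f := -%E)) => //; exact: mc.
    apply: ae_imp ff => x fx _ /=.
    have H : (cabs2 (fs n x))%:E @[n --> \oo] --> (cabs2 (f x))%:E.
      by apply: cvg_EFin; [exact: nearW|exact: cvg_cabs2].
    by rewrite is_cvg_limn_einfE ?(cvg_lim _ H)//; apply/cvg_ex; exists (cabs2 (f x))%:E.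
  apply: le_trans (fatou mu measurableT mc _) _.
    by move=> n x _; rewrite lee_fin cabs2_ge0.
  rewrite limn_einf_lim; apply: lime_le; first exact: is_cvg_einfs.
  apply: nearW => n; case: fc => N _ fcN.
  (* The index [maxn n N] lies in the tail over which the infimum is taken and also past [N], where
     the bound [c] holds. *)
  apply: (@le_trans _ _ (\int[mu]_x (cabs2 (fs (maxn n N) x))%:E)%E).
    by apply: ereal_inf_lbound; exists (maxn n N) => //=; exact: leq_maxl.
  by rewrite L2R_n2// lee_fin fcN//= leq_maxr.
have fi : integrableR (fun x => cabs2 (f x)).
  apply/integrableP; split => //.
  under eq_integral do rewrite gee0_abs ?lee_fin ?cabs2_ge0//.
  by rewrite (le_lt_trans H)// ltry.
by split => //; rewrite -lee_fin -L2R_n2.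
Qed.

(** * Completeness of L^2 (Riesz-Fischer) *)

Lemma cvg_geometric_increments (a : nat -> R) (C : R) :
  (forall k, `|a k.+1 - a k| <= C * 2^-1 ^+ k) -> cvgn a.
Proof.
move=> aC; have C0 : 0 <= C by have := aC 0%N; rewrite expr0 mulr1; exact: le_trans.
have H : cvgn (series (telescope a)).
  apply: normed_cvg; apply: (@series_le_cvg _ _ (geometric C 2^-1)).
  - by move=> n; exact: normr_ge0.
  - by move=> n; rewrite mulr_ge0// exprn_ge0// invr_ge0.
  - by move=> n; exact: aC.
  - by apply: is_cvg_geometric_series; rewrite ger0_norm// invf_lt1// ltr1n.
have -> : a = (fun n => series (telescope a) n + a 0%N).
  by apply/funext => n; rewrite telescopeK /= subrK.
by apply: is_cvgD => //; exact: is_cvg_cst.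
Qed.

Definition crestrict (D : set R) f := fun x => if x \in D then f x else 0.

Lemma crestrictE (D : set R) f x : crestrict D f x = RtoC (\1_D x) * f x.
Proof.
by rewrite /crestrict indicE; case: (x \in D); rewrite ?mul1r ?mul0r.
Qed.

Lemma cmeasurable_crestrict (D : set R) f : measurable D -> cmeasurable f ->
  cmeasurable (crestrict D f).
Proof.
move=> mD mf; rewrite (funext (crestrictE D f)).
by apply: cmeasurableM => //; apply: cmeasurable_RtoC; exact: measurable_indic.
Qed.

Lemma cabs2_crestrict_le (D : set R) f x : cabs2 (crestrict D f x) <= cabs2 (f x).
Proof. by rewrite /crestrict; case: ifP; rewrite // cabs20 cabs2_ge0. Qed.

Lemma L2R_crestrict (D : set R) f : measurable D -> L2R f -> L2R (crestrict D f).
Proof.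
move=> mD [mf fi]; apply: L2R_le fi; first exact: cmeasurable_crestrict.
by move=> x; exact: cabs2_crestrict_le.
Qed.

Lemma L2R_complete fs : (forall n, L2R (fs n)) ->
  (forall e : R, 0 < e -> exists N, forall m n, (N <= m)%N -> (N <= n)%N ->
    n2 (fun x => fs m x - fs n x) <= e) ->
  exists g, L2R g /\ n2_cvg fs g.
Proof.
move=> lfs cfs.
(* The rate 8^-k leaves room for a weight 4^k: the integral of 4^k |d_k|^2 is at most 2^-k, so the
   weighted series is finite a.e., and there |d_k| <= sqrt C 2^-k. *)
have : forall k : nat, exists N, forall m n, (N <= m)%N -> (N <= n)%N ->
    n2 (fun x => fs m x - fs n x) <= (8 ^+ k)^-1.
  by move=> k; apply: cfs; rewrite invr_gt0 exprn_gt0.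
move=> /choice[phi phiP].
(* Partial sums of [(phi i).+1] increase and dominate both [phi k] and [k]: consecutive terms obey
   the rate above, and the indices tend to infinity. *)
pose psi k := (\sum_(i < k.+1) (phi i).+1)%N.
have psiS k : (psi k <= psi k.+1)%N by rewrite /psi [leqRHS]big_ord_recr leq_addr.
have psi_phi k : (phi k <= psi k)%N.
  by rewrite /psi big_ord_recr /= (leq_trans (leqnSn _))// leq_addl.
have psi_ge k : (k <= psi k)%N.
  elim: k => // k IH; apply: leq_ltn_trans IH _.
  by rewrite /psi [ltnRHS]big_ord_recr /= -[X in (X < _)%N]addn0 ltn_add2l.
pose d k x := fs (psi k.+1) x - fs (psi k) x.
have ld k : L2R (d k) by exact: L2RB.
have dk k : n2 (d k) <= (8 ^+ k)^-1.
  by apply: phiP => //; exact: leq_trans (psi_phi k) (psiS k).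
pose u k x := ((4 ^+ k * cabs2 (d k x))%:E).
have mu_ k : measurable_fun setT (u k).
  apply/measurable_EFinP; apply: measurable_funM => //.
  by apply: measurable_cabs2; case: (ld k).
have u0 k x : (0 <= u k x)%E.
  by rewrite lee_fin mulr_ge0 ?cabs2_ge0// exprn_ge0.
have Iu : (\int[mu]_x (\sum_(k <oo) u k x) < +oo)%E.
  rewrite integral_nneseries//.
  apply: (@le_lt_trans _ _ (\sum_(k <oo) (0 + (2 / (2 ^ k.+1)%:R)%:E))%E).
    apply: lee_nneseries => k _.
      by move=> _; apply: integral_ge0.
    rewrite add0e; under eq_integral do rewrite /u EFinM.
    rewrite ge0_integralZl//; last 2 first.
    - by apply/measurable_EFinP; apply: measurable_cabs2; case: (ld k).
    - by move=> x _; rewrite lee_fin cabs2_ge0.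
    rewrite L2R_n2// -EFinM lee_fin natrX exprS invfM mulrA mulfV// mul1r.
    apply: (@le_trans _ _ (4 ^+ k * (8 ^+ k)^-1)).
      by rewrite ler_pM2l// exprn_gt0.
    have -> : (8 : R) = 4 * 2 by ring.
    by rewrite exprMn invfM mulrA mulfV ?mul1r// expf_neq0.
  apply: le_lt_trans (@epsilon_trick R (fun=> 0%E) 2 xpredT _ _) _ => //.
  by rewrite eseries0// add0e ltry.
have : {ae mu, forall x, (\sum_(k <oo) u k x < +oo)%E}.
  have mS : measurable_fun setT (fun x => \sum_(k <oo) u k x)%E.
    by apply: ge0_emeasurable_sum.
  have iS : mu.-integrable setT (fun x => \sum_(k <oo) u k x)%E.
    apply/integrableP; split => //.
    by under eq_integral do rewrite gee0_abs ?nneseries_ge0//.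
  have := integrable_ae measurableT iS; apply: ae_imp => x /(_ I).
  by rewrite ge0_fin_numE// nneseries_ge0.
move=> [Z [mZ Z0 subZ]].
have cvgZ x : ~ Z x ->
    cvgn (fun k => Re (fs (psi k) x)) /\ cvgn (fun k => Im (fs (psi k) x)).
  move=> nZ.
  have fS : (\sum_(k <oo) u k x < +oo)%E by apply: contrapT => /subZ.
  pose C := fine (\sum_(k <oo) u k x).
  have uC k : 4 ^+ k * cabs2 (d k x) <= C.
    rewrite -lee_fin fineK ?ge0_fin_numE ?nneseries_ge0//.
    apply: (@le_trans _ _ (\sum_(0 <= i < k.+1) u i x)%E).
      by rewrite big_nat_recr//= leeDr// sume_ge0.
    exact: nneseries_lim_ge.
  have C0 : 0 <= C by apply: le_trans (uC 0%N); rewrite mulr_ge0 ?cabs2_ge0// exprn_ge0.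
  have dC k : cabs (d k x) <= Num.sqrt C * 2^-1 ^+ k.
    rewrite exprVn ler_pdivlMr ?exprn_gt0//.
    rewrite -(@ler_sqr R) ?nnegrE ?mulr_ge0 ?sqrtr_ge0 ?exprn_ge0//.
    rewrite exprMn cabs_sqr sqr_sqrtr// -exprM mulnC exprM mulrC.
    by have -> : 2 ^+ 2 = 4 :> R by ring.
  split; apply: (@cvg_geometric_increments _ (Num.sqrt C)) => k.
    by apply: le_trans (dC k); rewrite -cReN -cReD; exact: normRe_le.
  by apply: le_trans (dC k); rewrite -cImN -cImD; exact: normIm_le.
(* Putting 0 on the exceptional null set [Z] gives convergence at every point, hence measurability
   of the limit. *)
pose g := crestrict (~` Z) (fun x => Complex (limn (fun k => Re (fs (psi k) x)))
  (limn (fun k => Im (fs (psi k) x)))).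
have mCZ : measurable (~` Z) by exact: measurableC.
have fsg x : ccvg (fun k => crestrict (~` Z) (fs (psi k)) x) (g x).
  rewrite /g /crestrict; case: ifPn => [/set_mem /= nZ|_]; last exact: ccvg_cst.
  by have [? ?] := cvgZ x nZ; split.
have mg : cmeasurable g.
  apply: cmeasurable_ccvg fsg => k; apply: cmeasurable_crestrict => //.
  by case: (lfs (psi k)).
have fsg' m : {ae mu, forall x,
    ccvg (fun k => fs m x - fs (psi k) x) (fs m x - g x)}.
  exists Z; split => // x; apply: contra_notP => nZ.
  apply: ccvgD; first exact: ccvg_cst.
  apply: ccvgN; have := fsg x; rewrite /crestrict.
  by rewrite mem_set.
(* Fatou applied to fs m - fs (psi k) as k grows turns the Cauchy estimate into one for the distance
   to [g]. *)
have key e : 0 < e -> exists N, forall m, (N <= m)%N ->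
    L2R (fun x => fs m x - g x) /\ n2 (fun x => fs m x - g x) <= e.
  move=> /cfs[N HN]; exists N => m Nm.
  apply: n2_fatou (fsg' m) _ _.
  - by move=> k; exact: L2RB.
  - by apply: cmeasurableD; [case: (lfs m)|exact: cmeasurableN].
  - exists N => // k /= Nk; apply: HN => //; exact: leq_trans (psi_ge k).
have lg : L2R g.
  have [N /(_ N (leqnn N)) [H _]] := key 1 ltr01.
  have := L2RB (lfs N) H.
  by congr L2R; apply/funext => x; rewrite opprB addrC subrK.
exists g; split => //.
apply/cvgrPdist_le => e e0; have [N HN] := key e e0.
exists N => // m /= /HN[_]; rewrite sub0r normrN ger0_norm//; exact: n2_ge0.
Qed.

(** By Fatou applied to fs n - g, the squared norm of f - g is below every e > 0. This identifies an
    abstract L^2 limit with an explicit pointwise formula. *)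
Lemma n2_cvg_pointwise fs f g : (forall n, L2R (fs n)) -> L2R g ->
  n2_cvg fs g -> (forall x, ccvg (fs ^~ x) (f x)) -> {ae mu, forall x, g x = f x}.
Proof.
move=> lfs lg fsg fsf.
have mf : cmeasurable f by apply: cmeasurable_ccvg fsf => n; case: (lfs n).
have key e : 0 < e -> L2R (fun x => f x - g x) /\ n2 (fun x => f x - g x) <= e.
  move=> e0; apply: (@n2_fatou (fun n x => fs n x - g x)).
  - by move=> n; exact: L2RB.
  - by apply: aeW => x; apply: ccvgD; [exact: fsf|apply: ccvgN; exact: ccvg_cst].
  - by apply: cmeasurableD => //; apply: cmeasurableN; case: lg.
  - move/cvgrPdist_le : fsg => /(_ _ e0); apply: filterS => n.
    by rewrite sub0r normrN ger0_norm ?n2_ge0.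
have [lfg _] := key 1 ltr01.
have fg0 : n2 (fun x => f x - g x) = 0.
  apply/eqP; rewrite eq_le n2_ge0 andbT; apply/ler_addgt0Pl => e e0.
  by rewrite addr0; case: (key e e0).
by apply: ae_imp (n2_eq0 lfg fg0) => x /eqP; rewrite subr_eq0 => /eqP.
Qed.

End SquareIntegrable.



(** * The Poisson kernel *)
Section RealDerivatives.
Context {R : realType}.
Implicit Types (f g : R -> R) (x a b df dg : R).

Lemma is_derive_fun_cst a x : is_derive x 1 (fun=> a) 0.
Proof. exact: is_derive_cst. Qed.

Lemma is_derive_fun_id x : is_derive x 1 (fun t : R => t) 1.
Proof. exact: is_derive_id. Qed.

Lemma is_derive_funD f g x df dg : is_derive x 1 f df -> is_derive x 1 g dg ->
  is_derive x 1 (fun t => f t + g t) (df + dg).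
Proof. by move=> hf hg; exact: is_deriveD. Qed.

Lemma is_derive_funN f x df : is_derive x 1 f df ->
  is_derive x 1 (fun t => - f t) (- df).
Proof. by move=> hf; exact: is_deriveN. Qed.

Lemma is_derive_funM f g x df dg : is_derive x 1 f df -> is_derive x 1 g dg ->
  is_derive x 1 (fun t => f t * g t) (f x * dg + g x * df).
Proof.
by move=> hf hg; exact: is_deriveM.
Qed.

Lemma is_derive_fun_exp f x df : is_derive x 1 f df ->
  is_derive x 1 (fun t => expR (f t)) (expR (f x) * df).
Proof. by move=> hf; apply: (@is_derive1_comp _ expR f). Qed.

Lemma is_derive_fun_cos f x df : is_derive x 1 f df ->
  is_derive x 1 (fun t => cos (f t)) (- sin (f x) * df).
Proof. by move=> hf; apply: (@is_derive1_comp _ cos f). Qed.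

Lemma is_derive_fun_sin f x df : is_derive x 1 f df ->
  is_derive x 1 (fun t => sin (f t)) (cos (f x) * df).
Proof. by move=> hf; apply: (@is_derive1_comp _ sin f). Qed.

Lemma is_derive_continuous f :
  (forall x, exists df, is_derive x 1 f df) -> continuous f.
Proof.
move=> H x; apply/differentiable_continuous/derivable1_diffP.
by case: (H x) => df [].
Qed.

End RealDerivatives.

(** The derivative is built as an existential variable following the shape of the function.
    [is_derive_eq] then leaves an algebraic identity, while [eexists] alone suffices for continuity
    through [is_derive_continuous]. *)
Ltac derive_fun :=
  first [ eapply is_derive_fun_id | eapply is_derive_fun_cst
        | eapply is_derive_funD; [derive_fun|derive_fun]
        | eapply is_derive_funN; derive_fun
        | eapply is_derive_funM; [derive_fun|derive_fun]
        | eapply is_derive_fun_exp; derive_fun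
        | eapply is_derive_fun_cos; derive_fun
        | eapply is_derive_fun_sin; derive_fun ].

Section PoissonKernel.
Context {R : realType}.
Local Notation mu := (@lebesgue_measure R).
Implicit Types (f g h : R -> R) (e d s : R).

Lemma integrable_mkcondR (D : set R) f : measurable D ->
  mu.-integrable D (fun x => (f x)%:E) <-> integrableR (f \_ D).
Proof.
by move=> mD; apply: iff_trans (integrable_mkcond (mu := mu) _ mD) _; rewrite restrict_EFin.
Qed.

Lemma cvg_Rintegral_itv (D : set R) f (a b : nat -> R) : measurable D ->
  measurable_fun setT f -> mu.-integrable D (fun x => (f x)%:E) ->
  (forall n x, x \in `[a n, b n] -> D x) ->
  (forall x, D x -> \forall n \near \oo, x \in `[a n, b n]) ->
  Rintegral mu `[a n, b n] f @[n --> \oo] --> Rintegral mu D f.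
Proof.
move=> mD mf fi abD Dab.
have -> : Rintegral mu D f = Rintegral mu setT (f \_ D).
  by rewrite Rintegral_mkcond.
have -> : (fun n => Rintegral mu `[a n, b n] f) =
    (fun n => Rintegral mu setT (f \_ `[a n, b n])).
  by apply/funext => n; rewrite Rintegral_mkcond.
apply: (Rintegral_dominated_cvg (k := fun x => `|(f \_ D) x|)).
- by move=> n; apply/(measurable_restrictT _ _).1 => //; exact: measurable_funTS.
- move=> x; apply: cvg_near_cst.
  have [Dx|nDx] := pselect (D x).
    have := Dab x Dx; apply: filterS => n xab.
    by rewrite !patchE mem_set// mem_set.
  apply: nearW => n; rewrite !patchE memNset; last by move=> /= xab; exact/nDx/(abD n).
  by rewrite memNset.
- move=> n x; rewrite !patchE; case: ifPn => [/set_mem /= xab|_]; last first.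
    by rewrite normr0.
  by rewrite mem_set//; exact: abD xab.
- exact: integrable_norm ((integrable_mkcondR f mD).1 fi).
Qed.

Lemma Rintegral_itv_FTC (f F : R -> R) a b : a <= b -> continuous f ->
  (forall x : R, is_derive x 1 F (f x)) ->
  Rintegral mu `[a, b] f = F b - F a.
Proof. by move=> ab cf dF; rewrite /Rintegral (continuous_FTC2_everywhere ab cf dF). Qed.

Lemma Rintegral_itvy_FTC (f F : R -> R) (a l : R) : continuous f ->
  mu.-integrable `[a, +oo[ (fun x => (f x)%:E) ->
  (forall x : R, is_derive x 1 F (f x)) ->
  F n%:R @[n --> \oo] --> l -> Rintegral mu `[a, +oo[ f = l - F a.
Proof.
move=> cf fi dF Fl.
have mf : measurable_fun setT f by exact: continuous_measurable_fun.
have H := @cvg_Rintegral_itv `[a, +oo[%classic f (fun=> a) (fun n => n%:R)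
  (measurable_itv _) mf fi.
have {}H : Rintegral mu `[a, n%:R] f @[n --> \oo] --> Rintegral mu `[a, +oo[ f.
  apply: H => [n x /=|x /=]; rewrite in_itv /=; first by rewrite in_itv /= andbT => /andP[].
  rewrite andbT => ax; near=> n; rewrite in_itv /= ax /=.
  near: n; exact: nbhs_infty_ger.
have H2 : Rintegral mu `[a, n%:R] f @[n --> \oo] --> l - F a.
  apply: cvg_trans (cvgB Fl (cvg_cst (F a))); apply: near_eq_cvg.
  near=> n; rewrite (Rintegral_itv_FTC (F := F))//.
  near: n; exact: nbhs_infty_ger.
by rewrite -(cvg_lim (@Rhausdorff R) H) (cvg_lim (@Rhausdorff R) H2).
Unshelve. all: by end_near. Qed.

(** Serves the rotation of the Gamma integral, where the derivative in the angle is at the same time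
    a derivative in the variable of integration. *)
Lemma RintegralT_FTC (f F : R -> R) : continuous f -> integrableR f ->
  (forall x : R, is_derive x 1 F (f x)) ->
  F n%:R @[n --> \oo] --> 0 -> F (- n%:R) @[n --> \oo] --> 0 ->
  Rintegral mu setT f = 0.
Proof.
move=> cf fi dF Fy FNy.
have mf : measurable_fun setT f by exact: continuous_measurable_fun.
have H := @cvg_Rintegral_itv setT f (fun n => - n%:R) (fun n => n%:R)
  measurableT mf fi.
have {}H : Rintegral mu `[- n%:R, n%:R] f @[n --> \oo] --> Rintegral mu setT f.
  apply: H => // x _; near=> n; rewrite in_itv /= -ler_norml.
  near: n; exact: nbhs_infty_ger.
have H2 : Rintegral mu `[- n%:R, n%:R] f @[n --> \oo] --> (0 - 0 : R).
  apply: cvg_trans (cvgB Fy FNy); apply: near_eq_cvg.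
  near=> n; rewrite (Rintegral_itv_FTC (F := F))//.
  by rewrite (@le_trans _ _ 0)// oppr_le0.
rewrite -(cvg_lim (@Rhausdorff R) H) (cvg_lim (@Rhausdorff R) H2).
by rewrite subrr.
Unshelve. all: by end_near. Qed.

Lemma Rintegral_opp f : measurable_fun setT f ->
  Rintegral mu setT (fun x => f (- x)) = Rintegral mu setT f.
Proof.
move=> mf; have N1 : (-1 : R) != 0 by rewrite oppr_eq0 oner_eq0.
rewrite -[RHS](Rintegral_substitution (substitution_affine 0 N1))//.
by apply: eq_Rintegral => x _; rewrite normrN1 mulr1 mulN1r addr0.
Qed.

Lemma integrableR_opp f : integrableR f -> integrableR (fun x => f (- x)).
Proof.
move=> fi; have mf := integrableR_measurable fi.
have N1 : (-1 : R) != 0 by rewrite oppr_eq0 oner_eq0.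
have := (integrable_substitution (substitution_affine 0 N1) _ _ _ measurableT mf).2 fi.
move=> H; apply: eq_integrableR (H _ _ _) => //.
- by move=> x; rewrite normrN1 mulr1 mulN1r addr0.
- apply: measurable_funD => //; exact: measurable_funM.
Qed.

Lemma Rintegral_split f : integrableR f ->
  Rintegral mu setT f =
  Rintegral mu (@Rpos R) f + Rintegral mu (@Rpos R) (fun x => f (- x)).
Proof.
move=> fi; have mf := integrableR_measurable fi.
have mN : measurable (~` @Rpos R) by apply: measurableC; exact: Rpos_measurable.
have -> : Rintegral mu setT f =
    Rintegral mu (@Rpos R) f + Rintegral mu (~` @Rpos R) f.
  rewrite -(setUv (@Rpos R)) Rintegral_setU//.
  - exact: Rpos_measurable.
  - by rewrite setUv.
  - by rewrite disj_set2E setICr.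
congr (_ + _).
rewrite Rintegral_mkcond -Rintegral_opp; last first.
  by apply/(measurable_restrictT _ _).1 => //; exact: measurable_funTS.
(* Reflection sends the complement of the open half-line to the closed half-line; the endpoint 0 is
   dropped at the end as a null set. *)
have -> : (fun x => (f \_ (~` @Rpos R)) (- x)) = ((fun x => f (- x)) \_ `[0, +oo[).
  apply/funext => x; rewrite !patchE; congr (if _ then _ else _).
  apply/idP/idP => /set_mem; rewrite /Rpos /= in_itv /= andbT.
    rewrite oppr_gt0 => /negP; rewrite -leNgt => x0; apply/mem_set.
    by rewrite /= in_itv /= x0.
  move=> x0; apply/mem_set; rewrite /Rpos /= in_itv /= andbT oppr_gt0.
  by apply/negP; rewrite -leNgt.
transitivity (Rintegral mu `[0, +oo[ (fun x => f (- x))).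
  by rewrite [RHS]Rintegral_mkcond.
apply/esym; rewrite /Rpos; apply: Rintegral_itv_obnd_cbnd.
by apply: integrableS (integrableR_opp fi) => //; exact: measurable_itv.
Qed.

Lemma integrable_exp_pos e : 0 < e ->
  mu.-integrable `[0, +oo[ (fun x => (expR (- (e * x)))%:E).
Proof.
move=> e0; have H := integrable_exponential_pdf e0.
have {}H := (integrable_mkcondR (fun x => e * expR (- e * x))
  (measurable_itv `[0, +oo[)).2 H.
have := integrableZl (mu := mu) (measurable_itv _) e^-1 H.
congr (_.-integrable _ _); apply/funext => x.
by rewrite -EFinM mulrA mulVf ?gt_eqF// mul1r mulNr.
Qed.

Lemma integrableR_exp_abs e : 0 < e -> integrableR (fun x => expR (- (e * `|x|))).
Proof.
move=> e0.
have mC : measurable_fun setT (fun x : R => expR (- (e * `|x|))).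
  have m1 : measurable_fun setT (fun x : R => e * `|x|).
    by apply: measurable_funM => //; exact: measurableT_comp.
  apply: (measurableT_comp (f := expR)); first exact: measurable_expR.
  exact: (measurable_funN m1).
pose p := fun x => (fun x => expR (- (e * x))) \_ `[0, +oo[ x.
have ip : integrableR p.
  exact: (integrable_mkcondR _ (measurable_itv `[0, +oo[)).1 (integrable_exp_pos e0).
apply: (integrableR_le mC _ (integrableRD ip (integrableR_opp ip))) => x.
rewrite ger0_norm ?expR_ge0// /p !patchE.
have [x0|x0] := leP 0 x.
  rewrite (ger0_norm x0) mem_set; last by rewrite /= in_itv /= x0.
  by rewrite lerDl; case: ifP => // _; exact: expR_ge0.
rewrite [X in _ <= _ + X]ifT; last first.
  by apply/mem_set; rewrite /= in_itv /= oppr_ge0 ltW.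
by rewrite (ltr0_norm x0) lerDr; case: ifP => // _; exact: expR_ge0.
Qed.

Lemma cvg_expRNn e : 0 < e -> expR (- (e * n%:R)) @[n --> \oo] --> (0 : R).
Proof.
move=> e0.
have -> : (fun n : nat => expR (- (e * n%:R))) = (fun n => (expR (- e)) ^+ n).
  by apply/funext => n; rewrite -expRM_natl; congr expR; rewrite mulrN mulrC.
by apply: cvg_expr; rewrite ger0_norm ?expR_ge0// expR_lt1 oppr_lt0.
Qed.

Lemma cvgM_bounded0 (u v : nat -> R) (C : R) : u n @[n --> \oo] --> 0 ->
  (forall n, `|v n| <= C) -> u n * v n @[n --> \oo] --> 0.
Proof.
move=> u0 vC; apply: norm_cvg0.
have H : `|u n| * C @[n --> \oo] --> 0.
  have := cvgM (cvg_norm u0) (cvg_cst C); rewrite normr0 mul0r; exact.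
apply: squeeze_cvgr (cvg_cst 0) H; apply: nearW => n.
by rewrite normr_ge0 normrM ler_wpM2l.
Qed.

Lemma Rintegral_exp_cos e d : 0 < e ->
  Rintegral mu (@Rpos R) (fun x => expR (- (e * x)) * cos (x * d)) =
  e / (e ^+ 2 + d ^+ 2).
Proof.
move=> e0; have D0 : e ^+ 2 + d ^+ 2 != 0.
  by rewrite gt_eqF// ltr_pwDl ?exprn_gt0// sqr_ge0.
(* The antiderivative is the real part of exp((-e + i d) x) / (-e + i d). *)
pose F x := (e ^+ 2 + d ^+ 2)^-1 *
  (expR (- (e * x)) * (d * sin (x * d) + - (e * cos (x * d)))).
pose f x := expR (- (e * x)) * cos (x * d).
have dF (x : R) : is_derive x 1 F (f x).
  rewrite /F /f; eapply is_derive_eq; first by derive_fun.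
  by rewrite /=; field.
have cf : continuous f.
  by apply: is_derive_continuous => x; rewrite /f; eexists; derive_fun.
have fi : mu.-integrable `[0, +oo[ (fun x => (f x)%:E).
  apply/(integrable_mkcondR _ (measurable_itv _)).
  apply: (integrableR_le _ _
    ((integrable_mkcondR _ (measurable_itv _)).1 (integrable_exp_pos e0))).
    apply/(measurable_restrictT _ _).1 => //.
    by apply: measurable_funTS; exact: continuous_measurable_fun.
  move=> x; rewrite !patchE; case: ifP => _; last by rewrite normr0.
  rewrite /f normrM ger0_norm ?expR_ge0// ler_piMr ?expR_ge0//.
  by rewrite ler_norml cos_geN1 cos_le1.
have Fl : F n%:R @[n --> \oo] --> 0.
  rewrite /F -(mulr0 (e ^+ 2 + d ^+ 2)^-1); apply: cvgM; first exact: cvg_cst.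
  apply: (@cvgM_bounded0 _ _ (`|d| + `|e|)); first exact: cvg_expRNn.
  move=> n; rewrite (le_trans (ler_normD _ _))// normrN !normrM lerD//.
    by rewrite ler_piMr// ler_norml sin_geN1 sin_le1.
  by rewrite ler_piMr// ler_norml cos_geN1 cos_le1.
have := Rintegral_itvy_FTC cf fi dF Fl.
rewrite -Rintegral_itv_obnd_cbnd; last first.
  by apply: integrableS fi => //; [exact: measurable_itv..|apply: subset_itvr; rewrite bnd_simp].
rewrite /f /F /Rpos => ->.
by rewrite mulr0 oppr0 expR0 mul0r sin0 cos0; field.
Qed.

Lemma cint_exp_abs e d : 0 < e ->
  cint (fun x => RtoC (expR (- (e * `|x|))) * cexpi (x * d)) =
  RtoC (2 * (e / (e ^+ 2 + d ^+ 2))).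
Proof.
move=> e0; have ie := integrableR_exp_abs e0.
have mC : measurable_fun setT (fun x : R => expR (- (e * `|x|))).
  exact: integrableR_measurable.
have mxd : measurable_fun setT (fun x : R => x * d) by exact: measurable_funM.
have mE : cmeasurable (fun x : R => RtoC (expR (- (e * `|x|))) * cexpi (x * d)).
  by apply: cmeasurableM; [exact: cmeasurable_RtoC|exact: cmeasurable_expi].
have [ir ii] : cintegrable (fun x : R => RtoC (expR (- (e * `|x|))) * cexpi (x * d)).
  apply: (cintegrable_le mE _ ie) => x.
  by rewrite cabsM cabs_expi cabsR mulr1 ger0_norm ?expR_ge0.
apply: complex_ext => /=.
  rewrite Rintegral_split// -[RHS]/(2 * _) mulr_natl mulr2n.
  rewrite -(Rintegral_exp_cos d e0); congr (_ + _).
    apply: eq_Rintegral => x; rewrite inE /Rpos /= in_itv /= andbT => x0.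
    by rewrite mul0r subr0 gtr0_norm.
  apply: eq_Rintegral => x; rewrite inE /Rpos /= in_itv /= andbT => x0.
  by rewrite mul0r subr0 normrN gtr0_norm// mulNr cosN.
set I := Rintegral _ _ _.
(* The imaginary part of the integrand is odd. *)
have : I = - I.
  rewrite {1}/I -Rintegral_opp; last exact: (integrableR_measurable ii).
  rewrite -mulN1r -RintegralZl//; apply: eq_Rintegral => x _.
  by rewrite !mul0r !addr0 normrN !mulNr sinN mulrN mul1r.
by move=> H; lra.
Qed.

(** The Poisson kernel of the half-plane at height [e]: (2 pi)^-1 times the integral computed in
    [cint_exp_abs]. *)
Definition poisson e d := pi^-1 * (e / (e ^+ 2 + d ^+ 2)).

Lemma poisson_ge0 e d : 0 < e -> 0 <= poisson e d.
Proof.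
move=> e0; rewrite mulr_ge0 ?invr_ge0 ?pi_ge0// divr_ge0 ?ltW//.
by rewrite ltr_pwDl ?exprn_gt0// sqr_ge0.
Qed.

Lemma integral_oneDsqr : (\int[mu]_x ((oneDsqr x)^-1)%:E = pi%:E)%E.
Proof.
rewrite ge0_symfun_integralT.
- have -> : [set x : R | 0 <= x] = `[0, +oo[%classic by rewrite set_itvcy.
  by rewrite integral0y_oneDsqr -EFinM; congr EFin; field.
- by move=> x; rewrite invr_ge0.
- exact: continuous_oneDsqrV.
- by move=> x /=; rewrite /oneDsqr sqrrN.
Qed.

Lemma measurable_poisson e : 0 < e -> measurable_fun setT (poisson e).
Proof.
move=> e0; apply: measurable_funM => //; apply: measurable_funM => //.
apply: continuous_measurable_fun => x; apply: cvgV.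
  by rewrite gt_eqF// ltr_pwDl ?exprn_gt0// sqr_ge0.
by apply: cvgD; [exact: cvg_cst|exact: exprn_continuous].
Qed.

(** Scaling by [e] leads to the fixed density 1 / (pi (1 + u^2)), which gives the total mass of the
    kernel and later a majorant independent of [e]. *)
Lemma poisson_scale e u : 0 < e ->
  poisson e (e * u) * e = pi^-1 * (oneDsqr u)^-1.
Proof.
move=> e0; rewrite /poisson /oneDsqr.
have D : 1 + u ^+ 2 != 0 by rewrite gt_eqF// ltr_pwDl ?sqr_ge0.
have -> : e ^+ 2 + (e * u) ^+ 2 = e * e * (1 + u ^+ 2) by ring.
rewrite -mulrA; congr (_ * _); field.
by rewrite D gt_eqF.
Qed.

Lemma integral_poisson e s : 0 < e ->
  (\int[mu]_t (poisson e (t - s))%:E = 1)%E.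
Proof.
move=> e0; have ene : e != 0 by rewrite gt_eqF.
have mp : measurable_fun setT (fun t : R => (poisson e (t - s))%:E).
  apply/measurable_EFinP; apply: (measurableT_comp (measurable_poisson e0)).
  exact: measurable_funB.
rewrite -(substitution_affine s ene) //; last first.
  by move=> x; rewrite lee_fin poisson_ge0.
have mo : measurable_fun setT (fun x : R => (oneDsqr x)^-1).
  by apply: continuous_measurable_fun; exact: continuous_oneDsqrV.
have H : (\int[mu]_x (pi^-1%:E * ((oneDsqr x)^-1)%:E) = 1)%E.
  rewrite ge0_integralZl//=.
  - by rewrite integral_oneDsqr -EFinM mulVf ?gt_eqF ?pi_gt0.
  - by apply/measurable_EFinP.
  - by rewrite lee_fin invr_ge0 pi_ge0.
rewrite -[RHS]H; apply: eq_integral => u _.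
by rewrite -!EFinM gtr0_norm// addrK poisson_scale.
Qed.

Lemma integrableR_poisson e s : 0 < e -> integrableR (fun t => poisson e (t - s)).
Proof.
move=> e0; apply/integrableP; split.
  apply/measurable_EFinP; apply: (measurableT_comp (measurable_poisson e0)).
  exact: measurable_funB.
under eq_integral do rewrite /= ger0_norm ?poisson_ge0//.
by rewrite integral_poisson// ltry.
Qed.

End PoissonKernel.



(** * Fourier transform of integrable functions *)
Section FourierTransform.
Context {R : realType}.
Local Notation mu := (@lebesgue_measure R).
Local Notation c := (@isqrt2pi R).
Implicit Types (f g h : R -> R[i]) (rho : R -> R) (e m s t : R).

Definition FT f m : R[i] := RtoC c * cint (fun s => f s * cexpi (m * s)).

Lemma isqrt2pi_gt0 : 0 < c.
Proof. by rewrite invr_gt0 sqrtr_gt0 mulr_gt0// pi_gt0. Qed.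

Lemma isqrt2pi_sqr : c ^+ 2 = (2 * pi)^-1.
Proof. by rewrite exprVn sqr_sqrtr// mulr_ge0// pi_ge0. Qed.

Lemma cmeasurable_snd f : cmeasurable f ->
  cmeasurable (fun p : R * R => f p.2).
Proof. by move=> mf; apply: cmeasurable_comp mf _; exact: measurable_snd. Qed.

Lemma cmeasurable_fst f : cmeasurable f ->
  cmeasurable (fun p : R * R => f p.1).
Proof. by move=> mf; apply: cmeasurable_comp mf _; exact: measurable_fst. Qed.

Lemma cmeasurable_kernel : cmeasurable (fun p : R * R => cexpi (p.1 * p.2)).
Proof.
apply: cmeasurable_expi; apply: measurable_funM.
  exact: measurable_fst.
exact: measurable_snd.
Qed.

Lemma cmeasurable_expiM m : cmeasurable (fun s => cexpi (m * s)).
Proof. by apply: cmeasurable_expi; exact: measurable_funM. Qed.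

Lemma cintegrableM_expi f m : cintegrable f ->
  cintegrable (fun s => f s * cexpi (m * s)).
Proof.
move=> fi; have mf := cintegrable_measurable fi.
apply: (cintegrable_le _ _ (integrable_cabs fi)).
  by apply: cmeasurableM => //; exact: cmeasurable_expiM.
by move=> s; rewrite cabsM cabs_expi mulr1.
Qed.

Lemma cmeasurable_FT f : cmeasurable f -> cmeasurable (FT f).
Proof.
move=> mf; apply: cmeasurableM; first exact: cmeasurable_cst.
apply: (cmeasurable_parametric_Cint (F := fun p => f p.2 * cexpi (p.1 * p.2))).
by apply: cmeasurableM; [exact: cmeasurable_snd|exact: cmeasurable_kernel].
Qed.

Lemma FTD (a : R[i]) f g m : cintegrable f -> cintegrable g ->
  FT (fun s => a * f s + g s) m = a * FT f m + FT g m.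
Proof.
move=> fi gi; rewrite /FT.
under eq_cint do rewrite mulrDl -mulrA.
rewrite cintD; last 2 first.
- by apply: cintegrableZ; exact: cintegrableM_expi.
- exact: cintegrableM_expi.
rewrite cintZ; last exact: cintegrableM_expi.
by rewrite mulrDr mulrCA.
Qed.

Lemma FTB f g m : cintegrable f -> cintegrable g ->
  FT (fun s => f s - g s) m = FT f m - FT g m.
Proof.
move=> fi gi; rewrite -[RHS]addrC -mulN1r -FTD//.
by congr (FT _ m); apply/funext => s; rewrite mulN1r addrC.
Qed.

Lemma FT_bounded f : cintegrable f -> exists C, forall m, cabs (FT f m) <= C.
Proof.
move=> fi; have mf := cintegrable_measurable fi.
exists (c * (2 * Rintegral mu setT (fun s => cabs (f s)))) => m.
rewrite cabsM cabsR gtr0_norm ?isqrt2pi_gt0// ler_pM2l ?isqrt2pi_gt0//.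
apply: cabs_cint_le (integrable_cabs fi).
  by apply: cmeasurableM => //; exact: cmeasurable_expiM.
by move=> s; rewrite cabsM cabs_expi mulr1.
Qed.

(** Fubini, the kernel having modulus a constant times |g m| |f s|. Conjugation changes the sign of
    the exponent, hence the reflected argument [- s]. *)
Lemma FT_adjoint f g : cintegrable f -> cintegrable g ->
  cint (fun m => FT f m * cconj (g m)) = cint (fun s => f s * cconj (FT g (- s))).
Proof.
move=> fi gi.
have mf := cintegrable_measurable fi; have mg := cintegrable_measurable gi.
pose F (p : R * R) := RtoC c * cconj (g p.1) * (f p.2 * cexpi (p.1 * p.2)).
have mF : cmeasurable F.
  apply: cmeasurableM.
    apply: cmeasurableM; first exact: cmeasurable_cst.
    by apply: cmeasurable_conj; exact: cmeasurable_fst.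
  by apply: cmeasurableM; [exact: cmeasurable_snd|exact: cmeasurable_kernel].
have FE m s : cabs (F (m, s)) <= c * cabs (g m) * cabs (f s).
  rewrite /F /= !cabsM cabs_expi mulr1 cabs_conj cabsR gtr0_norm//.
  exact: isqrt2pi_gt0.
transitivity (cint (fun m => cint (fun s => F (m, s)))).
  apply: eq_cint => m; rewrite /F /= cintZ; last exact: cintegrableM_expi.
  by rewrite /FT mulrAC.
rewrite (cint_fubini mF FE); last 2 first.
- exact/integrableRZ/integrable_cabs.
- exact: integrable_cabs.
apply: eq_cint => s; rewrite /F /= /FT.
transitivity (cint (fun m => f s * (RtoC c * cconj (g m * cexpi (- s * m))))).
  apply: eq_cint => m; rewrite cconjM mulNr -cexpiN opprK (mulrC m s).
  by rewrite mulrCA !mulrA.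
have ig := cintegrableM_expi (- s) gi.
have igc : cintegrable (fun m => cconj (g m * cexpi (- s * m))).
  apply: (cintegrable_le _ _ (integrable_cabs ig)).
    exact/cmeasurable_conj/cintegrable_measurable.
  by move=> m; rewrite cabs_conj.
rewrite cintZ; last exact: cintegrableZ.
by rewrite cintZ// cint_conj// cconjM cconjR.
Qed.

(** Inversion with a summability factor: [rho] makes the double integral absolutely convergent, and
    exchanging the order leaves [g] convolved with the transform of [rho]. *)
Lemma FT_convolution g rho s : cintegrable g -> integrableR rho ->
  FT (fun m => RtoC (rho m) * FT g m) (- s) =
  RtoC (c ^+ 2) *
  cint (fun t => g t * cint (fun m => RtoC (rho m) * cexpi (m * (t - s)))).
Proof.
move=> gi ri; have mg := cintegrable_measurable gi.
have mr := integrableR_measurable ri.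
pose F (p : R * R) := RtoC (rho p.1) * cexpi (- s * p.1) *
  (RtoC c * (g p.2 * cexpi (p.1 * p.2))).
have mF : cmeasurable F.
  apply: cmeasurableM.
    apply: (cmeasurable_fst (f := fun m => RtoC (rho m) * cexpi (- s * m))).
    by apply: cmeasurableM; [exact: cmeasurable_RtoC|exact: cmeasurable_expiM].
  apply: cmeasurableM; first exact: cmeasurable_cst.
  by apply: cmeasurableM; [exact: cmeasurable_snd|exact: cmeasurable_kernel].
have FE m t : cabs (F (m, t)) <= `|rho m| * (c * cabs (g t)).
  rewrite /F /= !cabsM !cabs_expi !mulr1 !cabsR (gtr0_norm isqrt2pi_gt0).
  exact: lexx.
rewrite {1}/FT expr2 RtoCM -mulrA; congr (_ * _).
transitivity (cint (fun m => cint (fun t => F (m, t)))).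
  apply: eq_cint => m; rewrite /F /=.
  rewrite cintZ; last by apply: cintegrableZ; exact: cintegrableM_expi.
  rewrite cintZ; last exact: cintegrableM_expi.
  by rewrite -/(FT g m) -mulrA [FT _ _ * _]mulrC mulrA.
rewrite (cint_fubini mF FE); last 2 first.
- exact: integrable_norm.
- exact/integrableRZ/integrable_cabs.
have ik t : cintegrable (fun m => RtoC (rho m) * cexpi (m * (t - s))).
  apply: (cintegrable_le _ _ (integrable_norm ri)).
    apply: cmeasurableM; first exact: cmeasurable_RtoC.
    by under eq_fun do rewrite mulrC; exact: cmeasurable_expiM.
  by move=> m; rewrite cabsM cabs_expi mulr1 cabsR.
transitivity (cint (fun t => RtoC c *
    (g t * cint (fun m => RtoC (rho m) * cexpi (m * (t - s)))))).
  apply: eq_cint => t; rewrite -cintZ//.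
  rewrite -cintZ; last exact: cintegrableZ.
  apply: eq_cint => m; rewrite /F /=.
  have -> : m * (t - s) = - s * m + m * t by ring.
  by rewrite cexpiD; ring.
rewrite cintZ//.
apply: (cintegrable_le _ _
  (integrableRZ (2 * Rintegral mu setT (fun m => `|rho m|)) (integrable_cabs gi))).
  apply: cmeasurableM => //.
  apply: (cmeasurable_parametric_Cint
    (F := fun p => RtoC (rho p.2) * cexpi (p.2 * (p.1 - s)))).
  apply: cmeasurableM.
    by apply: (cmeasurable_snd (f := fun m => RtoC (rho m))); exact: cmeasurable_RtoC.
  apply: cmeasurable_expi; apply: measurable_funM; first exact: measurable_snd.
  by apply: measurable_funB => //; exact: measurable_fst.
move=> t; rewrite cabsM mulrC ler_wpM2r ?cabs_ge0//.
apply: cabs_cint_le (integrable_norm ri).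
  exact: cintegrable_measurable (ik t).
by move=> m; rewrite cabsM cabs_expi mulr1 cabsR.
Qed.

Lemma FT_poisson g e s : 0 < e -> cintegrable g ->
  FT (fun m => RtoC (expR (- (e * `|m|))) * FT g m) (- s) =
  cint (fun t => g t * RtoC (poisson e (t - s))).
Proof.
move=> e0 gi; rewrite (FT_convolution s gi (integrableR_exp_abs e0)).
have mg := cintegrable_measurable gi.
under eq_cint do rewrite cint_exp_abs//.
rewrite -cintZ.
  apply: eq_cint => t; rewrite mulrCA -RtoCM isqrt2pi_sqr /poisson.
  congr (_ * RtoC _); rewrite invfM; set k := e / _.
  by rewrite mulrACA mulVf ?pnatr_eq0// mul1r.
apply: (cintegrable_le _ _ (integrableRZ (2 / e) (integrable_cabs gi))).
  apply: cmeasurableM => //; apply: cmeasurable_RtoC.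
  apply: measurable_funM => //; apply: measurable_funM => //.
  apply: continuous_measurable_fun => x; apply: cvgV.
    by rewrite gt_eqF// ltr_pwDl ?exprn_gt0// sqr_ge0.
  apply: cvgD; first exact: cvg_cst.
  apply: cvgM; (apply: cvgB; [exact: cvg_id|exact: cvg_cst]).
move=> t; rewrite cabsM cabsR mulrC ler_wpM2r ?cabs_ge0//.
have D0 : 0 < e ^+ 2 + (t - s) ^+ 2 by rewrite ltr_pwDl ?exprn_gt0// sqr_ge0.
rewrite ger0_norm; last by rewrite mulr_ge0// divr_ge0// ltW.
rewrite ler_pM2l// ler_pdivrMr// ler_pdivlMl// -expr2.
by rewrite lerDl sqr_ge0.
Qed.


Lemma poisson_le e s : 0 < e -> poisson e s <= (pi * e)^-1.
Proof.
move=> e0; rewrite invfM ler_pM2l ?invr_gt0 ?pi_gt0//.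
have D0 : 0 < e ^+ 2 + s ^+ 2 by rewrite ltr_pwDl ?exprn_gt0// sqr_ge0.
by rewrite ler_pdivrMr// ler_pdivlMl// -expr2 lerDl sqr_ge0.
Qed.

Definition poisson_smoothing e g s := cint (fun t => g t * RtoC (poisson e (t - s))).

Lemma cintegrable_poisson e g s : 0 < e -> cintegrable g ->
  cintegrable (fun t => g t * RtoC (poisson e (t - s))).
Proof.
move=> e0 gi; have mg := cintegrable_measurable gi.
apply: (cintegrable_le _ _ (integrableRZ (pi * e)^-1 (integrable_cabs gi))).
  apply: cmeasurableM => //; apply: cmeasurable_RtoC.
  apply: (measurableT_comp (measurable_poisson e0)).
  exact: measurable_funB.
move=> t; rewrite cabsM cabsR mulrC ler_wpM2r ?cabs_ge0//.
by rewrite ger0_norm ?poisson_ge0// poisson_le.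
Qed.

Lemma damped_FT_integrable e g : 0 < e -> cintegrable g ->
  cintegrable (fun m => RtoC (expR (- (e * `|m|))) * FT g m).
Proof.
move=> e0 gi; have mg := cintegrable_measurable gi.
have [C HC] := FT_bounded gi.
apply: (cintegrable_le _ _ (integrableRZ C (integrableR_exp_abs e0))).
  apply: cmeasurableM; last exact: cmeasurable_FT.
  apply: cmeasurable_RtoC; exact: (integrableR_measurable (integrableR_exp_abs e0)).
move=> m; rewrite cabsM cabsR mulrC ger0_norm ?expR_ge0//.
by rewrite ler_wpM2r ?expR_ge0.
Qed.

(** The adjunction moves one transform to the other factor, where [FT_poisson] makes it a smoothing
    of [g]. The damped energy can thus be estimated before FT g is known to be square integrable. *)
Lemma damped_norm e g : 0 < e -> cintegrable g ->
  Rintegral mu setT (fun m => expR (- (e * `|m|)) * cabs2 (FT g m)) =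
  rip g (poisson_smoothing e g).
Proof.
move=> e0 gi.
transitivity (Rintegral mu setT
  (fun m => Re (FT g m * cconj (RtoC (expR (- (e * `|m|))) * FT g m)))).
  apply: eq_Rintegral => m _; case: (FT g m) => a b.
  by rewrite /cabs2 /=; ring.
transitivity (Rintegral mu setT (fun s => Re (g s *
    cconj (FT (fun m => RtoC (expR (- (e * `|m|))) * FT g m) (- s))))).
  exact: (congr1 (@complex.Re R) (FT_adjoint gi (damped_FT_integrable e0 gi))).
by apply: eq_Rintegral => s _; rewrite FT_poisson.
Qed.

Lemma poisson_smoothing_measurable e g : 0 < e -> cintegrable g ->
  cmeasurable (poisson_smoothing e g).
Proof.
move=> e0 gi; have mg := cintegrable_measurable gi.
apply: (cmeasurable_parametric_Cint
  (F := fun p => g p.2 * RtoC (poisson e (p.2 - p.1)))).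
apply: cmeasurableM; first exact: cmeasurable_snd.
apply: cmeasurable_RtoC; apply: (measurableT_comp (measurable_poisson e0)).
by apply: measurable_funB; [exact: measurable_snd|exact: measurable_fst].
Qed.

Lemma poisson_smoothing_bounded e g : 0 < e -> cintegrable g ->
  exists C, forall s, cabs (poisson_smoothing e g s) <= C.
Proof.
move=> e0 gi; exists (2 * Rintegral mu setT (fun t => (pi * e)^-1 * cabs (g t))) => s.
apply: cabs_cint_le.
- exact: cintegrable_measurable (cintegrable_poisson s e0 gi).
- move=> t; rewrite cabsM cabsR mulrC ler_wpM2r ?cabs_ge0//.
  by rewrite ger0_norm ?poisson_ge0// poisson_le.
- exact/integrableRZ/integrable_cabs.
Qed.

(* Schur's test, in the form |g s||g t| <= (|g s|^2 + |g t|^2) / 2. *)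
Lemma rip_poisson_le e g : 0 < e -> cintegrable g -> L2R g ->
  rip g (poisson_smoothing e g) <= n2 g.
Proof.
move=> e0 gi lg; have mg := cintegrable_measurable gi; have [_ g2i] := lg.
have mpe t : measurable_fun setT (fun s : R => poisson e (t - s)).
  by apply: (measurableT_comp (measurable_poisson e0)); exact: measurable_funB.
have mp s : measurable_fun setT (fun t : R => poisson e (t - s)).
  by apply: (measurableT_comp (measurable_poisson e0)); exact: measurable_funB.
pose P s := Rintegral mu setT (fun t => cabs2 (g t) * poisson e (t - s)).
have iP s : integrableR (fun t => cabs2 (g t) * poisson e (t - s)).
  apply: (integrableR_le _ _ (integrableRZ (pi * e)^-1 g2i)).
    by apply: measurable_funM => //; exact: measurable_cabs2.
  move=> t; rewrite normrM mulrC !ger0_norm ?poisson_ge0 ?cabs2_ge0//.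
  by rewrite ler_wpM2r ?cabs2_ge0// poisson_le.
have P_ge0 s : 0 <= P s.
  by apply: Rintegral_ge0 => t _; rewrite mulr_ge0 ?cabs2_ge0 ?poisson_ge0.
have mF : measurable_fun setT (fun p : R * R => cabs2 (g p.2) * poisson e (p.2 - p.1)).
  apply: measurable_funM.
    by apply: (measurableT_comp (measurable_cabs2 mg)); exact: measurable_snd.
  apply: (measurableT_comp (measurable_poisson e0)).
  by apply: measurable_funB; [exact: measurable_snd|exact: measurable_fst].
have mP : measurable_fun setT P by exact: (measurable_parametric_Rintegral mF).
(* Tonelli exchanges the integrals, and since the kernel is even in t - s it has mass 1 in [s] as
   well. *)
have IP : (\int[mu]_s (P s)%:E = (n2 g)%:E)%E.
  transitivity (\int[mu]_s \int[mu]_t (cabs2 (g t) * poisson e (t - s))%:E)%E.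
    apply: eq_integral => s _; rewrite (integrableR_ge0 (iP s))//.
    by move=> t; rewrite mulr_ge0 ?cabs2_ge0 ?poisson_ge0.
  rewrite (fubini_tonelli (m1 := mu) (m2 := mu)
    (fun p : R * R => (cabs2 (g p.2) * poisson e (p.2 - p.1))%:E))//=; last 2 first.
  - exact/measurable_EFinP.
  - by move=> p; rewrite lee_fin mulr_ge0 ?cabs2_ge0 ?poisson_ge0.
  rewrite -L2R_n2//; apply: eq_integral => t _.
  under eq_integral do rewrite EFinM.
  rewrite ge0_integralZl//=; last 3 first.
  - by apply/measurable_EFinP; exact: mpe.
  - by move=> s _; rewrite lee_fin poisson_ge0.
  - by rewrite lee_fin cabs2_ge0.
  have -> : (\int[mu]_s (poisson e (t - s))%:E =
             \int[mu]_s (poisson e (s - t))%:E)%E.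
    by apply: eq_integral => s _; rewrite /poisson -(sqrrN (t - s)) opprB.
  by rewrite integral_poisson// mule1.
have iP' : integrableR P.
  apply/integrableP; split; first exact/measurable_EFinP.
  by under eq_integral do rewrite /= ger0_norm//; rewrite IP ltry.
have -> : n2 g = Rintegral mu setT (fun s => 2^-1 * cabs2 (g s) + 2^-1 * P s).
  rewrite RintegralD//; [|exact: integrableRZ|exact: integrableRZ].
  rewrite !RintegralZl//.
  have -> : Rintegral mu setT P = n2 g by rewrite /Rintegral IP.
  by rewrite -/(n2 g); field.
apply: le_Rintegral => //.
- have [C HC] := poisson_smoothing_bounded e0 gi.
  have mS := poisson_smoothing_measurable e0 gi.
  have [] : cintegrable (fun s => g s * cconj (poisson_smoothing e g s)).
    apply: (cintegrable_le _ _ (integrableRZ C (integrable_cabs gi))).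
      by apply: cmeasurableM => //; exact: cmeasurable_conj.
    move=> s; rewrite cabsM cabs_conj mulrC.
    by rewrite ler_wpM2r ?cabs_ge0.
  by [].
- by apply: integrableRD; exact: integrableRZ.
- move=> s _; rewrite /poisson_smoothing -cint_conj; last exact: cintegrable_poisson.
  have ipc : cintegrable (fun t => cconj (g t * RtoC (poisson e (t - s)))).
    apply: (cintegrable_le _ _ (integrable_cabs (cintegrable_poisson s e0 gi))).
      exact/cmeasurable_conj/cintegrable_measurable/cintegrable_poisson.
    by move=> t; rewrite cabs_conj.
  have iprod := cintegrableZ (g s) ipc.
  rewrite -cintZ// /=.
  have -> : 2^-1 * cabs2 (g s) + 2^-1 * P s = Rintegral mu setT
      (fun t => 2^-1 * cabs2 (g s) * poisson e (t - s) +
        2^-1 * (cabs2 (g t) * poisson e (t - s))).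
    have ip := integrableR_poisson s e0.
    rewrite RintegralD//; [|exact: integrableRZ|exact: integrableRZ].
    rewrite (RintegralZl _ measurableT ip) (RintegralZl _ measurableT (iP s)) -/(P s).
    have -> : Rintegral mu setT (fun t => poisson e (t - s)) = 1.
      by rewrite /Rintegral integral_poisson.
    by rewrite mulr1.
  apply: le_Rintegral => //.
  + by case: iprod.
  + apply: integrableRD; apply: integrableRZ => //.
    exact: integrableR_poisson.
  + move=> t _; rewrite cconjM cconjR mulrA mulrC cReIm /= mul0r subr0.
    have -> : 2^-1 * cabs2 (g s) * poisson e (t - s) +
        2^-1 * (cabs2 (g t) * poisson e (t - s)) =
        poisson e (t - s) * (2^-1 * (cabs2 (g s) + cabs2 (g t))) by ring.
    rewrite ler_wpM2l ?poisson_ge0// !cReIm /= /cabs2.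
    set a := complex.Re (g s); set b := complex.Im (g s).
    set a' := complex.Re (g t); set b' := complex.Im (g t).
    rewrite -subr_ge0.
    have -> : 2^-1 * (a ^+ 2 + b ^+ 2 + (a' ^+ 2 + b' ^+ 2)) - (a * a' - b * - b') =
       2^-1 * ((a - a') ^+ 2 + (b - b') ^+ 2) by field.
    by rewrite mulr_ge0// addr_ge0 ?sqr_ge0.
Qed.

Lemma expR_Nharmonic_le1 n m : expR (- (n.+1%:R^-1 / 2 * `|m|)) <= 1.
Proof. by rewrite expR_le1 oppr_le0 mulr_ge0// divr_ge0// invr_ge0. Qed.

Lemma ccvg_damping m (z : R[i]) :
  ccvg (fun n => RtoC (expR (- (n.+1%:R^-1 / 2 * `|m|))) * z) z.
Proof.
have H : n.+1%:R^-1 / 2 * `|m| @[n --> \oo] --> (0 : R) / 2 * `|m|.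
  apply: cvgM; last exact: cvg_cst.
  by apply: cvgM; [exact: cvg_harmonic|exact: cvg_cst].
rewrite !mul0r in H.
have {}H : expR (- (n.+1%:R^-1 / 2 * `|m|)) @[n --> \oo] --> expR (- 0 : R).
  by apply: continuous_cvg; [exact: continuous_expR|exact: cvgN].
rewrite oppr0 expR0 in H.
by have := ccvgM (ccvg_RtoC H) (ccvg_cst z); rewrite RtoC1 mul1r.
Qed.

(** The modulus is squared, so halving the damping rate gives the energy the rate [n.+1%:R^-1] to
    which [damped_norm] applies. *)
Lemma cabs2_damped n m (z : R[i]) :
  cabs2 (RtoC (expR (- (n.+1%:R^-1 / 2 * `|m|))) * z) =
  expR (- (n.+1%:R^-1 * `|m|)) * cabs2 z.
Proof.
rewrite cabs2M cabs2R; congr (_ * _); rewrite expr2 -expRD; congr expR.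
by set k := n.+1%:R^-1; field.
Qed.

Lemma L2R_damped_FT n g : cintegrable g ->
  L2R (fun m => RtoC (expR (- (n.+1%:R^-1 / 2 * `|m|))) * FT g m).
Proof.
move=> gi; have mg := cintegrable_measurable gi.
have e0 : 0 < n.+1%:R^-1 :> R by rewrite invr_gt0 ltr0n.
have e20 : 0 < n.+1%:R^-1 / 2 :> R by rewrite divr_gt0.
have [C HC] := FT_bounded gi.
have mF : cmeasurable (fun m => RtoC (expR (- (n.+1%:R^-1 / 2 * `|m|))) * FT g m).
  exact: cintegrable_measurable (damped_FT_integrable e20 gi).
apply: (L2R_le mF _ (integrableRZ (C ^+ 2) (integrableR_exp_abs e0))) => m.
rewrite cabs2_damped mulrC ler_wpM2r ?expR_ge0// -cabs_sqr.
by rewrite ler_sqr ?nnegrE ?cabs_ge0// (le_trans (cabs_ge0 _) (HC m)).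
Qed.

Lemma n2_damped_FT n g : cintegrable g ->
  n2 (fun m => RtoC (expR (- (n.+1%:R^-1 / 2 * `|m|))) * FT g m) =
  rip g (poisson_smoothing n.+1%:R^-1 g).
Proof.
move=> gi; rewrite -damped_norm//; apply: eq_Rintegral => m _.
by rewrite cabs2_damped.
Qed.

(** The damped energies are at most n2 g uniformly, by [rip_poisson_le], and Fatou removes the
    damping. *)
Lemma FT_contraction g : cintegrable g -> L2R g ->
  L2R (FT g) /\ n2 (FT g) <= n2 g.
Proof.
move=> gi lg; have mg := cintegrable_measurable gi.
apply: (n2_fatou (fs := fun n m =>
  RtoC (expR (- (n.+1%:R^-1 / 2 * `|m|))) * FT g m)).
- by move=> n; exact: L2R_damped_FT.
- by apply: aeW => m; exact: ccvg_damping.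
- exact: cmeasurable_FT.
- by apply: nearW => n; rewrite n2_damped_FT// rip_poisson_le.
Qed.

(** FT g, now known to be square integrable, dominates its damped versions, so Fatou's inequality
    becomes a limit. *)
Lemma cvg_rip_poisson g : cintegrable g -> L2R g ->
  rip g (poisson_smoothing n.+1%:R^-1 g) @[n --> \oo] --> n2 (FT g).
Proof.
move=> gi lg; have [lF _] := FT_contraction gi lg.
under eq_fun do rewrite -n2_damped_FT//.
apply: cvg_n2 => //; first by move=> n; exact: L2R_damped_FT.
apply: (n2_dominated_cvg (k := fun m => cabs2 (FT g m))).
- by move=> n; case: (L2R_damped_FT n gi).
- by move=> m; exact: ccvg_damping.
- move=> n m; set r := expR _.
  have -> : RtoC r * FT g m - FT g m = RtoC (r - 1) * FT g m.
    by rewrite RtoCD mulrDl; congr (_ + _); apply: complex_ext; rewrite ?cReIm /=; ring.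
  rewrite cabs2M cabs2R ler_piMl ?cabs2_ge0//.
  rewrite -sqrrN opprB expr_le1// ?subr_ge0 ?expR_Nharmonic_le1//.
  by rewrite gerBl expR_ge0.
- by case: lF.
Qed.

End FourierTransform.



(** * Plancherel theorem *)
Section Plancherel.
Context {R : realType}.
Local Notation mu := (@lebesgue_measure R).
Implicit Types (f g h : R -> R[i]) (e m s t : R).

Lemma cint_affine f (a b : R) : a != 0 -> cmeasurable f ->
  cint (fun s => f (a * s + b) * RtoC `|a|) = cint f.
Proof.
move=> a0 [mr mi]; apply: complex_ext => /=.
  rewrite -(Rintegral_substitution (substitution_affine b a0) (fun=> normr_ge0 a) mr).
  by apply: eq_Rintegral => s _; rewrite cReIm /= mulr0 subr0.
rewrite -(Rintegral_substitution (substitution_affine b a0) (fun=> normr_ge0 a) mi).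
by apply: eq_Rintegral => s _; rewrite cReIm /= mulr0 add0r.
Qed.

Lemma poisson_smoothing_le e f (M : R) s : 0 < e -> cintegrable f ->
  (forall s, cabs (f s) <= M) -> cabs (poisson_smoothing e f s) <= 2 * M.
Proof.
move=> e0 fi fM.
have H : Rintegral mu setT (fun t => M * poisson e (t - s)) = M.
  rewrite (RintegralZl _ measurableT (integrableR_poisson s e0)).
  by rewrite /Rintegral integral_poisson// mulr1.
rewrite -[X in _ <= 2 * X]H; apply: cabs_cint_le.
- exact: cintegrable_measurable (cintegrable_poisson s e0 fi).
- move=> t; rewrite cabsM cabsR ger0_norm ?poisson_ge0//.
  by rewrite ler_wpM2r ?poisson_ge0.
- exact/integrableRZ/integrableR_poisson.
Qed.

Definition ccontinuous_at f s :=
  {for s, continuous (fun t => Re (f t))} /\ {for s, continuous (fun t => Im (f t))}.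

Lemma integrableR_oneDsqrV : integrableR (fun u : R => pi^-1 * (oneDsqr u)^-1).
Proof.
have mo : measurable_fun setT (fun x : R => (oneDsqr x)^-1).
  by apply: continuous_measurable_fun; exact: continuous_oneDsqrV.
apply: integrableRZ; apply/integrableP; split; first exact/measurable_EFinP.
under eq_integral do rewrite /= ger0_norm ?invr_ge0//.
by rewrite integral_oneDsqr ltry.
Qed.

(** After scaling the kernel no longer depends on [n]; only the argument s + u / (n + 1) moves, and
    dominated convergence applies with majorant [M * k u]. *)
Lemma cvg_poisson_smoothing f (M : R) s : cintegrable f ->
  (forall s, cabs (f s) <= M) -> ccontinuous_at f s ->
  ccvg (fun n => poisson_smoothing n.+1%:R^-1 f s) (f s).
Proof.
move=> fi fM [cr ci]; have mf := cintegrable_measurable fi.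
pose k (u : R) := pi^-1 * (oneDsqr u)^-1.
have ik : integrableR k by exact: integrableR_oneDsqrV.
have k0 (u : R) : 0 <= k u by rewrite mulr_ge0 ?invr_ge0 ?pi_ge0.
have E n : poisson_smoothing n.+1%:R^-1 f s =
    cint (fun u => f (n.+1%:R^-1 * u + s) * RtoC (k u)).
  have e0 : 0 < n.+1%:R^-1 :> R by rewrite invr_gt0 ltr0n.
  rewrite /poisson_smoothing -(@cint_affine _ n.+1%:R^-1 s); last 2 first.
  - by rewrite gt_eqF.
  - exact: cintegrable_measurable (cintegrable_poisson s e0 fi).
  apply: eq_cint => u; rewrite -mulrA -RtoCM addrK gtr0_norm//.
  by rewrite poisson_scale.
(* The density [k] has mass 1. *)
have -> : f s = cint (fun u => f s * RtoC (k u)).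
  have H : cintegrable (fun u => RtoC (k u)).
    by split => //=; exact: (integrableRZ 0 ik) || exact: integrable0.
  rewrite cintZ// -[LHS]mulr1; congr (_ * _); apply: complex_ext => /=.
    rewrite (RintegralZl _ measurableT); last first.
      have := integrableRZ pi ik; apply: eq_integrableR => u.
      by rewrite /k mulrA mulfV ?mul1r// gt_eqF// pi_gt0.
    by rewrite /Rintegral integral_oneDsqr /= mulVf// gt_eqF// pi_gt0.
  by rewrite Rintegral_cst// mul0r.
under eq_fun do rewrite E.
apply: (cint_dominated_cvg (k := fun u => M * k u)).
- move=> n; apply: cmeasurableM.
    by apply: cmeasurable_comp mf _; exact: measurable_funD.
  by apply: cmeasurable_RtoC; exact: integrableR_measurable.
- move=> u; apply: ccvgM; last exact: ccvg_cst.
  have H : n.+1%:R^-1 * u + s @[n --> \oo] --> s.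
    rewrite -[X in _ --> X]add0r; apply: cvgD; last exact: cvg_cst.
    rewrite -(mul0r u); apply: cvgM; last exact: cvg_cst.
    exact: cvg_harmonic.
  by split; [exact: (cvg_comp _ _ H cr)|exact: (cvg_comp _ _ H ci)].
- move=> n u; rewrite cabsM cabsR ger0_norm//.
  by rewrite ler_wpM2r.
- exact: integrableRZ.
Qed.

(** Smoothing converges at points of continuity, and where [f] vanishes the integrand of [rip] is 0
    whatever the smoothing does. The alternative admits continuous functions cut off sharply at the
    ends of an interval. *)
Lemma FT_isometry_nice f (M : R) : cintegrable f -> L2R f ->
  (forall s, cabs (f s) <= M) -> (forall s, f s = 0 \/ ccontinuous_at f s) ->
  n2 (FT f) = n2 f.
Proof.
move=> fi lf fM fc; have mf := cintegrable_measurable fi.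
have H1 := cvg_rip_poisson fi lf.
have e0 n : 0 < n.+1%:R^-1 :> R by rewrite invr_gt0 ltr0n.
have H2 : rip f (poisson_smoothing n.+1%:R^-1 f) @[n --> \oo] --> n2 f.
  rewrite -rip_self; apply: (Rintegral_dominated_cvg (k := fun s => 2 * M * cabs (f s))).
  - move=> n; have [] : cmeasurable (fun s => f s * cconj (poisson_smoothing n.+1%:R^-1 f s)).
      apply: cmeasurableM => //; apply: cmeasurable_conj.
      exact: poisson_smoothing_measurable.
    by [].
  - move=> s; have [fs0|fs] := fc s.
      by rewrite fs0 mul0r; under eq_fun do rewrite mul0r; exact: cvg_cst.
    have [] : ccvg (fun n => f s * cconj (poisson_smoothing n.+1%:R^-1 f s))
        (f s * cconj (f s)).
      apply: ccvgM; first exact: ccvg_cst.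
      have [hr hi] := cvg_poisson_smoothing fi fM fs.
      by split => //=; exact: cvgN.
    by [].
  - move=> n s; rewrite (le_trans (normRe_le _))// cabsM cabs_conj mulrC.
    by rewrite ler_wpM2r ?cabs_ge0// poisson_smoothing_le.
  - exact/integrableRZ/integrable_cabs.
by rewrite -(cvg_lim (@Rhausdorff R) H1) (cvg_lim (@Rhausdorff R) H2).
Qed.

(** * Density of nice functions in L^2 *)

Lemma bounded_continuous_approx (N : nat) (u : R -> R) (M e : R) : measurable_fun setT u ->
  (forall x, `|u x| <= M) -> 0 < e ->
  exists p : R -> R, [/\ continuous p, forall x, `|p x| <= M &
    Rintegral mu `]- N%:R, N%:R[ (fun x => `|u x - p x|) <= e].
Proof.
move=> mu_ uM e0; have M0 : 0 <= M by rewrite (le_trans _ (uM 0)).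
set E := `]- N%:R, N%:R[%classic.
have mE : measurable E by exact: measurable_itv.
have Efin : (mu E < +oo)%E.
  by rewrite /E lebesgue_measure_itv/=; case: ifP => _; rewrite -?EFinB ltry.
have ui : mu.-integrable E (EFin \o u).
  apply: measurable_bounded_integrable => //; first exact: measurable_funTS.
  by exists M; split; rewrite ?num_real// => x Mx y _; exact: le_trans (uM y) (ltW Mx).
have [q [cq qi qcv]] := approximation_continuous_integrable mE Efin ui.
have : \forall n \near \oo, (\int[mu]_(z in E) `|(u z - q n z)%:E| < e%:E)%E.
  move/fine_cvgP : qcv => [qf /cvgrPdist_lt /(_ _ e0)].
  apply: filterS2 qf => n qf; rewrite sub0r normrN => H.
  by rewrite -(fineK qf) lte_fin (le_lt_trans _ H)// ler_norm.
move=> [n _ /(_ n (leqnn n)) qn].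
(* Clipping to [-M, M] preserves continuity and does not increase the distance to [u], whose values
   lie there. *)
pose p x := Num.max (- M) (Num.min M (q n x)).
have pM x : `|p x| <= M.
  rewrite ler_norml /p le_max lexx /= ge_max ge_min lexx /=.
  by rewrite andbT ge0_cp.
have upq x : `|u x - p x| <= `|u x - q n x|.
  have := uM x; rewrite ler_norml => /andP[u1 u2]; rewrite /p.
  have [qM|Mq] := leP M (q n x).
    rewrite (max_idPr _); last by rewrite ge0_cp.
    by rewrite ler0_norm ?subr_le0// ler0_norm ?subr_le0 ?(le_trans u2)// lerN2 lerD2l lerN2.
  have [Mq'|qM'] := leP (- M) (q n x) => //.
  rewrite ger0_norm ?subr_ge0// ger0_norm ?subr_ge0; last exact: le_trans (ltW qM') u1.
  by rewrite lerD2l lerN2 ltW.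
have cp : continuous p.
  move=> x; apply: (@continuous_max _ _ (cst (- M)) (fun x => Num.min M (q n x))).
    exact: cst_continuous.
  apply: (@continuous_min _ _ (cst M) (q n)); first exact: cst_continuous.
  exact: cq.
exists p; split => //.
have mp : measurable_fun setT p by exact: continuous_measurable_fun.
have mq : measurable_fun setT (q n) by exact: continuous_measurable_fun.
have Hle : (\int[mu]_(z in E) (`|u z - p z|)%:E <= \int[mu]_(z in E) `|(u z - q n z)%:E|)%E.
  apply: ge0_le_integral => //.
  - apply/measurable_EFinP/measurable_funTS; apply: measurableT_comp => //.
    exact: measurable_funB.
  - apply: measurableT_comp => //; apply/measurable_EFinP/measurable_funTS.
    exact: measurable_funB.
  - by move=> x _; rewrite lee_fin.
rewrite /Rintegral -lee_fin fineK; last first.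
  rewrite ge0_fin_numE; last by apply: integral_ge0 => x _; rewrite lee_fin.
  by rewrite (le_lt_trans Hle)// (lt_trans qn)// ltry.
exact: le_trans Hle (ltW qn).
Qed.

(** The interval is open so that both alternatives are exhausted: the cut-off function is 0 outside,
    endpoints included, and inside it agrees with a continuous one near each point. *)
Lemma crestrict_itv_continuous (N : nat) (p q : R -> R) s :
  continuous p -> continuous q ->
  crestrict `]- N%:R, N%:R[ (fun x => Complex (p x) (q x)) s = 0 \/
  ccontinuous_at (crestrict `]- N%:R, N%:R[ (fun x => Complex (p x) (q x))) s.
Proof.
move=> cp cq; have [sN|sN] := pselect (s \in `]- N%:R, N%:R[); last first.
  by left; rewrite /crestrict memNset.
have near_in : \forall t \near s, t \in `]- N%:R, N%:R[.
  by apply: near_in_itvoo.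
right; split.
  rewrite /prop_for /continuous_at /crestrict mem_set//=.
  apply: cvg_trans (cp s); apply: near_eq_cvg.
  by apply: filterS near_in => t tN; rewrite mem_set.
rewrite /prop_for /continuous_at /crestrict mem_set//=.
apply: cvg_trans (cq s); apply: near_eq_cvg.
by apply: filterS near_in => t tN; rewrite mem_set.
Qed.

Lemma bounded_support_integrable (N : nat) f (M : R) : cmeasurable f ->
  (forall s, cabs (f s) <= M) ->
  (forall s, ~ s \in `]- N%:R, N%:R[ -> f s = 0) -> cintegrable f /\ L2R f.
Proof.
move=> mf fM f0.
have i1 : integrableR (fun x => \1_(`]- N%:R, N%:R[) x : R).
  exact: integrable_indic_itv.
have M0 : 0 <= M by rewrite (le_trans _ (fM 0))// cabs_ge0.
split.
  apply: (cintegrable_le mf _ (integrableRZ M i1)) => s.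
  rewrite indicE; have [sN|sN] := pselect (s \in `]- N%:R, N%:R[).
    by rewrite mem_set// mulr1.
  by rewrite f0// cabs0 mulr_ge0.
apply: (L2R_le mf _ (integrableRZ (M ^+ 2) i1)) => s.
rewrite indicE; have [sN|sN] := pselect (s \in `]- N%:R, N%:R[).
  by rewrite mem_set// mulr1 -cabs_sqr ler_sqr ?nnegrE ?cabs_ge0.
by rewrite f0// cabs20 mulr_ge0// sqr_ge0.
Qed.

Definition nice f := [/\ cintegrable f, L2R f,
  exists M : R, forall s, cabs (f s) <= M &
  forall s, f s = 0 \/ ccontinuous_at f s].

Lemma nice_dense_bounded (N : nat) f (M e : R) : cmeasurable f ->
  (forall s, cabs (f s) <= M) ->
  (forall s, ~ s \in `]- N%:R, N%:R[ -> f s = 0) -> 0 < e ->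
  exists2 h, nice h & n2 (fun s => f s - h s) <= e.
Proof.
move=> mf fM f0 e0; have [fi lf] := bounded_support_integrable mf fM f0.
have M0 : 0 <= M by rewrite (le_trans _ (fM 0))// cabs_ge0.
have [mr mi] := mf.
(* The final bound is 4 M d = e M / (M + 1) <= e; adding 1 keeps the quotient meaningful for M =
   0. *)
pose d := e / (4 * (M + 1)).
have D0 : 0 < 4 * (M + 1) by rewrite mulr_gt0// ltr_wpDl.
have d0 : 0 < d by rewrite divr_gt0.
have rM s : `|Re (f s)| <= M by exact: le_trans (normRe_le _) (fM s).
have iM s : `|Im (f s)| <= M by exact: le_trans (normIm_le _) (fM s).
have [p [cp pM pe]] := bounded_continuous_approx N mr rM d0.
have [q [cq qM qe]] := bounded_continuous_approx N mi iM d0.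
have mp : measurable_fun setT p by exact: continuous_measurable_fun.
have mq : measurable_fun setT q by exact: continuous_measurable_fun.
pose h := crestrict `]- N%:R, N%:R[ (fun x => Complex (p x) (q x)).
have mh : cmeasurable h.
  by apply: cmeasurable_crestrict => //; exact: measurable_itv.
have hM s : cabs (h s) <= M + M.
  rewrite /h /crestrict; case: ifP => _; last by rewrite cabs0 addr_ge0.
  by rewrite (le_trans (cabs_le _))//= lerD.
have h0 s : ~ s \in `]- N%:R, N%:R[ -> h s = 0.
  by move=> sN; rewrite /h /crestrict memNset.
have [hi lh] := bounded_support_integrable mh hM h0.
exists h.
  split => //; first by exists (M + M).
  by move=> s; exact: crestrict_itv_continuous.
pose E := `]- N%:R, N%:R[%classic : set R.
have mE : measurable E by exact: measurable_itv.
have Efin : (mu E < +oo)%E.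
  by rewrite /E lebesgue_measure_itv/=; case: ifP => _; rewrite -?EFinB ltry.
have iE (a b : R -> R) : measurable_fun setT a -> measurable_fun setT b ->
    (forall x, `|a x| <= M) -> (forall x, `|b x| <= M) ->
    mu.-integrable E (fun x => (`|a x - b x|)%:E).
  move=> ma mb aM bM.
  have := @measurable_bounded_integrable _ _ R mu (fun x : R => `|a x - b x|) E mE Efin.
  apply; first by apply: measurable_funTS; apply: measurableT_comp => //; exact: measurable_funB.
  exists (M + M); split; rewrite ?num_real// => x Mx y _ /=; rewrite normr_id.
  by rewrite (le_trans (ler_normB _ _))// (le_trans _ (ltW Mx))// lerD.
have ir := iE _ _ mr mp rM pM; have ii := iE _ _ mi mq iM qM.
have key : n2 (fun s => f s - h s) <= Rintegral mu setT
    ((fun s => 2 * M * `|Re (f s) - p s| + 2 * M * `|Im (f s) - q s|) \_ E).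
  apply: n2_le; first exact: L2RB.
    move=> s; rewrite patchE; have [sN|sN] := pselect (s \in `]- N%:R, N%:R[); last first.
      by rewrite f0// h0// subr0 cabs20; case: ifP => // _;
        rewrite addr_ge0// !mulr_ge0.
    rewrite mem_set// /h /crestrict mem_set// /cabs2 !cReIm /=.
    (* Boundedness turns the L^1 estimate into an L^2 one, because |a - b| <= 2 M. *)
    have sq (a b : R) : `|a| <= M -> `|b| <= M -> (a - b) ^+ 2 <= 2 * M * `|a - b|.
      move=> aM bM; rewrite -real_normK ?num_real// expr2 ler_wpM2r//.
      by rewrite (le_trans (ler_normB _ _))// mulr_natl mulr2n lerD.
    by rewrite lerD// sq.
  apply/(integrable_mkcondR _ mE).
  have := integrableD (mu := mu) mE (integrableZl (mu := mu) mE (2 * M) ir)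
    (integrableZl (mu := mu) mE (2 * M) ii).
  by [].
apply: le_trans key _; rewrite -Rintegral_mkcond RintegralD//; last 2 first.
- exact: (integrableZl (mu := mu) mE (2 * M) ir).
- exact: (integrableZl (mu := mu) mE (2 * M) ii).
rewrite !RintegralZl//.
apply: (@le_trans _ _ (2 * M * d + 2 * M * d)).
  by rewrite lerD// ler_wpM2l// mulr_ge0.
have -> : 2 * M * d + 2 * M * d = e * (M / (M + 1)).
  by rewrite /d; field; rewrite gt_eqF// ltr_wpDl.
have Mp : 0 < M + 1 by rewrite ltr_wpDl.
have e0' := ltW e0.
by rewrite ler_piMr// ler_pdivrMr// mul1r lerDl.
Qed.

(** Cutting both the domain and the values reduces to [nice_dense_bounded]. Two errors e / 4, each
    doubled by [n2_triangle_le], add up to [e]. *)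
Lemma nice_dense f (e : R) : L2R f -> 0 < e ->
  exists2 h, nice h & n2 (fun s => f s - h s) <= e.
Proof.
move=> lf e0; have [mf f2i] := lf.
pose D n := `]- n%:R, n%:R[%classic `&` [set s | cabs (f s) <= n%:R].
have mD n : measurable (D n).
  apply: measurableI; first exact: measurable_itv.
  rewrite -[X in measurable X]setTI.
  have mc : measurable_fun setT (fun _ : R => n%:R : R) by exact: measurable_cst.
  have := measurable_fun_ler (measurable_cabs mf) mc.
  by move=> /(_ measurableT [set true]); apply.
pose T n := crestrict (D n) f.
have mT n : cmeasurable (T n) by exact: cmeasurable_crestrict.
have lT n : L2R (T n) by exact: L2R_crestrict.
have cT : n2_cvg T f.
  apply: (n2_dominated_cvg (k := fun s => cabs2 (f s))) => //.
  - move=> s; have Hs : \forall n \near \oo, T n s = f s.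
      near=> n; rewrite /T /crestrict mem_set//; split => /=.
        rewrite in_itv /= -ltr_norml.
        near: n; exact: nbhs_infty_gtr.
      near: n; exact: nbhs_infty_ger.
    by split; apply: cvg_near_cst; apply: filterS Hs => n ->.
  - move=> n s; rewrite /T /crestrict; case: ifP => _; first by rewrite subrr cabs20 cabs2_ge0.
    by rewrite sub0r cabs2N.
have e4 : 0 < e / 4 by rewrite divr_gt0.
move/cvgrPdist_le : (cT) => /(_ _ e4) [n _ /(_ n (leqnn n))].
rewrite sub0r normrN ger0_norm ?n2_ge0// => Tn.
have [h hn hTn] : exists2 h, nice h & n2 (fun s => T n s - h s) <= e / 4.
  apply: (@nice_dense_bounded n _ n%:R) => // s.
    rewrite /T /crestrict; case: ifPn => [/set_mem[]//|_].
    by rewrite cabs0.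
  by move=> sN; rewrite /T /crestrict memNset// => -[].
exists h => //; have [_ lh _ _] := hn.
apply: le_trans (n2_triangle_le lf (lT n) lh) _.
rewrite [X in 2 * X + _]n2C; lra.
Unshelve. all: by end_near. Qed.

Theorem plancherel f : cintegrable f -> L2R f -> n2 (FT f) = n2 f.
Proof.
move=> fi lf.
have : forall n : nat, exists h, nice h /\ n2 (fun s => f s - h s) <= n.+1%:R^-1.
  move=> n; have [|h hn hf] := @nice_dense f n.+1%:R^-1 lf.
    by rewrite invr_gt0.
  by exists h.
move=> /choice[h hP].
have hi n : cintegrable (h n) by have [[]] := hP n.
have lh n : L2R (h n) by have [[]] := hP n.
have hE n : n2 (FT (h n)) = n2 (h n).
  by have [[? ? [M HM] ?] _] := hP n; exact: (FT_isometry_nice (M := M)).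
have [lF _] := FT_contraction fi lf.
have lFh n : L2R (FT (h n)) by have [] := FT_contraction (hi n) (lh n).
have c1 : n2_cvg h f.
  apply: (n2_cvg_le (@cvg_harmonic R)) => n; rewrite n2C.
  by case: (hP n).
have c2 : n2_cvg (fun n => FT (h n)) (FT f).
  apply: (n2_cvg_le (@cvg_harmonic R)) => n; rewrite n2C.
  apply: le_trans (hP n).2.
  have -> : (fun x => FT f x - FT (h n) x) = FT (fun s => f s - h n s).
    by apply/funext => x; rewrite FTB.
  have di : cintegrable (fun s => f s - h n s).
    have := cintegrableD fi (cintegrableZ (-1) (hi n)).
    by under eq_fun do rewrite mulN1r.
  by have [] := FT_contraction di (L2RB lf (lh n)).
have H1 := cvg_n2 lh lf c1; have H2 := cvg_n2 lFh lF c2.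
rewrite -(cvg_lim (@Rhausdorff R) H1) -(cvg_lim (@Rhausdorff R) H2).
by congr (limn _); apply/funext => n; exact: hE.
Qed.

(** * Extension of the transform to L^2 *)

Definition trunc (n : nat) f := crestrict `[- n%:R, n%:R] f.

Lemma measurable_trunc_itv (n : nat) : measurable (`[- n%:R, n%:R]%classic : set R).
Proof. exact: measurable_itv. Qed.

Lemma L2R_trunc n f : L2R f -> L2R (trunc n f).
Proof. by move=> lf; apply: L2R_crestrict => //; exact: measurable_trunc_itv. Qed.

Lemma cintegrable_trunc n f : L2R f -> cintegrable (trunc n f).
Proof.
move=> lf; have [mf f2i] := lf.
have i1 : integrableR (fun x => \1_(`[- n%:R, n%:R]) x : R).
  exact: integrable_indic_itv.
have mT : cmeasurable (trunc n f) by case: (L2R_trunc n lf).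
apply: (cintegrable_le mT _ (integrableRD i1 f2i)) => s.
rewrite /trunc /crestrict indicE; case: ifPn => sn; last first.
  by rewrite cabs0 add0r cabs2_ge0.
(* The inequality a <= 1 + a^2 makes a square-integrable function integrable on a bounded
   interval. *)
rewrite -cabs_sqr /=; have := cabs_ge0 (f s); set a := cabs _ => a0.
rewrite -subr_ge0; have -> : 1 + a ^+ 2 - a = (a - 2^-1) ^+ 2 + 3 / 4 by field.
by rewrite addr_ge0// sqr_ge0.
Qed.

Lemma cvg_trunc f : L2R f -> n2_cvg (fun n => trunc n f) f.
Proof.
move=> lf; have [mf f2i] := lf.
apply: (n2_dominated_cvg (k := fun s => cabs2 (f s))) => //.
- by move=> n; case: (L2R_trunc n lf).
- move=> s; have Hs : \forall n \near \oo, trunc n f s = f s.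
    near=> n; rewrite /trunc /crestrict mem_set// /= in_itv /= -ler_norml.
    near: n; exact: nbhs_infty_ger.
  by split; apply: cvg_near_cst; apply: filterS Hs => n ->.
- move=> n s; rewrite /trunc /crestrict; case: ifP => _.
    by rewrite subrr cabs20 cabs2_ge0.
  by rewrite sub0r cabs2N.
Unshelve. all: by end_near. Qed.

(* The graph of the L2 extension of [FT]. *)
Definition is_FT f h := [/\ L2R f, L2R h & n2_cvg (fun n => FT (trunc n f)) h].

Lemma L2R_FT_trunc n f : L2R f -> L2R (FT (trunc n f)).
Proof.
by move=> lf; have [] := FT_contraction (cintegrable_trunc n lf) (L2R_trunc n lf).
Qed.

Lemma n2_FTB f g : cintegrable f -> cintegrable g -> L2R f -> L2R g ->
  n2 (fun m => FT f m - FT g m) = n2 (fun s => f s - g s).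
Proof.
move=> fi gi lf lg.
have -> : (fun m => FT f m - FT g m) = FT (fun s => f s - g s).
  by apply/funext => m; rewrite FTB.
apply: plancherel; last exact: L2RB.
have := cintegrableD fi (cintegrableZ (-1) gi).
by under eq_fun do rewrite mulN1r.
Qed.

Lemma is_FT_integrable f : cintegrable f -> L2R f -> is_FT f (FT f).
Proof.
move=> fi lf; have [lF _] := FT_contraction fi lf; split => //.
apply: (n2_cvg_le (cvg_trunc lf)) => n.
rewrite n2_FTB//; [exact: cintegrable_trunc|exact: L2R_trunc].
Qed.

Lemma is_FT_exists f : L2R f -> exists h, is_FT f h.
Proof.
move=> lf.
have [e e0|h [lh ch]] := @L2R_complete R (fun n => FT (trunc n f))
    (fun n => L2R_FT_trunc n lf); last by exists h; split.
have e4 : 0 < e / 4 by rewrite divr_gt0.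
have /cvgrPdist_le /(_ _ e4) [N _ HN] := cvg_trunc lf.
exists N => m n Nm Nn.
rewrite n2_FTB//; [|exact: cintegrable_trunc..|exact: L2R_trunc|exact: L2R_trunc].
apply: le_trans (n2_triangle_le (L2R_trunc m lf) lf (L2R_trunc n lf)) _.
have := HN m Nm; have := HN n Nn; rewrite /= !sub0r !normrN !ger0_norm ?n2_ge0//.
by rewrite [X in _ -> _ -> _ + 2 * X <= _]n2C; lra.
Qed.

Lemma is_FT_norm f h : is_FT f h -> n2 h = n2 f.
Proof.
move=> [lf lh ch].
have H1 := cvg_n2 (fun n => L2R_FT_trunc n lf) lh ch.
have H2 := cvg_n2 (fun n => L2R_trunc n lf) lf (cvg_trunc lf).
rewrite -(cvg_lim (@Rhausdorff R) H1) -(cvg_lim (@Rhausdorff R) H2).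
congr (limn _); apply/funext => n.
by apply: plancherel; [exact: cintegrable_trunc|exact: L2R_trunc].
Qed.

Lemma is_FTD (a : R[i]) f f' h h' : is_FT f h -> is_FT f' h' ->
  is_FT (fun s => a * f s + f' s) (fun m => a * h m + h' m).
Proof.
move=> [lf lh ch] [lf' lh' ch']; split.
- by apply: L2RD => //; exact: L2RZ.
- by apply: L2RD => //; exact: L2RZ.
have -> : (fun n => FT (trunc n (fun s => a * f s + f' s))) =
    (fun n m => a * FT (trunc n f) m + FT (trunc n f') m).
  apply/funext => n; apply/funext => m.
  rewrite -FTD; [|exact: cintegrable_trunc..].
  congr (FT _ m); apply/funext => s; rewrite /trunc /crestrict.
  by case: ifP => // _; rewrite mulr0 addr0.
apply: n2_cvgD => //.
- by move=> n; apply: L2RZ; exact: L2R_FT_trunc.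
- by move=> n; exact: L2R_FT_trunc.
- exact: L2RZ.
- apply: n2_cvgZ => //; by move=> n; exact: L2R_FT_trunc.
Qed.

(** Linearity and [is_FT_norm]. Uniqueness up to null sets and closedness of the graph both rest on
    it. *)
Lemma is_FT_dist f f' h h' : is_FT f h -> is_FT f' h' ->
  n2 (fun m => h m - h' m) = n2 (fun s => f s - f' s).
Proof.
move=> fh fh'; have := is_FT_norm (is_FTD (-1) fh' fh).
have E (u v : R -> R[i]) : (fun x => -1 * u x + v x) = (fun x => v x - u x).
  by apply/funext => x; rewrite mulN1r addrC.
by rewrite !E.
Qed.

Lemma n2_opp f : cmeasurable f -> n2 (fun s => f (- s)) = n2 f.
Proof. by move=> mf; apply: (Rintegral_opp (measurable_cabs2 mf)). Qed.

Lemma L2R_opp f : L2R f -> L2R (fun s => f (- s)).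
Proof.
move=> [mf fi]; split; last exact: (integrableR_opp fi).
by apply: cmeasurable_comp mf _; exact: oppr_measurable.
Qed.

(* The inverse transform of [h] is the reflected transform of [h]: with
   [f] that candidate and [h'] the transform of [f], expanding
   |h' - h|^2 and moving the transform across the inner product gives 0. *)
Lemma is_FT_onto h : L2R h -> exists f, is_FT f h.
Proof.
move=> lh; have [k hk] := is_FT_exists lh; have [_ lk ck] := hk.
pose f s := k (- s); have lf : L2R f by exact: L2R_opp.
have [h' fh'] := is_FT_exists lf; have [_ lh' ch'] := fh'.
(* The adjunction holds for truncations, which are integrable; in the limit the right-hand side
   becomes rip f f, since [f] is the reflected transform of [h]. *)
have rip_eq : rip h' h = n2 f.
  have H1 := cvg_rip (fun n => L2R_FT_trunc n lf) (fun n => L2R_trunc n lh) lh' lh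
    ch' (cvg_trunc lh).
  have lo n : L2R (fun s => FT (trunc n h) (- s)) by exact/L2R_opp/L2R_FT_trunc.
  have co : n2_cvg (fun n s => FT (trunc n h) (- s)) f.
    apply: (n2_cvg_le ck) => n.
    rewrite (n2_opp (f := fun s => FT (trunc n h) s - k s))//.
    by case: (L2RB (L2R_FT_trunc n lh) lk).
  have H2 := cvg_rip (fun n => L2R_trunc n lf) lo lf lf (cvg_trunc lf) co.
  rewrite -rip_self -(cvg_lim (@Rhausdorff R) H1) -(cvg_lim (@Rhausdorff R) H2).
  congr (limn _); apply/funext => n.
  exact: (congr1 (@complex.Re R)
    (FT_adjoint (cintegrable_trunc n lf) (cintegrable_trunc n lh))).
exists f; split => //.
have n2h' : n2 h' = n2 f by exact: is_FT_norm fh'.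
have n2h : n2 h = n2 f.
  by rewrite -(is_FT_norm hk) /f n2_opp//; case: lk.
have d0 : n2 (fun m => h' m - h m) = 0.
  by rewrite n2B// rip_eq n2h' n2h; ring.
have Z : (fun n : nat => 2 * n2 (fun m => FT (trunc n f) m - h' m)) @ \oo --> (2 * 0 : R).
  by apply: cvgM => //; exact: cvg_cst.
rewrite mulr0 in Z; apply: (n2_cvg_le Z) => n.
apply: le_trans (n2_triangle_le (L2R_FT_trunc n lf) lh' lh) _.
by rewrite d0 mulr0 addr0.
Qed.

(** Representatives matter: the values prescribed by an integral formula or by [gluing] may differ
    from a given transform on a null set. *)
Lemma is_FT_ae f f' h h' : is_FT f h -> cmeasurable f' -> cmeasurable h' ->
  {ae mu, forall s, f s = f' s} -> {ae mu, forall m, h m = h' m} -> is_FT f' h'.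
Proof.
move=> fh mf' mh' ff' hh'; have [lf lh ch] := fh.
have mf : cmeasurable f by case: lf.
have mh : cmeasurable h by case: lh.
have lf' : L2R f' by exact: (ae_L2R mf mf' ff' lf).
have lh' : L2R h' by exact: (ae_L2R mh mh' hh' lh).
split => //.
have [k fk] := is_FT_exists lf'; have [_ lk ck] := fk.
have dhk : n2 (fun m => h m - k m) = 0.
  rewrite (is_FT_dist fh fk); apply: ae_n2_eq0.
    by case: (L2RB lf lf').
  by apply: ae_imp ff' => s ->; rewrite subrr.
have dhh' : n2 (fun m => h m - h' m) = 0.
  apply: ae_n2_eq0; first by case: (L2RB lh lh').
  by apply: ae_imp hh' => s ->; rewrite subrr.
have dkh' : n2 (fun m => k m - h' m) = 0.
  apply/eqP; rewrite eq_le n2_ge0 andbT.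
  apply: le_trans (n2_triangle_le lk lh lh') _.
  by rewrite [X in 2 * X + _]n2C dhk dhh' mulr0 addr0.
have Z : (fun n : nat => 2 * n2 (fun m => FT (trunc n f') m - k m)) @ \oo --> (2 * 0 : R).
  by apply: cvgM => //; exact: cvg_cst.
rewrite mulr0 in Z; apply: (n2_cvg_le Z) => n.
apply: le_trans (n2_triangle_le (L2R_FT_trunc n lf') lk lh') _.
by rewrite dkh' mulr0 addr0.
Qed.

End Plancherel.



(** * Rotation of the Gamma integral *)
Section GammaRotation.
Context {R : realType}.
Local Notation mu := (@lebesgue_measure R).
Implicit Types (e nu phi xi k u : R).

(** Squares the inequality x / 2 <= exp(x / 2). *)
Lemma expRN_sqr_le (x : R) : 0 < x -> expR (- x) <= 4 / x ^+ 2.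
Proof.
move=> x0; rewrite expRN -[leRHS]invrK lef_pV2 ?posrE ?expR_gt0 ?invr_gt0 ?divr_gt0 ?exprn_gt0//.
rewrite invf_div; have -> : x = x / 2 + x / 2 by field.
rewrite expRD; have H : x / 2 <= expR (x / 2).
  by apply: le_trans (expR_ge1Dx _); rewrite lerDr.
have -> : (x / 2 + x / 2) ^+ 2 / 4 = (x / 2) * (x / 2) by field.
by apply: ler_pM => //; apply: divr_ge0 => //; exact: ltW.
Qed.

(** For u <= 0 the factor exp(u / 2) decays and the rest is bounded. For u > 0 the bound exp(-k exp
    u) <= 4 / (k exp u)^2 outweighs exp(u / 2) times a multiple of exp u and leaves exp(-u / 2). *)
Lemma expR_exp_decay (k A u : R) : 0 < k -> k <= 1 -> 0 <= A ->
  expR (u / 2 - k * expR u) * (A + 2 * expR u) <=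
  4 * (A + 2) / k ^+ 2 * expR (- (2^-1 * `|u|)).
Proof.
move=> k0 k1 A0; have y0 := expR_gt0 u.
have C1 : A + 2 <= 4 * (A + 2) / k ^+ 2.
  rewrite ler_pdivlMr ?exprn_gt0//.
  have k2 : k * k <= 1 * 1 by apply: ler_pM => //; exact: ltW.
  by rewrite [leRHS]mulrC ler_wpM2l ?addr_ge0// expr2; lra.
have [u0|u0] := leP u 0.
  have y1 : expR u <= 1 by rewrite -expR0 ler_expR.
  rewrite ler0_norm// mulrN opprK mulrC; apply: ler_pM.
  - by nra.
  - exact: expR_ge0.
  - by apply: le_trans C1; nra.
  - by rewrite ler_expR [u / 2]mulrC gerBl mulr_ge0// ltW.
have y1 : 1 <= expR u by rewrite -expR0 ler_expR ltW.
rewrite gtr0_norm// expRD.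
have H := expRN_sqr_le (mulr_gt0 k0 y0).
have E : expR (u / 2) = expR u * expR (- (2^-1 * u)).
  by rewrite -expRD; congr expR; field.
rewrite E.
set w := expR (- (2^-1 * u)); have w0 : 0 < w := expR_gt0 _.
have HH : expR (- (k * expR u)) * (expR u * (A + 2 * expR u)) <= 4 * (A + 2) / k ^+ 2.
  apply: (@le_trans _ _ (4 / (k * expR u) ^+ 2 * (expR u * ((A + 2) * expR u)))).
    apply: ler_pM; [exact: expR_ge0| |exact: H|].
      by rewrite mulr_ge0 ?expR_ge0// addr_ge0// mulr_ge0// expR_ge0.
    by apply: ler_pM; [exact: ltW|nra|exact: lexx|nra].
  rewrite le_eqVlt; apply/orP; left; apply/eqP; field.
  by rewrite !gt_eqF.
have -> : expR u * w * expR (- (k * expR u)) * (A + 2 * expR u) =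
  expR (- (k * expR u)) * (expR u * (A + 2 * expR u)) * w by ring.
by rewrite ler_pM2r.
Qed.

Lemma integrableR_expR_exp_decay (k A : R) : 0 < k -> k <= 1 -> 0 <= A ->
  integrableR (fun u => expR (u / 2 - k * expR u) * (A + 2 * expR u)).
Proof.
move=> k0 k1 A0.
have := integrableRZ (4 * (A + 2) / k ^+ 2) (@integrableR_exp_abs R 2^-1 ltac:(by [])).
apply: integrableR_le => [|u].
  apply: continuous_measurable_fun; apply: is_derive_continuous => u; eexists.
  by derive_fun.
rewrite ger0_norm; first exact: expR_exp_decay.
by rewrite mulr_ge0 ?expR_ge0// addr_ge0// mulr_ge0// expR_ge0.
Qed.

(* [gammaR nu c phi u] is the real part of
   [e^{ic} exp((1/2 + i nu) z - e^z)] at [z = u + i phi]. *)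
Definition gammaR nu c phi u : R :=
  expR (u / 2 - nu * phi - expR u * cos phi) *
  cos (nu * u + phi / 2 - expR u * sin phi + c).

(** The phase shift pi / 2 is multiplication by i. For a holomorphic function of u + i phi the
    derivative in [phi] is i times the derivative in [u], so this value reappears for phase [c] in
    the angular direction. *)
Lemma is_derive_gammaR_u nu c phi u : is_derive u 1 (gammaR nu (c + pi / 2) phi)
  (expR (u / 2 - nu * phi - expR u * cos phi) *
   ((- nu + expR u * sin phi) * cos (nu * u + phi / 2 - expR u * sin phi + c) -
    (2^-1 - expR u * cos phi) * sin (nu * u + phi / 2 - expR u * sin phi + c))).
Proof.
rewrite /gammaR; eapply is_derive_eq; first by derive_fun.
by rewrite /= !addrA sinDpihalf cosDpihalf; field.
Qed.

(* Cauchy-Riemann equation for the holomorphic function above. *)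
Lemma is_derive_gammaR_phi nu c phi u :
  is_derive phi 1 (gammaR nu c ^~ u)
  (expR (u / 2 - nu * phi - expR u * cos phi) *
   ((- nu + expR u * sin phi) * cos (nu * u + phi / 2 - expR u * sin phi + c) -
    (2^-1 - expR u * cos phi) * sin (nu * u + phi / 2 - expR u * sin phi + c))).
Proof.
rewrite /gammaR; eapply is_derive_eq; first by derive_fun.
by rewrite /=; field.
Qed.

(** Only a lower bound [k] of cos phi enters the double exponential, so one majorant serves a whole
    range of angles, as differentiation under the integral demands. *)
Lemma gammaR_weight_le nu phi k u : k <= cos phi -> `|phi| <= pi ->
  expR (u / 2 - nu * phi - expR u * cos phi) <=
  expR (`|nu| * pi) * expR (u / 2 - k * expR u).
Proof.
move=> kc phipi; rewrite -expRD ler_expR.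
have H1 : - (nu * phi) <= `|nu| * pi.
  apply: (le_trans (ler_norm _)); rewrite normrN normrM; exact: ler_wpM2l.
have H2 : k * expR u <= expR u * cos phi by rewrite mulrC ler_wpM2l// expR_ge0.
by lra.
Qed.

Lemma continuous_gammaR nu c phi : continuous (gammaR nu c phi).
Proof.
by apply: is_derive_continuous => u; eexists; rewrite /gammaR; derive_fun.
Qed.

Lemma gammaR_le nu c phi k u : k <= cos phi -> `|phi| <= pi ->
  `|gammaR nu c phi u| <=
  expR (`|nu| * pi) * (expR (u / 2 - k * expR u) * (1 + 2 * expR u)).
Proof.
move=> kc phipi; rewrite /gammaR normrM ger0_norm ?expR_ge0//.
rewrite mulrA; apply: ler_pM; [exact: expR_ge0|by []|exact: gammaR_weight_le|].
apply: le_trans (_ : 1 <= _); first by rewrite ler_norml cos_geN1 cos_le1.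
by rewrite lerDl mulr_ge0// expR_ge0.
Qed.

Lemma gammaR_derive_le nu phi k u (a b : R) : k <= cos phi -> `|phi| <= pi ->
  `|expR (u / 2 - nu * phi - expR u * cos phi) *
   ((- nu + expR u * sin phi) * cos a - (2^-1 - expR u * cos phi) * sin a)| <=
  expR (`|nu| * pi) * (expR (u / 2 - k * expR u) * (`|nu| + 1 + 2 * expR u)).
Proof.
move=> kc phipi; rewrite normrM ger0_norm ?expR_ge0//.
rewrite mulrA; apply: ler_pM; [exact: expR_ge0|by []|exact: gammaR_weight_le|].
have y0 := expR_ge0 u.
have c1 (t : R) : `|cos t| <= 1 by rewrite ler_norml cos_geN1 cos_le1.
have s1 (t : R) : `|sin t| <= 1 by rewrite ler_norml sin_geN1 sin_le1.
apply: le_trans (ler_normB _ _) _; rewrite !normrM.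
have -> : `|nu| + 1 + 2 * expR u = (`|nu| + expR u) * 1 + (1 + expR u) * 1 by ring.
apply: lerD; apply: ler_pM => //.
  apply: le_trans (ler_normD _ _) _; rewrite normrN lerD2l normrM ger0_norm//.
  by rewrite ler_piMr.
apply: le_trans (ler_normB _ _) _; apply: lerD; first by rewrite ger0_norm//; lra.
by rewrite normrM ger0_norm// ler_piMr.
Qed.

Lemma integrableR_gammaR nu c phi k : 0 < k -> k <= cos phi -> `|phi| <= pi ->
  integrableR (gammaR nu c phi).
Proof.
move=> k0 kc phipi.
have k1 : k <= 1 := le_trans kc (cos_le1 _).
have := integrableRZ (expR (`|nu| * pi)) (integrableR_expR_exp_decay k0 k1 ler01).
apply: integrableR_le => [|u].
  by apply: continuous_measurable_fun; exact: continuous_gammaR.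
exact: gammaR_le.
Qed.

Lemma Rintegral_gammaR_derive nu c phi k : 0 < k -> k <= cos phi -> `|phi| <= pi ->
  Rintegral mu setT (fun u => expR (u / 2 - nu * phi - expR u * cos phi) *
   ((- nu + expR u * sin phi) * cos (nu * u + phi / 2 - expR u * sin phi + c) -
    (2^-1 - expR u * cos phi) * sin (nu * u + phi / 2 - expR u * sin phi + c))) = 0.
Proof.
move=> k0 kc phipi.
have k1 : k <= 1 := le_trans kc (cos_le1 _).
have cf : continuous (fun u => expR (u / 2 - nu * phi - expR u * cos phi) *
   ((- nu + expR u * sin phi) * cos (nu * u + phi / 2 - expR u * sin phi + c) -
    (2^-1 - expR u * cos phi) * sin (nu * u + phi / 2 - expR u * sin phi + c))).
  by apply: is_derive_continuous => u; eexists; derive_fun.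
(* One estimate serves both ends of the line, because the majorant depends only on |u|. *)
have cvg0 (s : nat -> R) : (forall n, `|s n| = n%:R) ->
    gammaR nu (c + pi / 2) phi (s n) @[n --> \oo] --> (0 : R).
  move=> sn; apply/cvgrPdist_le => e e0.
  have Z : expR (`|nu| * pi) * (4 * (1 + 2) / k ^+ 2) *
      expR (- (2^-1 * n%:R)) @[n --> \oo] --> (expR (`|nu| * pi) * (4 * (1 + 2) / k ^+ 2) * 0 : R).
    by apply: cvgM; [exact: cvg_cst|exact: cvg_expRNn].
  rewrite mulr0 in Z; move/cvgrPdist_le : Z => /(_ _ e0) [N _ HN].
  exists N => // n /HN /=; rewrite !sub0r !normrN; apply: le_trans.
  rewrite [leRHS]ger0_norm; last first.
    by rewrite !mulr_ge0 ?expR_ge0// invr_ge0 exprn_ge0// ltW.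
  apply: le_trans (gammaR_le _ _ _ kc phipi) _.
  rewrite -(mulrA (expR (`|nu| * pi))); apply: ler_wpM2l; first exact: expR_ge0.
  rewrite -(sn n); exact: (expR_exp_decay (s n) k0 k1 ler01).
apply: (RintegralT_FTC (F := gammaR nu (c + pi / 2) phi)) => //.
- have A0 : 0 <= `|nu| + 1 by rewrite addr_ge0.
  have := integrableRZ (expR (`|nu| * pi)) (integrableR_expR_exp_decay k0 k1 A0).
  apply: integrableR_le => [|u]; first exact: continuous_measurable_fun.
  exact: gammaR_derive_le.
- by move=> u; exact: is_derive_gammaR_u.
- by apply: (cvg0 (fun n => n%:R)) => n; rewrite ger0_norm.
- by apply: (cvg0 (fun n => - n%:R)) => n; rewrite normrN ger0_norm.
Qed.

(** The derivative in the angle is the integral of a derivative in [u], hence 0, and the mean value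
    theorem gives constancy. This takes the place of Cauchy's theorem. *)
Lemma Rintegral_gammaR_cst nu c phi : - (pi / 2) < phi -> phi <= 0 ->
  Rintegral mu setT (gammaR nu c phi) = Rintegral mu setT (gammaR nu c 0).
Proof.
move=> phi1 phi0.
have pi0 := pi_gt0 R.
(* The midpoint of -phi and pi / 2: the open interval ]-th, th[ contains [phi, 0], and cos is at
   least cos th > 0 on it. *)
set th := (pi / 2 - phi) / 2.
have th1 : 0 < th < pi / 2 by apply/andP; split; rewrite /th; lra.
set k := cos th.
have k0 : 0 < k by apply: cos_gt0_pihalf; apply/andP; split; lra.
have Ik x : x \in `]- th, th[ -> k <= cos x /\ `|x| <= pi.
  rewrite in_itv/= => /andP[x1 x2]; split; last by rewrite ler_norml; apply/andP; split; lra.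
  have [xp|xn] := leP 0 x.
    by rewrite ltW// ltr_cos ?in_itv/=; [|lra..].
  have : cos th < cos (- x) by rewrite ltr_cos ?in_itv/=; [lra..].
  by rewrite cosN => /ltW.
set F := fun x => Rintegral mu setT (gammaR nu c x).
have dF x : x \in `]- th, th[ -> is_derive x 1 F 0.
  move=> xI.
  have int1 y : `]- th, th[%classic y -> mu.-integrable setT (EFin \o gammaR nu c y).
    by move=> /Ik [H1 H2]; exact: (integrableR_gammaR _ _ k0 H1 H2).
  have der1 (y u : R) : `]- th, th[%classic y -> [set: R] u ->
      derivable (gammaR nu c ^~ u) y 1.
    by move=> _ _; have [] := is_derive_gammaR_phi nu c y u.
  have A0 : 0 <= `|nu| + 1 by rewrite addr_ge0.
  pose G u := expR (`|nu| * pi) * (expR (u / 2 - k * expR u) * (`|nu| + 1 + 2 * expR u)).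
  have G0 u : 0 <= G u.
    by rewrite /G !mulr_ge0 ?expR_ge0// !addr_ge0// mulr_ge0// expR_ge0.
  have pE (y u : R) : partial1of2 (gammaR nu c) y u =
   (expR (u / 2 - nu * y - expR u * cos y) *
   ((- nu + expR u * sin y) * cos (nu * u + y / 2 - expR u * sin y + c) -
    (2^-1 - expR u * cos y) * sin (nu * u + y / 2 - expR u * sin y + c))).
    by rewrite partial1of2E; have [_] := is_derive_gammaR_phi nu c y u.
  have intG : mu.-integrable setT (EFin \o G).
    exact: (integrableRZ (expR (`|nu| * pi)) (integrableR_expR_exp_decay k0 (cos_le1 _) A0)).
  have ubG (y u : R) : `]- th, th[%classic y -> [set: R] u ->
      `|partial1of2 (gammaR nu c) y u| <= G u.
    by move=> /Ik [H1 H2] _; rewrite pE; exact: gammaR_derive_le.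
  have D := derivable_under_integral measurableT xI int1 der1 G0 intG ubG.
  have E := differentiation_under_integral measurableT xI int1 der1 G0 intG ubG.
  apply: DeriveDef => //; rewrite -derive1E; rewrite /F /= in E *; rewrite E.
  have [H1 H2] := Ik _ xI.
  rewrite -(Rintegral_gammaR_derive nu c k0 H1 H2).
  by apply: eq_Rintegral => u _; rewrite pE.
have H : {within `[phi, 0], continuous F}.
  apply: derivable_within_continuous => x; rewrite in_itv/= => /andP[x1 x2].
  by have [] := dF x ltac:(rewrite in_itv/= /th; lra).
have dF' (x : R) : x \in `]phi, 0[ -> is_derive x 1 F 0.
  by rewrite in_itv/= => /andP[x1 x2]; apply: dF; rewrite in_itv/= /th; lra.
have [y _] := @MVT_segment R F (fun=> 0) phi 0 phi0 dF' H.
by rewrite mul0r => /eqP; rewrite subr_eq0 /F => /eqP.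
Qed.


(** With t = exp u this is t^(1/2 + i nu) exp(-(e - i xi) t), to be integrated against dt / t. *)
Definition gamma_kernel e xi nu u : R[i] :=
  RtoC (expR (u / 2 - e * expR u)) * cexpi (xi * expR u + nu * u).

Definition gammaI e xi nu : R[i] := cint (gamma_kernel e xi nu).

Lemma cmeasurable_gamma_kernel e :
  cmeasurable (fun p : R * (R * R) => gamma_kernel e p.1 p.2.1 p.2.2).
Proof.
have m1 : measurable_fun setT (fun p : R * (R * R) => p.1) by exact: measurable_fst.
have m2 : measurable_fun setT (fun p : R * (R * R) => p.2.1).
  by apply: measurableT_comp; [exact: measurable_fst|exact: measurable_snd].
have m3 : measurable_fun setT (fun p : R * (R * R) => p.2.2).
  by apply: measurableT_comp; [exact: measurable_snd|exact: measurable_snd].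
have mE : measurable_fun setT (fun p : R * (R * R) => expR p.2.2).
  by apply: measurableT_comp m3; exact: measurable_expR.
apply: cmeasurableM.
  apply: cmeasurable_RtoC; apply: measurableT_comp; first exact: measurable_expR.
  by apply: measurable_funB; apply: measurable_funM.
by apply: cmeasurable_expi; apply: measurable_funD; apply: measurable_funM.
Qed.

Lemma cabs_gamma_kernel e xi nu u :
  cabs (gamma_kernel e xi nu u) = expR (u / 2 - e * expR u).
Proof. by rewrite cabsM cabs_expi mulr1 cabsR ger0_norm ?expR_ge0. Qed.

Lemma integrableR_expR_exp e : 0 < e ->
  integrableR (fun u => expR (u / 2 - e * expR u)).
Proof.
move=> e0; set k := Num.min e 1.
have k0 : 0 < k by rewrite lt_min e0 ltr01.
have k1 : k <= 1 by rewrite ge_min lexx orbT.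
have := integrableR_expR_exp_decay k0 k1 ler01; apply: integrableR_le => [|u].
  by apply: continuous_measurable_fun; apply: is_derive_continuous => u; eexists; derive_fun.
rewrite ger0_norm ?expR_ge0// -[leLHS]mulr1; apply: ler_pM; rewrite ?expR_ge0//.
  by rewrite ler_expR lerD2l lerN2 ler_wpM2r ?expR_ge0// ge_min lexx.
by rewrite lerDl mulr_ge0// expR_ge0.
Qed.

Lemma cintegrable_gamma_kernel e xi nu : 0 < e -> cintegrable (gamma_kernel e xi nu).
Proof.
move=> e0; apply: cintegrable_le (integrableR_expR_exp e0).
  apply: (cmeasurable_comp (cmeasurable_gamma_kernel e) (h := fun u => (xi, (nu, u)))).
  by apply: measurable_fun_pair => //; exact: measurable_fun_pair.
by move=> u; rewrite cabs_gamma_kernel.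
Qed.

Lemma CGammaE nu : CGamma (Complex 2^-1 nu) = gammaI 1 0 nu.
Proof.
set F := fun t : R => cpow t (Complex 2^-1 nu - 1) * RtoC (expR (- t)).
have mF : cmeasurable F.
  apply: cmeasurableM; last first.
    by apply: cmeasurable_RtoC; apply: measurableT_comp => //; exact: measurable_expR.
  apply: cmeasurableM; [apply: cmeasurable_RtoC|apply: cmeasurable_expi].
    apply: measurableT_comp; first exact: measurable_expR.
    by apply: measurable_funM => //; exact: measurable_ln.
  by apply: measurable_funM => //; exact: measurable_ln.
have FE s : F (expR s) * RtoC (expR s) = gamma_kernel 1 0 nu s.
  rewrite /F /cpow /gamma_kernel !cReIm /= expRK mul0r add0r mul1r oppr0 addr0.
  have -> : expR (s / 2 - expR s) = expR ((2^-1 - 1) * s) * expR (- expR s) * expR s.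
    by rewrite -!expRD; congr expR; field.
  by rewrite !RtoCM; ring.
have E (p : R[i] -> R) : (forall z (r : R), p (z * RtoC r) = p z * r) ->
    measurable_fun setT (fun x => p (F x)) ->
    Rintegral mu (@Rpos R) (fun x => p (F x)) = Rintegral mu setT (fun s => p (gamma_kernel 1 0 nu s)).
  move=> pM mp; rewrite -(Rintegral_substitution (@substitution_exp R) (@expR_ge0 R) mp).
  by apply: eq_Rintegral => s _; rewrite -FE pM.
apply: complex_ext.
  by refine (E (fun z => Re z) _ mF.1) => z r; rewrite cReM /= mulr0 subr0.
by refine (E (fun z => Im z) _ mF.2) => z r; rewrite cImM /= mulr0 add0r.
Qed.

(** This is exp((1/2 + i nu) z - exp z) at z = u + i phi; its real and imaginary parts are [gammaR]
    with phases 0 and -pi / 2. *)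
Definition rotated_kernel nu phi u : R[i] :=
  RtoC (expR (u / 2 - nu * phi - expR u * cos phi)) *
  cexpi (nu * u + phi / 2 - expR u * sin phi).

Lemma cint_rotated_kernel nu phi : - (pi / 2) < phi -> phi <= 0 ->
  cint (rotated_kernel nu phi) = CGamma (Complex 2^-1 nu).
Proof.
move=> phi1 phi0.
have ReE x u : Re (rotated_kernel nu x u) = gammaR nu 0 x u.
  by rewrite cReM /= mul0r subr0 /gammaR addr0.
have ImE x u : Im (rotated_kernel nu x u) = gammaR nu (- (pi / 2)) x u.
  by rewrite cImM /= mul0r addr0 /gammaR cosBpihalf.
have cE x : cint (rotated_kernel nu x) =
    Complex (Rintegral mu setT (gammaR nu 0 x)) (Rintegral mu setT (gammaR nu (- (pi / 2)) x)).
  apply: complex_ext.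
    by apply: eq_Rintegral => u _; exact: ReE.
  by apply: eq_Rintegral => u _; exact: ImE.
rewrite cE !Rintegral_gammaR_cst// -cE.
rewrite CGammaE; apply: eq_cint => u; rewrite /rotated_kernel /gamma_kernel.
by rewrite cos0 sin0 !mulr0 !mulr1 mul1r mul0r !subr0 mul0r add0r addr0.
Qed.

(** Here e - i xi = exp(rho + i phi). A translation by rho absorbs the modulus and the rotation by
    phi the argument, leaving exp(-(1/2 + i nu)(rho + i phi)) times Gamma(1/2 + i nu). *)
Lemma gammaI_rotation nu phi (rho : R) : - (pi / 2) < phi -> phi <= 0 ->
  gammaI (expR rho * cos phi) (- (expR rho * sin phi)) nu =
  RtoC (expR (nu * phi - rho / 2)) * cexpi (- (nu * rho) - phi / 2) *
  CGamma (Complex 2^-1 nu).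
Proof.
move=> phi1 phi0; rewrite -(cint_rotated_kernel nu phi1 phi0).
have c0 : 0 < expR rho * cos phi.
  by rewrite mulr_gt0 ?expR_gt0// cos_gt0_pihalf// phi1 /=; have := pi_gt0 R; lra.
have [mK _] := cintegrable_gamma_kernel (- (expR rho * sin phi)) nu c0.
have K := cintegrable_gamma_kernel (- (expR rho * sin phi)) nu c0.
rewrite /gammaI -(@cint_affine _ _ 1 (- rho) _ (cintegrable_measurable K)) ?oner_neq0//.
rewrite -cintZ.
  apply: eq_cint => s; rewrite normr1 RtoC1 mulr1 mul1r /gamma_kernel /rotated_kernel.
  rewrite (_ : expR (s - rho) = expR s / expR rho); last by rewrite expRD expRN.
  have e0 : expR rho != 0 by rewrite gt_eqF// expR_gt0.
  have -> : (s - rho) / 2 - expR rho * cos phi * (expR s / expR rho) =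
    (nu * phi - rho / 2) + (s / 2 - nu * phi - expR s * cos phi) by field.
  have -> : - (expR rho * sin phi) * (expR s / expR rho) + nu * (s - rho) =
    (- (nu * rho) - phi / 2) + (nu * s + phi / 2 - expR s * sin phi) by field.
  by rewrite expRD cexpiD RtoCM; ring.
have cp : 0 < cos phi by rewrite -(pmulr_rgt0 _ (expR_gt0 rho)).
have H1 : `|phi| <= pi by rewrite ler_norml; have := pi_gt0 R; lra.
split.
  apply: eq_integrableR (integrableR_gammaR nu 0 cp (lexx _) H1) => u.
  by rewrite cReM /= mul0r subr0 /gammaR addr0.
apply: eq_integrableR (integrableR_gammaR nu (- (pi / 2)) cp (lexx _) H1) => u.
by rewrite cImM /= mul0r addr0 /gammaR cosBpihalf.
Qed.

(** The argument of e - i xi is -acos(e / r) with r its modulus, strictly above -pi / 2 because e >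
    0. *)
Lemma gammaI_polar nu e xi : 0 < e -> 0 < xi ->
  gammaI e xi nu =
  RtoC (expR (- (nu * acos (e / Num.sqrt (e ^+ 2 + xi ^+ 2))) -
              ln (Num.sqrt (e ^+ 2 + xi ^+ 2)) / 2)) *
  cexpi (- (nu * ln (Num.sqrt (e ^+ 2 + xi ^+ 2))) +
         acos (e / Num.sqrt (e ^+ 2 + xi ^+ 2)) / 2) *
  CGamma (Complex 2^-1 nu).
Proof.
move=> e0 xi0; set r := Num.sqrt _; set x := e / r.
have s0 : 0 < e ^+ 2 + xi ^+ 2 by rewrite addr_gt0// exprn_gt0.
have r0 : 0 < r by rewrite sqrtr_gt0.
have r2 : r ^+ 2 = e ^+ 2 + xi ^+ 2 by rewrite sqr_sqrtr// ltW.
have x0 : 0 < x by rewrite divr_gt0.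
have x1 : x <= 1.
  by rewrite ler_pdivrMr// mul1r -(ler_pXn2r (n := 2))// ?nnegrE ?ltW// r2 ltrDl exprn_gt0.
have x11 : -1 <= x <= 1 by rewrite x1 andbT; lra.
have ca : cos (acos x) = x by apply: acosK; rewrite in_itv.
have sa : sin (acos x) = xi / r.
  rewrite sin_acos//; have -> : 1 - x ^+ 2 = (xi / r) ^+ 2.
    rewrite /x !expr_div_n r2; field; lra.
  by rewrite sqrtr_sqr ger0_norm// divr_ge0// ltW.
have pi0 := pi_gt0 R.
have a1 : acos x < pi / 2.
  have a2 := acos_ge0 x11; have a3 := acos_lepi x11.
  rewrite -ltr_cos ?in_itv/= ?a2 ?a3//; last lra.
  by rewrite ca cos_pihalf.
have := @gammaI_rotation nu (- acos x) (ln r).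
rewrite cosN sinN ca sa lnK ?posrE// ltrN2 oppr_le0 => /(_ a1 (acos_ge0 x11)).
have -> : r * x = e by rewrite /x; field; rewrite gt_eqF.
have -> : - (r * - (xi / r)) = xi by field; rewrite gt_eqF.
by move=> ->; rewrite mulrN mulNr opprK.
Qed.

Lemma CGamma_bounded : exists2 C : R, 0 <= C &
  forall nu, cabs (CGamma (Complex 2^-1 nu)) <= C.
Proof.
have I1 : integrableR (fun u => expR (u / 2 - 1 * expR u)) := integrableR_expR_exp ltr01.
exists (2 * Rintegral mu setT (fun u => expR (u / 2 - 1 * expR u))).
  by rewrite mulr_ge0// Rintegral_ge0// => u _; exact: expR_ge0.
move=> nu; rewrite CGammaE; apply: cabs_cint_le I1.
  exact/cintegrable_measurable/cintegrable_gamma_kernel.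
by move=> u; rewrite cabs_gamma_kernel.
Qed.

Lemma cmeasurable_gammaI e nu : cmeasurable (fun xi => gammaI e xi nu).
Proof.
apply: (cmeasurable_parametric_Cint (F := fun p => gamma_kernel e p.1 nu p.2)).
apply: (cmeasurable_comp (cmeasurable_gamma_kernel e) (h := fun p => (p.1, (nu, p.2)))).
apply: measurable_fun_pair; first exact: measurable_fst.
by apply: measurable_fun_pair => //; exact: measurable_snd.
Qed.

Lemma cmeasurable_CGamma : cmeasurable (fun nu : R => CGamma (Complex 2^-1 nu)).
Proof.
have -> : (fun nu : R => CGamma (Complex 2^-1 nu)) =
    (fun nu => cint (fun u => gamma_kernel 1 0 nu u)).
  by apply/funext => nu; rewrite CGammaE.
apply: (cmeasurable_parametric_Cint (F := fun p => gamma_kernel 1 0 p.1 p.2)).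
apply: (cmeasurable_comp (cmeasurable_gamma_kernel 1) (h := fun p : R * R => ((0 : R), p))).
exact: measurable_fun_pair.
Qed.

(** Uniform in [e], as the limit e -> 0 needs: the modulus of e - i xi is at least xi, the angle is
    at most pi, and Gamma is bounded on the line Re z = 1/2. *)
Lemma gammaI_le : exists2 C : R, 0 <= C & forall e xi nu, 0 < e -> 0 < xi ->
  cabs (gammaI e xi nu) <= C * expR (`|nu| * pi) * expR (- (ln xi / 2)).
Proof.
have [C C0 HC] := CGamma_bounded; exists C => // e xi nu e0 xi0.
rewrite gammaI_polar// !cabsM cabs_expi mulr1 cabsR ger0_norm ?expR_ge0// mulrC.
rewrite -(mulrA C) -expRD; apply: ler_pM; rewrite ?cabs_ge0 ?expR_ge0 ?HC//.
set r := Num.sqrt _; set x := e / r.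
have s0 : 0 < e ^+ 2 + xi ^+ 2 by rewrite addr_gt0// exprn_gt0.
have r0 : 0 < r by rewrite sqrtr_gt0.
have r2 : r ^+ 2 = e ^+ 2 + xi ^+ 2 by rewrite sqr_sqrtr// ltW.
have x0 : 0 < x by rewrite divr_gt0.
have x1 : x <= 1.
  by rewrite ler_pdivrMr// mul1r -(ler_pXn2r (n := 2))// ?nnegrE ?ltW// r2 ltrDl exprn_gt0.
have x11 : -1 <= x <= 1 by rewrite x1 andbT; lra.
rewrite ler_expR lerD//.
  apply: le_trans (ler_norm _) _; rewrite normrN normrM ler_wpM2l//.
  by rewrite ger0_norm ?acos_lepi// acos_ge0.
rewrite lerN2 ler_pM2r// ler_ln ?posrE//.
by rewrite -(ler_pXn2r (n := 2)) ?nnegrE ?(ltW r0) ?(ltW xi0)// r2 lerDr exprn_ge0// ltW.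
Qed.

Lemma cvg_comp_continuous (f : R -> R) (u : nat -> R) (l : R) :
  {for l, continuous f} -> u n @[n --> \oo] --> l -> f (u n) @[n --> \oo] --> f l.
Proof. by move=> cf ul; apply: (cvg_comp u f ul). Qed.

(** As e -> 0 the angle acos(e / r) tends to pi / 2 and r to xi, which creates the factors exp(-pi
    nu / 2) and exp(i pi / 4) of [Fpm]. *)
Lemma ccvg_gammaI nu xi : 0 < xi ->
  ccvg (fun n => gammaI n.+1%:R^-1 xi nu)
  (RtoC (expR (- (nu * (pi / 2)) - ln xi / 2)) *
   cexpi (- (nu * ln xi) + pi / 2 / 2) * CGamma (Complex 2^-1 nu)).
Proof.
move=> xi0.
pose e n : R := n.+1%:R^-1.
have e0 n : 0 < e n by rewrite invr_gt0.
have ecvg : e n @[n --> \oo] --> (0 : R) by exact: cvg_harmonic.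
pose r n := Num.sqrt (e n ^+ 2 + xi ^+ 2).
have rcvg : r n @[n --> \oo] --> xi.
  have H0 : Num.sqrt (0 * 0 + xi ^+ 2) = xi by rewrite mul0r add0r sqrtr_sqr gtr0_norm.
  rewrite -[X in _ --> X]H0.
  apply: (cvg_comp_continuous (f := Num.sqrt)); first exact: sqrt_continuous.
  apply: cvgD; last exact: cvg_cst.
  under eq_fun do rewrite expr2.
  exact: cvgM.
have xcvg : e n / r n @[n --> \oo] --> (0 : R).
  rewrite -[X in _ --> X](mul0r xi^-1); apply: cvgM => //.
  by apply: cvgV => //; rewrite gt_eqF.
have acvg : acos (e n / r n) @[n --> \oo] --> (pi / 2 : R).
  rewrite -acos0; apply: (cvg_comp_continuous (f := @acos R)) xcvg.
  by apply: continuous_acos; lra.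
have lcvg : ln (r n) @[n --> \oo] --> ln xi.
  by apply: (cvg_comp_continuous (f := @ln R)) rcvg; exact: continuous_ln.
have -> : (fun n => gammaI n.+1%:R^-1 xi nu) = (fun n =>
   RtoC (expR (- (nu * acos (e n / r n)) - ln (r n) / 2)) *
   cexpi (- (nu * ln (r n)) + acos (e n / r n) / 2) * CGamma (Complex 2^-1 nu)).
  by apply/funext => n; rewrite gammaI_polar.
apply: ccvgM; last exact: ccvg_cst.
apply: ccvgM.
  apply: ccvg_RtoC; apply: (cvg_comp_continuous (f := @expR R)).
    exact: continuous_expR.
  apply: cvgB; last by apply: cvgM => //; exact: cvg_cst.
  by apply: cvgN; apply: cvgM => //; exact: cvg_cst.
have tcvg : - (nu * ln (r n)) + acos (e n / r n) / 2 @[n --> \oo] -->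
    - (nu * ln xi) + pi / 2 / 2.
  apply: cvgD; last by apply: cvgM => //; exact: cvg_cst.
  by apply: cvgN; apply: cvgM => //; exact: cvg_cst.
split => /=.
  by apply: (cvg_comp_continuous (f := @cos R)) tcvg; exact: continuous_cos.
by apply: (cvg_comp_continuous (f := @sin R)) tcvg; exact: continuous_sin.
Qed.

End GammaRotation.



(** * The half-line and the logarithmic variable *)
Section HalfLine.
Context {R : realType}.
Local Notation mu := (@lebesgue_measure R).
Implicit Types (x : R -> R[i]) (g h f : R -> R[i]) (y z : (R -> R[i]) * (R -> R[i])).

(** The values of a representative at t <= 0 are arbitrary; extension by 0 makes integration over
    the whole line available. *)
Definition ext x := crestrict (@Rpos R) x.

Lemma mem_Rpos (t : R) : (t \in @Rpos R) = (0 < t).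
Proof.
apply/idP/idP => [/set_mem|t0]; first by rewrite /Rpos /= in_itv/= andbT.
by apply/mem_set; rewrite /Rpos /= in_itv/= andbT.
Qed.

Lemma RposP (t : R) : Rpos t <-> 0 < t.
Proof. by rewrite -mem_Rpos; split=> [/mem_set|/set_mem]. Qed.

Lemma extE x t : 0 < t -> ext x t = x t.
Proof. by move=> t0; rewrite /ext /crestrict mem_Rpos t0. Qed.

Lemma ext_le0 x t : t <= 0 -> ext x t = 0.
Proof. by move=> t0; rewrite /ext /crestrict mem_Rpos ltNge t0. Qed.

Lemma ext_restrict (p : R[i] -> R) x : p 0 = 0 ->
  (fun t => p (ext x t)) = (fun t => p (x t)) \_ (@Rpos R).
Proof.
by move=> p0; apply/funext => t; rewrite /patch /ext /crestrict; case: ifP.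
Qed.

Lemma cmeasurable_ext x :
  measurable_fun (@Rpos R) (fun t => Re (x t)) ->
  measurable_fun (@Rpos R) (fun t => Im (x t)) -> cmeasurable (ext x).
Proof.
move=> m1 m2; split.
  by rewrite (ext_restrict (p := @complex.Re R))//; apply/(measurable_restrictT _ (@Rpos_measurable R)).
by rewrite (ext_restrict (p := @complex.Im R))//; apply/(measurable_restrictT _ (@Rpos_measurable R)).
Qed.

(* [R] carries two measurable structures with the same measurable sets, whose
   integrals are not convertible. *)
Lemma leb_integral (D : set R) (f : R -> \bar R) : measurable D ->
  measurable_fun D f -> (forall t, 0 <= f t)%E ->
  (\int[leb (R := R)]_(t in D) f t = \int[mu]_(t in D) f t)%E.
Proof.
move=> mD mf f0.
have mid : measurable_fun (T := measurableTypeR R) (U := R) setT idfun by exact: measurable_id.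
exact: (@ge0_integral_pushforward _ _ (measurableTypeR R) R R idfun mid mu D f mD mf
  (fun t _ => f0 t)).
Qed.

Lemma leb_integrable (D : set R) (f : R -> R) : measurable D ->
  (leb (R := R)).-integrable D (fun t => (f t)%:E) <->
  mu.-integrable D (fun t => (f t)%:E).
Proof.
move=> mD; split=> /integrableP [mf fi]; apply/integrableP; (split; first exact: mf).
  rewrite -leb_integral//; exact: measurableT_comp.
rewrite leb_integral//; exact: measurableT_comp.
Qed.

Lemma L2pos_ext x : L2pos x <-> L2R (ext x).
Proof.
split=> [[m1 [m2 i]]|[[m1 m2] i]].
  split; first exact: cmeasurable_ext.
  rewrite (ext_restrict x (@cabs20 R)).
  exact: ((integrable_mkcondR (fun t => cabs2 (x t)) (@Rpos_measurable R)).1 ((leb_integrable _ (@Rpos_measurable R)).1 i)).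
split; last split.
- move: m1; rewrite (ext_restrict (p := @complex.Re R))//.
  by move/(measurable_restrictT _ (@Rpos_measurable R)).
- move: m2; rewrite (ext_restrict (p := @complex.Im R))//.
  by move/(measurable_restrictT _ (@Rpos_measurable R)).
- move: i; rewrite (ext_restrict (p := @cabs2 R)) ?cabs20//.
  by move/(integrable_mkcondR _ (@Rpos_measurable R)) => i; apply/(leb_integrable _ (@Rpos_measurable R)).
Qed.

Lemma norm2_ext x : norm2 x = n2 (ext x).
Proof.
by rewrite /n2 (ext_restrict (p := @cabs2 R)) ?cabs20// /norm2 /leb Rintegral_mkcond.
Qed.

Lemma Fformula_FT x t : Fformula x t = FT (ext x) t.
Proof.
rewrite /Fformula /FT; congr (_ * _); apply: complex_ext => /=.
  rewrite /leb Rintegral_mkcond; apply: eq_Rintegral => s _.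
  by rewrite /patch /ext /crestrict; case: ifP => //; rewrite mul0r.
rewrite /leb Rintegral_mkcond; apply: eq_Rintegral => s _.
by rewrite /patch /ext /crestrict; case: ifP => //; rewrite mul0r.
Qed.

Lemma extD (a : R[i]) x x' t : ext (fun t => a * x t + x' t) t = a * ext x t + ext x' t.
Proof. by rewrite /ext /crestrict; case: ifP; rewrite // mulr0 addr0. Qed.

Lemma extB x x' t : ext (fun t => x t - x' t) t = ext x t - ext x' t.
Proof. by rewrite /ext /crestrict; case: ifP; rewrite // subr0. Qed.

Lemma aeeq_n2 x x' : L2pos x -> L2pos x' ->
  aeeq x x' <-> n2 (fun t => ext x t - ext x' t) = 0.
Proof.
move=> /L2pos_ext lx /L2pos_ext lx'; split.
  move=> xx'; apply: ae_n2_eq0; first by case: (L2RB lx lx').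
  apply: (ae_imp _ xx') => t xt; have [t0|t0] := ltP 0 t.
    by rewrite !extE// xt ?subrr//; exact/RposP.
  by rewrite !ext_le0// subrr.
move=> /(n2_eq0 (L2RB lx lx')) H; apply: ae_imp H => t + tp.
have t0 : 0 < t by exact/RposP.
by rewrite !extE// => /eqP; rewrite subr_eq0 => /eqP.
Qed.

Lemma L2posD (a : R[i]) x x' : L2pos x -> L2pos x' -> L2pos (fun t => a * x t + x' t).
Proof.
move=> /L2pos_ext lx /L2pos_ext lx'; apply/L2pos_ext.
rewrite (_ : ext _ = fun t => a * ext x t + ext x' t).
  by apply: L2RD => //; exact: L2RZ.
by apply/funext => t; exact: extD.
Qed.

Lemma L2R_L2pos h : L2R h -> L2pos h.
Proof. by move=> lh; apply/L2pos_ext; exact: L2R_crestrict (@Rpos_measurable R) lh. Qed.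

(** * Passage to the logarithmic variable *)

Definition lg x s : R[i] := ext x (expR s) * RtoC (expR (s / 2)).

Definition ilg g t : R[i] := g (ln t) * RtoC (expR (- (ln t / 2))).

Lemma lg_ilg g : lg (ilg g) = g.
Proof.
apply/funext => s; rewrite /lg extE ?expR_gt0// /ilg expRK -mulrA -RtoCM -expRD.
by rewrite addrC subrr expR0 RtoC1 mulr1.
Qed.

Lemma cabs2_lg x s : cabs2 (lg x s) = cabs2 (ext x (expR s)) * expR s.
Proof.
rewrite cabs2M cabs2R expr2 -expRD; congr (_ * expR _); by field.
Qed.

Lemma measurable_expR_half : measurable_fun setT (fun s : R => expR (s / 2)).
Proof.
by apply: measurableT_comp; [exact: measurable_expR|exact: measurable_funM].
Qed.

Lemma cmeasurable_lg x : cmeasurable (ext x) -> cmeasurable (lg x).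
Proof.
move=> mx; apply: cmeasurableM; first exact: (cmeasurable_comp mx (@measurable_expR R)).
by apply: cmeasurable_RtoC; exact: measurable_expR_half.
Qed.

Lemma L2R_lg x : L2pos x -> L2R (lg x).
Proof.
move=> /L2pos_ext lx; have [mx ix] := lx; split; first exact: cmeasurable_lg.
apply: (eq_integrableR (fun s => esym (cabs2_lg x s))).
apply/(integrable_substitution (@substitution_exp R) (@expR_ge0 R)
  (@measurable_expR R) (@measurable_expR R) (@Rpos_measurable R) (measurable_cabs2 mx)).
exact: (integrableS (mu := mu) measurableT (@Rpos_measurable R) (@subsetT _ _) ix).
Qed.

Lemma n2_lg x : L2pos x -> n2 (lg x) = norm2 x.
Proof.
move=> /L2pos_ext [mx ix]; transitivity (Rintegral mu setT (fun s => cabs2 (ext x (expR s)) * expR s)).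
  by apply: eq_Rintegral => s _; exact: cabs2_lg.
rewrite (Rintegral_substitution (@substitution_exp R) (@expR_ge0 R) (measurable_cabs2 mx)).
by apply: eq_Rintegral => t; rewrite mem_Rpos => t0; rewrite extE.
Qed.

Lemma lgD (a : R[i]) x x' s : lg (fun t => a * x t + x' t) s = a * lg x s + lg x' s.
Proof. by rewrite /lg extD; ring. Qed.

Lemma L2pos_ilg g : L2R g -> L2pos (ilg g).
Proof.
move=> [mg ig]; apply/L2pos_ext.
have m0 : cmeasurable (ilg g).
  apply: cmeasurableM; first exact: (cmeasurable_comp mg (@measurable_ln R)).
  apply: cmeasurable_RtoC; apply: measurableT_comp; first exact: measurable_expR.
  apply: measurable_funN; apply: measurable_funM => //; exact: measurable_ln.
have m1 : cmeasurable (ext (ilg g)) := cmeasurable_crestrict (@Rpos_measurable R) m0.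
split=> //.
have : integrableR (fun s => cabs2 (ext (ilg g) (expR s)) * expR s).
  by apply: eq_integrableR ig => s; rewrite -cabs2_lg lg_ilg.
move/(integrable_substitution (@substitution_exp R) (@expR_ge0 R)
  (@measurable_expR R) (@measurable_expR R) (@Rpos_measurable R) (measurable_cabs2 m1)).
move/(integrable_mkcondR _ (@Rpos_measurable R)).
rewrite -(ext_restrict (ext (ilg g)) (@cabs20 R)); apply: eq_integrableR => t.
by congr cabs2; rewrite /ext /crestrict; case: ifP => // ->.
Qed.

Lemma norm2B_lg x x' : L2pos x -> L2pos x' ->
  n2 (fun t => ext x t - ext x' t) = n2 (fun s => lg x s - lg x' s).
Proof.
move=> lx lx'; have := n2_lg (L2posD (-1) lx' lx); rewrite norm2_ext.
have -> : ext (fun t => -1 * x' t + x t) = (fun t => ext x t - ext x' t).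
  by apply/funext => t; rewrite extD mulN1r addrC.
have -> // : lg (fun t => -1 * x' t + x t) = (fun t => lg x t - lg x' t).
by apply/funext => t; rewrite lgD mulN1r addrC.
Qed.

(** The second component is reflected to the negative side, and the value at 0 is 0. The norm of the
    model space becomes [n2], and [U] becomes the Fourier transform of [lg x]. *)
Definition gluing y m : R[i] := ext y.1 m + ext y.2 (- m).

Lemma gluing_pos y m : 0 < m -> gluing y m = y.1 m.
Proof. by move=> m0; rewrite /gluing extE// ext_le0 ?addr0// oppr_le0 ltW. Qed.

Lemma gluing_neg y m : m < 0 -> gluing y m = y.2 (- m).
Proof. by move=> m0; rewrite /gluing ext_le0 ?ltW// add0r extE// oppr_gt0. Qed.

Lemma ext_gluing1 y : ext (gluing y) = ext y.1.
Proof.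
apply/funext => t; have [t0|t0] := ltP 0 t; last by rewrite !ext_le0.
by rewrite !extE// gluing_pos.
Qed.

Lemma ext_gluing2 y : ext (fun m => gluing y (- m)) = ext y.2.
Proof.
apply/funext => t; have [t0|t0] := ltP 0 t; last by rewrite !ext_le0.
by rewrite !extE// gluing_neg ?opprK// oppr_lt0.
Qed.

Lemma Mspace_gluing y : Mspace y <-> L2R (gluing y).
Proof.
split=> [[/L2pos_ext l1 /L2pos_ext l2]|lg].
  by apply: L2RD => //; exact: L2R_opp.
split; apply/L2pos_ext.
  by rewrite -ext_gluing1; apply: L2R_crestrict => //; exact: Rpos_measurable.
rewrite -ext_gluing2; apply: L2R_crestrict; first exact: Rpos_measurable.
exact: L2R_opp.
Qed.

Lemma normM2_gluing y : Mspace y -> normM2 y = n2 (gluing y).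
Proof.
move=> /Mspace_gluing [_ ig]; rewrite /n2 Rintegral_split// /normM2 /norm2 /leb.
congr (_ + _); apply: eq_Rintegral => t; rewrite mem_Rpos => t0.
  by rewrite gluing_pos.
by rewrite gluing_neg ?opprK// oppr_lt0.
Qed.

Lemma aeeqM_gluing y z : Mspace y -> Mspace z ->
  aeeqM y z <-> n2 (fun m => gluing y m - gluing z m) = 0.
Proof.
move=> My Mz.
pose d := (fun t => y.1 t - z.1 t, fun t => y.2 t - z.2 t).
have dE m : gluing d m = gluing y m - gluing z m by rewrite /gluing /= !extB; ring.
have Md : Mspace d.
  apply/Mspace_gluing; rewrite (_ : gluing d = fun m => gluing y m - gluing z m).
    by apply: L2RB; exact/Mspace_gluing.
  exact/funext.
have -> : n2 (fun m => gluing y m - gluing z m) = normM2 d.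
  by rewrite normM2_gluing//; congr n2; apply/funext => m; rewrite dE.
case: My => My1 My2; case: Mz => Mz1 Mz2; rewrite /aeeqM /normM2.
have e1 : n2 (fun t => ext y.1 t - ext z.1 t) = norm2 d.1.
  by rewrite norm2_ext; congr n2; apply/funext => t; rewrite extB.
have e2 : n2 (fun t => ext y.2 t - ext z.2 t) = norm2 d.2.
  by rewrite norm2_ext; congr n2; apply/funext => t; rewrite extB.
have d1 : 0 <= norm2 d.1 by rewrite norm2_ext n2_ge0.
have d2 : 0 <= norm2 d.2 by rewrite norm2_ext n2_ge0.
split=> [[/(aeeq_n2 My1 Mz1) + /(aeeq_n2 My2 Mz2)]|/eqP].
  by rewrite e1 e2 => -> ->; rewrite addr0.
by rewrite paddr_eq0// => /andP[/eqP z1 /eqP z2]; split; apply/aeeq_n2; rewrite ?e1 ?e2.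
Qed.

Definition halves h : (R -> R[i]) * (R -> R[i]) := (h, fun m => h (- m)).

Lemma ae_neq0 : {ae mu, forall m : R, m != 0}.
Proof.
exists [set 0]; split; [exact: measurable_set1|exact: lebesgue_measure_set1|].
by move=> m /= /negP; rewrite negbK => /eqP.
Qed.

(** Reflection preserves null sets, by [substitution_affine] applied to an indicator function. *)
Lemma ae_oppP (P : R -> Prop) : {ae mu, forall m, P m} -> {ae mu, forall m, P (- m)}.
Proof.
move=> [A [mA A0 PA]].
have mo : measurable_fun setT (fun s : R => - s) by exact: measurable_funN.
exists (-%R @^-1` A); split.
- by rewrite -[X in measurable X]setTI; exact: mo.
- have mA' : measurable (-%R @^-1` A : set R).
    by rewrite -[X in measurable X]setTI; exact: mo.
  have mI : measurable_fun setT (fun s : R => (\1_A s)%:E : \bar R).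
    by apply/measurable_EFinP; exact: measurable_indic.
  have I0 (s : R) : (0 <= (\1_A s)%:E :> \bar R)%E by rewrite lee_fin.
  have a0 : (-1 : R) != 0 by rewrite oppr_eq0 oner_eq0.
  have := @substitution_affine R (-1) 0 a0 _ mI I0.
  rewrite [RHS]integral_indic// setIT => E; apply: etrans A0; rewrite -{}E.
  have <- : (\int[mu]_s (\1_(-%R @^-1` A) s)%:E = mu (-%R @^-1` A))%E.
    by rewrite integral_indic// setIT.
  apply: eq_integral => s _; rewrite normrN1 mule1 mulN1r addr0.
  by congr EFin.
- by move=> m /= Pm; apply: PA.
Qed.

(** Equality can fail only at 0, where [gluing] takes the value 0. *)
Lemma gluing_halves h : {ae mu, forall m, h m = gluing (halves h) m}.
Proof.
apply: ae_imp ae_neq0 => m; rewrite neq_lt => /orP[m0|m0].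
  by rewrite gluing_neg//= opprK.
by rewrite gluing_pos.
Qed.

End HalfLine.



(** * Existence of the operators and unitarity of U *)
Section Operators.
Context {R : realType}.
Local Notation mu := (@lebesgue_measure R).
Implicit Types (x : R -> R[i]) (g h f : R -> R[i]) (y z : (R -> R[i]) * (R -> R[i])).

Lemma Cint_exp f : cmeasurable (ext f) ->
  Cint (@Rpos R) f = cint (fun s => f (expR s) * RtoC (expR s)).
Proof.
move=> mf.
have E (p : R[i] -> R) : (forall (w : R[i]) (r : R), p (w * RtoC r) = p w * r) ->
    measurable_fun setT (fun t => p (ext f t)) ->
    Rintegral mu (@Rpos R) (fun t => p (f t)) =
    Rintegral mu setT (fun s => p (f (expR s) * RtoC (expR s))).
  move=> pM mp; transitivity (Rintegral mu (@Rpos R) (fun t => p (ext f t))).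
    by apply: eq_Rintegral => t; rewrite mem_Rpos => t0; rewrite extE.
  rewrite -(Rintegral_substitution (@substitution_exp R) (@expR_ge0 R) mp).
  by apply: eq_Rintegral => s _; rewrite pM extE// expR_gt0.
apply: complex_ext.
  by refine (E (fun w => Re w) _ mf.1) => w r; rewrite cReM /= mulr0 subr0.
by refine (E (fun w => Im w) _ mf.2) => w r; rewrite cImM /= mulr0 add0r.
Qed.

Lemma powR_half (t : R) : 0 < t -> powR t (- 2^-1) = expR (- (ln t / 2)).
Proof. by move=> t0; rewrite /powR gt_eqF// mulNr mulrC. Qed.

Lemma Uformula_FT x m (sg : R) : L2pos x -> Uformula sg x m = FT (lg x) (sg * m).
Proof.
move=> /L2pos_ext [mx _]; rewrite /Uformula /FT; congr (_ * _); rewrite Cint_exp.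
  apply: eq_cint => s; rewrite /lg extE ?expR_gt0// powR_half ?expR_gt0// expRK /cpow /=.
  rewrite expRK mul0r expR0 RtoC1 mul1r.
  have -> : expR (s / 2) = expR (- (s / 2)) * expR s by rewrite -expRD; congr expR; field.
  by rewrite RtoCM; ring.
rewrite (_ : ext _ = fun t => ext x t * RtoC (expR (- (ln t / 2))) * cexpi (sg * m * ln t)).
  apply: cmeasurableM; first apply: cmeasurableM => //.
    apply: cmeasurable_RtoC; apply: measurableT_comp; first exact: measurable_expR.
    by apply: measurable_funN; apply: measurable_funM => //; exact: measurable_ln.
  by apply: cmeasurable_expi; apply: measurable_funM => //; exact: measurable_ln.
apply/funext => t; have [t0|t0] := ltP 0 t; last by rewrite !ext_le0// !mul0r.
by rewrite !extE// powR_half// /cpow /= mul0r expR0 RtoC1 mul1r.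
Qed.

Lemma cabs_lg x s : cabs (lg x s) = cabs (ext x (expR s)) * expR (s / 2).
Proof. by rewrite cabsM cabsR ger0_norm// expR_ge0. Qed.

(** The substitution t = exp s turns |x| t^(-1/2) dt into |lg x| ds, so the domain of the formula
    for U is the intersection of L^1 and L^2 in the logarithmic variable. *)
Lemma Udom_lg x : L2pos x -> Udom x <-> cintegrable (lg x).
Proof.
move=> lx; have [mx _] := (L2pos_ext x).1 lx.
pose w (t : R) := cabs (ext x t) * expR (- (ln t / 2)).
have mw : measurable_fun setT w.
  apply: measurable_funM; first exact: measurable_cabs.
  apply: measurableT_comp; first exact: measurable_expR.
  by apply: measurable_funN; apply: measurable_funM => //; exact: measurable_ln.
have wE s : w (expR s) * expR s = cabs (lg x s).
  rewrite cabs_lg /w expRK -mulrA -expRD; congr (_ * expR _); by field.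
have S := integrable_substitution (@substitution_exp R) (@expR_ge0 R)
  (@measurable_expR R) (@measurable_expR R) (@Rpos_measurable R) mw.
have wp t : t \in @Rpos R -> (Num.sqrt (cabs2 (x t)) * powR t (- 2^-1))%:E = (w t)%:E.
  by rewrite mem_Rpos => t0; rewrite powR_half// /w /cabs extE.
split=> [[_ /(leb_integrable _ (@Rpos_measurable R)) H]|H].
  have iw : mu.-integrable (@Rpos R) (fun t => (w t)%:E).
    by apply: eq_integrable H => //; exact: Rpos_measurable.
  apply: (cintegrable_le (k := fun s => cabs (lg x s))) => //.
    exact: cmeasurable_lg.
  by apply: eq_integrableR (S.2 iw).
split=> //; apply/(leb_integrable _ (@Rpos_measurable R)).
have iw : mu.-integrable (@Rpos R) (fun t => (w t)%:E).
  by apply/S; apply: eq_integrableR (integrable_cabs H) => s; rewrite wE.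
by apply: eq_integrable iw => //; [exact: Rpos_measurable|move=> t /wp].
Qed.

Lemma L2R_is_FT f h : is_FT f h -> L2R f /\ L2R h.
Proof. by case. Qed.

Lemma is_FT_uniq f h h' : is_FT f h -> is_FT f h' -> n2 (fun m => h m - h' m) = 0.
Proof.
move=> fh fh'; rewrite (is_FT_dist fh fh'); apply: ae_n2_eq0.
  by have [lf _] := L2R_is_FT fh; case: (L2RB lf lf).
by apply: aeW => s; rewrite subrr.
Qed.

Lemma aeeq_lg x x' : L2pos x -> L2pos x' ->
  aeeq x x' <-> n2 (fun s => lg x s - lg x' s) = 0.
Proof. by move=> lx lx'; rewrite -norm2B_lg//; exact: aeeq_n2. Qed.

Lemma gluingD (a : R[i]) y z m :
  gluing (fun t => a * y.1 t + z.1 t, fun t => a * y.2 t + z.2 t) m =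
  a * gluing y m + gluing z m.
Proof. by rewrite /gluing !extD; ring. Qed.

(** The graph fixes a transform only up to null sets, whereas the specifications demand the integral
    formula at every point of the half-line. Hence the choice takes [FT f] itself whenever [f] is
    integrable. *)
Lemma FT_extension : exists H : (R -> R[i]) -> (R -> R[i]),
  forall f, L2R f -> is_FT f (H f) /\ (cintegrable f -> H f = FT f).
Proof.
suff /choice [H HP] : forall f, exists h, L2R f -> is_FT f h /\ (cintegrable f -> h = FT f).
  by exists H.
move=> f.
have [lf|nf] := pselect (L2R f); last by exists f.
have [cf|ncf] := pselect (cintegrable f); first by exists (FT f) => _; split=> //; exact: is_FT_integrable.
by have [h fh] := is_FT_exists lf; exists h => _; split.
Qed.

Lemma L2R_gluing_halves h : L2R h -> L2R (gluing (halves h)).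
Proof. by move=> lh; apply/Mspace_gluing; split; apply: L2R_L2pos => //; exact: L2R_opp. Qed.

Lemma is_FT_gluing_halves f h : is_FT f h -> is_FT f (gluing (halves h)).
Proof.
move=> fh; have [lf lh] := L2R_is_FT fh.
apply: (is_FT_ae fh); [by case: lf|by case: (L2R_gluing_halves lh)|exact: aeW|].
exact: gluing_halves.
Qed.

Lemma aeeqM_is_FT f y z : is_FT f (gluing y) -> is_FT f (gluing z) -> aeeqM y z.
Proof.
move=> fy fz; have [_ ly] := L2R_is_FT fy; have [_ lz] := L2R_is_FT fz.
by apply/aeeqM_gluing; [exact/Mspace_gluing|exact/Mspace_gluing|exact: is_FT_uniq fy fz].
Qed.

Lemma is_FT_lg_ae x x' h : L2pos x -> L2pos x' -> aeeq x x' -> is_FT (lg x) h ->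
  is_FT (lg x') h.
Proof.
move=> lx lx' /(aeeq_lg lx lx') xx' xh; have [lf lh] := L2R_is_FT xh.
have /(n2_eq0 (L2RB lf (L2R_lg lx'))) H := xx'.
apply: (is_FT_ae xh); [by case: (L2R_lg lx')|by case: lh| |exact: aeW].
by apply: ae_imp H => s /eqP; rewrite subr_eq0 => /eqP.
Qed.

Lemma is_FT_lgD (a : R[i]) x x' h h' : is_FT (lg x) h -> is_FT (lg x') h' ->
  is_FT (lg (fun t => a * x t + x' t)) (fun m => a * h m + h' m).
Proof.
move=> xh xh'; rewrite (_ : lg _ = fun s => a * lg x s + lg x' s); first exact: is_FTD.
by apply/funext => s; exact: lgD.
Qed.

Lemma U_exists : exists U, @is_Uop R U.
Proof.
have [H HP] := FT_extension.
pose U x := halves (H (lg x)).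
have UFT x : L2pos x -> is_FT (lg x) (gluing (U x)).
  by move=> lx; apply: is_FT_gluing_halves; exact: (HP _ (L2R_lg lx)).1.
exists U; split.
- by move=> x lx; apply/Mspace_gluing; have [] := L2R_is_FT (UFT x lx).
- move=> x x' lx lx' xx'; apply: aeeqM_is_FT (UFT _ lx').
  exact: is_FT_lg_ae xx' (UFT _ lx).
- move=> a x x' lx lx'; apply: (aeeqM_is_FT (UFT _ (L2posD a lx lx'))).
  rewrite (_ : gluing _ = fun m => a * gluing (U x) m + gluing (U x') m).
    by apply: is_FT_lgD; exact: UFT.
  by apply/funext => m; exact: gluingD.
- exists 1 => x lx; rewrite mul1r -n2_lg// normM2_gluing ?(is_FT_norm (UFT _ lx))//.
  by apply/Mspace_gluing; have [] := L2R_is_FT (UFT x lx).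
- move=> x ux m m0; have lx : L2pos x by case: ux.
  have -> : U x = halves (FT (lg x)).
    by rewrite /U (HP _ (L2R_lg lx)).2//; exact/Udom_lg.
  by rewrite !Uformula_FT// mul1r mulN1r.
Qed.

Lemma cintegrable_ext x : L2pos x -> Cintegrable (@Rpos R) x -> cintegrable (ext x).
Proof.
move=> _ [/(leb_integrable _ (@Rpos_measurable R)) i1 /(leb_integrable _ (@Rpos_measurable R)) i2].
split.
  rewrite (ext_restrict (p := @complex.Re R))//.
  exact: ((integrable_mkcondR _ (@Rpos_measurable R)).1 i1).
rewrite (ext_restrict (p := @complex.Im R))//.
exact: ((integrable_mkcondR _ (@Rpos_measurable R)).1 i2).
Qed.

Lemma n2B_ae h h' : L2R h -> L2R h' -> n2 (fun m => h m - h' m) = 0 ->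
  {ae mu, forall m, h m = h' m}.
Proof.
move=> lh lh' /(n2_eq0 (L2RB lh lh')) H; apply: ae_imp H => m.
by move=> /eqP; rewrite subr_eq0 => /eqP.
Qed.

Lemma aeeq_n2B h h' : L2R h -> L2R h' -> n2 (fun m => h m - h' m) = 0 -> aeeq h h'.
Proof.
by move=> lh lh' /(n2B_ae lh lh') H; apply: ae_imp H => m + _.
Qed.

Lemma F_exists : exists F, @is_truncFourier R F.
Proof.
have [H HP] := FT_extension.
have HF x : L2pos x -> is_FT (ext x) (H (ext x)).
  by move=> /L2pos_ext lx; exact: (HP _ lx).1.
have LH x : L2pos x -> L2R (H (ext x)) by move=> lx; have [] := L2R_is_FT (HF x lx).
exists (fun x => H (ext x)); split.
- by move=> x lx; exact/L2R_L2pos/LH.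
- move=> x x' lx lx' xx'; apply: aeeq_n2B; [exact: LH|exact: LH|].
  by rewrite (is_FT_dist (HF _ lx) (HF _ lx')); exact/aeeq_n2.
- move=> a x x' lx lx'; have lD := L2posD a lx lx'.
  have FD : is_FT (ext (fun t => a * x t + x' t)) (fun t => a * H (ext x) t + H (ext x') t).
    rewrite (_ : ext _ = fun t => a * ext x t + ext x' t).
      by apply: is_FTD; exact: HF.
    by apply/funext => t; exact: extD.
  by apply: aeeq_n2B (is_FT_uniq (HF _ lD) FD); [exact: LH|case: (L2R_is_FT FD)].
(* The transform is isometric on the line, and restriction to the half-line can only decrease the
   norm. *)
- exists 1 => x lx; rewrite mul1r !norm2_ext -(is_FT_norm (HF _ lx)).
  apply: n2_le; first exact/L2pos_ext/L2R_L2pos/LH.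
    by move=> t; exact: cabs2_crestrict_le.
  by case: (LH _ lx).
- move=> x lx cx t _; rewrite Fformula_FT (HP _ _).2//; first exact/L2pos_ext.
  exact: cintegrable_ext.
Qed.

(** The common shape of x |-> gluing (U x) and x |-> ext (F x), with linearity up to null sets, so
    that one continuity argument serves both. *)
Definition bounded_linear (T : (R -> R[i]) -> (R -> R[i])) :=
  [/\ forall x, L2pos x -> L2R (T x),
    forall (a : R[i]) x x', L2pos x -> L2pos x' ->
      {ae mu, forall m, T (fun t => a * x t + x' t) m = a * T x m + T x' m} &
    exists c : R, forall x, L2pos x -> n2 (T x) <= c * norm2 x].

Lemma bounded_linear_lipschitz T : bounded_linear T -> exists c : R,
  forall x x', L2pos x -> L2pos x' ->
  n2 (fun m => T x m - T x' m) <= c * n2 (fun s => lg x s - lg x' s).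
Proof.
move=> [TL TD [c Tc]]; exists c => x x' lx lx'.
have lD := L2posD (-1) lx' lx.
have -> : n2 (fun s => lg x s - lg x' s) = norm2 (fun t => -1 * x' t + x t).
  by rewrite -n2_lg//; congr n2; apply/funext => s; rewrite lgD mulN1r addrC.
apply: le_trans (Tc _ lD).
have [mT _] := TL _ lD; have [mB _] := L2RB (TL _ lx) (TL _ lx').
rewrite (ae_n2_eq mB mT)//; apply: ae_imp (TD (-1) x' x lx' lx) => m ->.
by rewrite mulN1r addrC.
Qed.

Lemma bounded_linear_cvg T (xs : nat -> R -> R[i]) x : bounded_linear T ->
  (forall n, L2pos (xs n)) -> L2pos x ->
  n2_cvg (fun n => lg (xs n)) (lg x) -> n2_cvg (fun n => T (xs n)) (T x).
Proof.
move=> /bounded_linear_lipschitz [c Tc] lxs lx cx.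
have Z : (fun n => c * n2 (fun s => lg (xs n) s - lg x s)) @ \oo --> (c * 0 : R).
  by apply: cvgM => //; exact: cvg_cst.
by rewrite mulr0 in Z; apply: (n2_cvg_le Z) => n; exact: Tc.
Qed.

Lemma bounded_linear_U U : is_Uop U -> bounded_linear (fun x => gluing (U x)).
Proof.
move=> [UM _ UD [c Uc] _]; split.
- by move=> x lx; exact/Mspace_gluing/UM.
- move=> a x x' lx lx'; have lD := L2posD a lx lx'.
  pose yz := (fun t => a * (U x).1 t + (U x').1 t, fun t => a * (U x).2 t + (U x').2 t).
  have [l1 l2] := UM _ lx; have [l3 l4] := UM _ lx'.
  have Myz : Mspace yz by split; exact: L2posD.
  have := (aeeqM_gluing (UM _ lD) Myz).1 (UD a x x' lx lx').
  move=> /(n2B_ae ((Mspace_gluing _).1 (UM _ lD)) ((Mspace_gluing _).1 Myz)) H.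
  by apply: ae_imp H => m ->; exact: gluingD.
- by exists c => x lx; rewrite -normM2_gluing; [exact: Uc|exact: UM].
Qed.

Lemma bounded_linear_F F : is_truncFourier F -> bounded_linear (fun x => ext (F x)).
Proof.
move=> [FL _ FD [c Fc] _]; split.
- by move=> x lx; exact/L2pos_ext/FL.
- move=> a x x' lx lx'; have lD := L2posD a lx lx'.
  have l1 := L2posD a (FL _ lx) (FL _ lx').
  have := (aeeq_n2 (FL _ lD) l1).1 (FD a x x' lx lx').
  move=> /(n2B_ae ((L2pos_ext _).1 (FL _ lD)) ((L2pos_ext _).1 l1)) H.
  by apply: ae_imp H => m ->; exact: extD.
- by exists c => x lx; rewrite -norm2_ext; exact: Fc.
Qed.

(** The cut confines t to [exp(-n), exp n], away from both 0 and infinity, so the integral formulas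
    of U and of F both apply. *)
Definition lgtrunc n x := ilg (trunc n (lg x)).

Lemma L2pos_lgtrunc n x : L2pos x -> L2pos (lgtrunc n x).
Proof. by move=> lx; apply/L2pos_ilg/L2R_trunc/L2R_lg. Qed.

Lemma cvg_lgtrunc x : L2pos x -> n2_cvg (fun n => lg (lgtrunc n x)) (lg x).
Proof.
move=> lx; rewrite (_ : (fun n => _) = fun n => trunc n (lg x)); first exact/cvg_trunc/L2R_lg.
by apply/funext => n; rewrite /lgtrunc lg_ilg.
Qed.

Lemma Uop_FT U x : is_Uop U -> L2pos x -> cintegrable (lg x) ->
  is_FT (lg x) (gluing (U x)).
Proof.
move=> [UM _ _ _ UF] lx cx; have ux := (Udom_lg lx).2 cx.
apply: (is_FT_ae (is_FT_integrable cx (L2R_lg lx))); [by case: (L2R_lg lx)| |exact: aeW|].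
  by case: ((Mspace_gluing _).1 (UM _ lx)).
apply: ae_imp ae_neq0 => m; rewrite neq_lt => /orP[m0|m0].
  have m1 : Rpos (- m) by apply/RposP; rewrite oppr_gt0.
  by rewrite gluing_neg// (UF _ ux _ m1).2 Uformula_FT// mulN1r opprK.
by rewrite gluing_pos// (UF _ ux _ ((RposP m).2 m0)).1 Uformula_FT// mul1r.
Qed.

Lemma is_FT_closed (fs hs : nat -> R -> R[i]) f h : L2R f -> L2R h ->
  (forall n, is_FT (fs n) (hs n)) -> n2_cvg fs f -> n2_cvg hs h -> is_FT f h.
Proof.
move=> lf lh FT_ cf ch; have [k fk] := is_FT_exists lf; have [_ lk] := L2R_is_FT fk.
have ck : n2_cvg hs k by apply: (n2_cvg_le cf) => n; rewrite (is_FT_dist (FT_ n) fk).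
have lhs n : L2R (hs n) by case: (L2R_is_FT (FT_ n)).
have H := n2B_ae lk lh (n2_cvg_uniq lhs lk lh ck ch).
by apply: (is_FT_ae fk _ _ _ H); [case: lf|case: lh|exact: aeW].
Qed.

(** The formula identifies [U] on the truncations, which lie in its domain and converge to x;
    boundedness of [U] and closedness of the graph do the rest. *)
Lemma is_FT_Uop U x : is_Uop U -> L2pos x -> is_FT (lg x) (gluing (U x)).
Proof.
move=> isU lx; have BU := bounded_linear_U isU; have [UL _ _] := BU.
have lT n := L2pos_lgtrunc n lx.
apply: (@is_FT_closed (fun n => lg (lgtrunc n x)) (fun n => gluing (U (lgtrunc n x)))).
- exact: L2R_lg.
- exact: UL.
- move=> n; apply: Uop_FT => //; rewrite lg_ilg; exact/cintegrable_trunc/L2R_lg.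
- exact: cvg_lgtrunc.
- exact: (bounded_linear_cvg (T := fun x => gluing (U x)) BU lT lx (cvg_lgtrunc lx)).
Qed.

Lemma Uop_isometry U x : is_Uop U -> L2pos x -> normM2 (U x) = norm2 x.
Proof.
move=> isU lx; rewrite normM2_gluing; last by case: isU => UM _ _ _ _; exact: UM.
by rewrite (is_FT_norm (is_FT_Uop isU lx)) n2_lg.
Qed.

Lemma Uop_onto U y : is_Uop U -> Mspace y -> exists x, L2pos x /\ aeeqM (U x) y.
Proof.
move=> isU /Mspace_gluing ly; have [f fy] := is_FT_onto ly; have [lf _] := L2R_is_FT fy.
have lx := L2pos_ilg lf; exists (ilg f); split=> //.
by have := is_FT_Uop isU lx; rewrite lg_ilg => H; exact: aeeqM_is_FT H fy.
Qed.

End Operators.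



(** * Intertwining relation *)
Section Intertwining.
Context {R : realType}.
Local Notation mu := (@lebesgue_measure R).
Local Notation c := (@isqrt2pi R).
Implicit Types (x : R -> R[i]) (g h f : R -> R[i]) (e m s t u : R).

Lemma cintegrable_ext_lg x : L2pos x ->
  integrableR (fun s => cabs (lg x s) * expR (s / 2)) -> cintegrable (ext x).
Proof.
move=> /L2pos_ext [mx _] H; have mc := measurable_cabs mx.
have S := integrable_substitution (@substitution_exp R) (@expR_ge0 R)
  (@measurable_expR R) (@measurable_expR R) (@Rpos_measurable R) mc.
have i1 : mu.-integrable (@Rpos R) (fun t => (cabs (ext x t))%:E).
  apply/S; apply: eq_integrableR H => s; rewrite cabs_lg -mulrA -expRD.
  by congr (_ * expR _); field.
apply: (cintegrable_le (k := fun t => cabs (ext x t))) => //.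
have := (integrable_mkcondR _ (@Rpos_measurable R)).1 i1.
rewrite -(ext_restrict (ext x) (@cabs0 R)); apply: eq_integrableR => t.
by congr cabs; rewrite /ext /crestrict; case: ifP => // ->.
Qed.

Lemma Fformula_ilg g t : cmeasurable g ->
  Fformula (ilg g) t =
  RtoC c * cint (fun s => g s * RtoC (expR (s / 2)) * cexpi (t * expR s)).
Proof.
move=> mg; rewrite /Fformula; congr (_ * _); rewrite Cint_exp.
  apply: eq_cint => s; rewrite /ilg expRK.
  have -> : expR (s / 2) = expR (- (s / 2)) * expR s by rewrite -expRD; congr expR; field.
  by rewrite RtoCM; ring.
apply: cmeasurable_crestrict; first exact: Rpos_measurable.
apply: cmeasurableM; last exact: cmeasurable_expiM.
apply: cmeasurableM; first exact: (cmeasurable_comp mg (@measurable_ln R)).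
apply: cmeasurable_RtoC; apply: measurableT_comp; first exact: measurable_expR.
by apply: measurable_funN; apply: measurable_funM => //; exact: measurable_ln.
Qed.

Definition damp e f t : R[i] := RtoC (expR (- (e * t))) * f t.

Lemma lg_damp e f u :
  lg (damp e f) u = RtoC (expR (u / 2 - e * expR u)) * f (expR u).
Proof. by rewrite /lg extE ?expR_gt0// /damp expRD RtoCM; ring. Qed.

(** * Damped transforms of functions integrable in both variables *)

Section Damped.
Variable g : R -> R[i].
Hypothesis gL2 : L2R g.
Hypothesis g_int : cintegrable g.
(** Integrability of [ilg g] against dt, where F is given by its integral formula. *)
Hypothesis g_exp : integrableR (fun s => cabs (g s) * expR (s / 2)).

Let mg : cmeasurable g. Proof. by case: gL2. Qed.

Let G s := g s * RtoC (expR (s / 2)).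

Let mG : cmeasurable G.
Proof. by apply: cmeasurableM => //; apply: cmeasurable_RtoC; exact: measurable_expR_half. Qed.

Let GE s : cabs (G s) = cabs (g s) * expR (s / 2).
Proof. by rewrite cabsM cabsR ger0_norm// expR_ge0. Qed.

Lemma cintegrable_ext_ilg : cintegrable (ext (ilg g)).
Proof. by apply: cintegrable_ext_lg; rewrite ?lg_ilg//; exact: L2pos_ilg. Qed.

Lemma L2R_Fformula_ilg : L2R (Fformula (ilg g)).
Proof.
rewrite (_ : Fformula _ = FT (ext (ilg g))); last by apply/funext => t; exact: Fformula_FT.
have [] := FT_contraction cintegrable_ext_ilg => //.
by apply/L2pos_ext; exact: L2pos_ilg.
Qed.

Lemma cintegrable_lg_damp e : 0 < e -> cintegrable (lg (damp e (Fformula (ilg g)))).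
Proof.
move=> e0; have [C HC] := FT_bounded cintegrable_ext_ilg.
have [mF _] := L2R_Fformula_ilg.
have mE : cmeasurable (fun u => Fformula (ilg g) (expR u)).
  exact: (cmeasurable_comp mF (@measurable_expR R)).
apply: (cintegrable_le (k := fun u => C * expR (u / 2 - e * expR u))).
- rewrite (_ : lg _ = fun u => RtoC (expR (u / 2 - e * expR u)) * Fformula (ilg g) (expR u)).
    apply: cmeasurableM => //; apply: cmeasurable_RtoC.
    exact: integrableR_measurable (integrableR_expR_exp e0).
  by apply/funext => u; exact: lg_damp.
- move=> u; rewrite lg_damp cabsM cabsR ger0_norm ?expR_ge0// mulrC.
  by rewrite ler_wpM2r ?expR_ge0// Fformula_FT.
- exact/integrableRZ/integrableR_expR_exp.
Qed.

(** Damping bounds the kernel by an integrable function of [u] times one of [s], so the integrals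
    can be exchanged; the inner one is then [gammaI] at frequency exp s. *)
Lemma FT_lg_damp e m : 0 < e -> FT (lg (damp e (Fformula (ilg g)))) m =
  RtoC (c ^+ 2) * cint (fun s => G s * gammaI e (expR s) m).
Proof.
move=> e0.
pose F (p : R * R) := G p.2 * gamma_kernel e (expR p.2) m p.1.
have mF : cmeasurable F.
  apply: cmeasurableM; first exact: (cmeasurable_comp mG measurable_snd).
  apply: (cmeasurable_comp (cmeasurable_gamma_kernel e) (h := fun p : R * R => (expR p.2, (m, p.1)))).
  apply: measurable_fun_pair; first exact: measurableT_comp.
  by apply: measurable_fun_pair => //; exact: measurable_fst.
have FB u s : cabs (F (u, s)) <= expR (u / 2 - e * expR u) * (cabs (g s) * expR (s / 2)).
  by rewrite /F cabsM GE cabs_gamma_kernel mulrC.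
have fub := cint_fubini mF FB (integrableR_expR_exp e0) g_exp.
have icG t : cintegrable (fun s => G s * cexpi (t * expR s)).
  apply: cintegrable_le g_exp.
    apply: cmeasurableM; [exact: mG|apply: cmeasurable_expi].
    by apply: measurable_funM => //; exact: measurable_expR.
  by move=> s; rewrite cabsM cabs_expi mulr1 GE.
rewrite /FT expr2 RtoCM -mulrA; congr (_ * _).
transitivity (cint (fun u => RtoC c * cint (fun s => F (u, s)))).
  apply: eq_cint => u; rewrite lg_damp (Fformula_ilg (expR u) mg).
  rewrite -[X in _ * (_ * X)]/(cint (fun s => G s * cexpi (expR u * expR s))).
  have -> : RtoC (expR (u / 2 - e * expR u)) * (RtoC c *
    cint (fun s => G s * cexpi (expR u * expR s))) * cexpi (m * u) =
    RtoC c * ((RtoC (expR (u / 2 - e * expR u)) * cexpi (m * u)) *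
    cint (fun s => G s * cexpi (expR u * expR s))) by ring.
  rewrite -(cintZ _ (icG (expR u))); congr (_ * _); apply: eq_cint => s.
  by rewrite /F /gamma_kernel /= cexpiD (mulrC (expR s)); ring.
rewrite cintZ; last first.
  have mI : cmeasurable (fun u => cint (fun s => F (u, s))) by exact: cmeasurable_parametric_Cint.
  apply: (cintegrable_le (k := fun u => 2 * Rintegral mu setT (fun s => cabs (g s) * expR (s / 2)) * expR (u / 2 - e * expR u))).
  - exact: mI.
  - move=> u; apply: (@le_trans _ _ (2 * Rintegral mu setT (fun s => expR (u / 2 - e * expR u) * (cabs (g s) * expR (s / 2))))).
      apply: cabs_cint_le; [|exact: FB|exact: integrableRZ].
      by apply: (cmeasurable_comp mF (h := fun s => (u, s))); exact: measurable_fun_pair.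
    rewrite RintegralZl; [|exact: measurableT|exact: g_exp].
    rewrite -mulrA [X in 2 * X]mulrC; exact: lexx.
  - exact/integrableRZ/integrableR_expR_exp.
congr (_ * _); rewrite fub; apply: eq_cint => s.
exact: (cintZ (G s) (cintegrable_gamma_kernel (expR s) m e0)).
Qed.

(** Dominated convergence with [gammaI_le]. At frequency exp s the limit contains exp(-s / 2), which
    cancels the factor of [G], and exp(-i m s), which makes the transform of [g] appear at -m. *)
Lemma ccvg_FT_lg_damp m :
  ccvg (fun n => FT (lg (damp n.+1%:R^-1 (Fformula (ilg g)))) m) (Fpm m * FT g (- m)).
Proof.
have e0 n : (0 : R) < n.+1%:R^-1 by rewrite invr_gt0.
have -> : (fun n => FT (lg (damp n.+1%:R^-1 (Fformula (ilg g)))) m) =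
    (fun n => RtoC (c ^+ 2) * cint (fun s => G s * gammaI n.+1%:R^-1 (expR s) m)).
  by apply/funext => n; exact: FT_lg_damp.
(* This is [Fpm m] without its factor (2 pi)^(-1/2). *)
pose K := cexpi (pi / 4) * RtoC (expR (- (pi * m) / 2)) * CGamma (Complex 2^-1 m).
have -> : Fpm m * FT g (- m) = RtoC (c ^+ 2) * cint (fun s => K * (g s * cexpi (- m * s))).
  rewrite cintZ; last exact: cintegrableM_expi.
  by rewrite /FT /Fpm /K expr2 RtoCM; ring.
apply: ccvgM; first exact: ccvg_cst.
have [C C0 HC] := @gammaI_le R.
apply: (cint_dominated_cvg (k := fun s => C * expR (`|m| * pi) * cabs (g s))).
- move=> n; apply: cmeasurableM => //.
  exact: (cmeasurable_comp (cmeasurable_gammaI n.+1%:R^-1 m) (@measurable_expR R)).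
- move=> s; have -> : K * (g s * cexpi (- m * s)) = G s *
   (RtoC (expR (- (m * (pi / 2)) - ln (expR s) / 2)) *
   cexpi (- (m * ln (expR s)) + pi / 2 / 2) * CGamma (Complex 2^-1 m)).
    rewrite expRK /K /G cexpiD (mulNr m).
    have -> : expR (- (pi * m) / 2) = expR (s / 2) * expR (- (m * (pi / 2)) - s / 2).
      by rewrite -expRD; congr expR; field.
    by rewrite (_ : pi / 2 / 2 = pi / 4) ?RtoCM; [ring|field].
  by apply: ccvgM; [exact: ccvg_cst|apply: ccvg_gammaI; exact: expR_gt0].
- move=> n s; rewrite cabsM GE.
  have := HC _ _ m (e0 n) (expR_gt0 s); rewrite expRK => H.
  apply: le_trans (ler_wpM2l _ H) _; first by rewrite mulr_ge0 ?cabs_ge0 ?expR_ge0.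
  rewrite le_eqVlt; apply/orP; left; apply/eqP.
  have -> : cabs (g s) * expR (s / 2) * (C * expR (`|m| * pi) * expR (- (s / 2))) =
    C * expR (`|m| * pi) * cabs (g s) * (expR (s / 2) * expR (- (s / 2))) by ring.
  by rewrite -expRD subrr expR0 mulr1.
- exact/integrableRZ/integrable_cabs.
Qed.

Lemma L2pos_damp n : L2pos (damp n.+1%:R^-1 (Fformula (ilg g))).
Proof.
have [mF iF] := L2R_Fformula_ilg; apply/L2pos_ext.
have mD : cmeasurable (ext (damp n.+1%:R^-1 (Fformula (ilg g)))).
  apply: cmeasurable_crestrict; first exact: Rpos_measurable.
  apply: cmeasurableM => //; apply: cmeasurable_RtoC.
  apply: measurableT_comp; first exact: measurable_expR.
  by apply: measurable_funN; exact: measurable_funM.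
apply: (L2R_le mD _ iF) => t; have [t0|t0] := ltP 0 t; last first.
  by rewrite ext_le0// cabs20 cabs2_ge0.
rewrite extE// /damp cabs2M cabs2R ler_piMl ?cabs2_ge0//.
rewrite expr_le1// ?expR_ge0// -expR0 ler_expR oppr_le0 mulr_ge0// ?invr_ge0//; exact: ltW.
Qed.

Lemma cvg_lg_damp :
  n2_cvg (fun n => lg (damp n.+1%:R^-1 (Fformula (ilg g)))) (lg (Fformula (ilg g))).
Proof.
have LF := L2R_L2pos L2R_Fformula_ilg.
have [mL iL] := L2R_lg LF.
apply: (n2_dominated_cvg (k := fun u => cabs2 (lg (Fformula (ilg g)) u))) => //.
- by move=> n; case: (L2R_lg (L2pos_damp n)).
- move=> u.
  have -> : (fun n => lg (damp n.+1%:R^-1 (Fformula (ilg g))) u) =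
      (fun n => RtoC (expR (- (n.+1%:R^-1 * expR u))) * lg (Fformula (ilg g)) u).
    by apply/funext => n; rewrite /lg !extE ?expR_gt0// /damp mulrA.
  suff : ccvg (fun n => RtoC (expR (- (n.+1%:R^-1 * expR u))) * lg (Fformula (ilg g)) u)
      (RtoC (expR 0) * lg (Fformula (ilg g)) u) by rewrite expR0 RtoC1 mul1r.
  apply: ccvgM; last exact: ccvg_cst.
  apply: ccvg_RtoC; apply: (cvg_comp_continuous (f := @expR R)); first exact: continuous_expR.
  rewrite -[X in _ --> X]oppr0; apply: cvgN; rewrite -[X in _ --> X](mul0r (expR u)).
  by apply: cvgM; [exact: cvg_harmonic|exact: cvg_cst].
- move=> n u; have -> : lg (damp n.+1%:R^-1 (Fformula (ilg g))) u - lg (Fformula (ilg g)) u =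
     RtoC (expR (- (n.+1%:R^-1 * expR u)) - 1) * lg (Fformula (ilg g)) u.
    by rewrite /lg !extE ?expR_gt0// /damp RtoCD (_ : RtoC (-1) = -1 :> R[i]);
      [ring|apply: complex_ext; rewrite /= ?oppr0].
  rewrite cabs2M cabs2R ler_piMl ?cabs2_ge0//.
  have H1 : expR (- (n.+1%:R^-1 * expR u)) <= 1.
    by rewrite -expR0 ler_expR oppr_le0 mulr_ge0// expR_ge0.
  have H2 := expR_ge0 (- (n.+1%:R^-1 * expR u)).
  by rewrite -real_normK ?num_real// expr_le1// ler_norml; apply/andP; split; lra.
Qed.

(** The damped transforms converge in L^2 to the glued U (F x) and pointwise to the explicit limit,
    so the two agree a.e. Reflecting the a.e. equality of the glued U x with FT g gives its value at
    -m. *)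
Lemma intertwining_ilg U F : is_Uop U -> is_truncFourier F ->
  {ae mu, forall m, gluing (U (F (ilg g))) m = Fpm m * gluing (U (ilg g)) (- m)}.
Proof.
move=> isU isF; have lx := L2pos_ilg gL2.
have [FL _ _ _ FE] := isF; have [UM _ _ _ _] := isU.
have cx : Cintegrable (@Rpos R) (ilg g).
  have [i1 i2] := cintegrable_ext_ilg.
  rewrite (ext_restrict (p := @complex.Re R))// in i1.
  rewrite (ext_restrict (p := @complex.Im R))// in i2.
  split; apply/(leb_integrable _ (@Rpos_measurable R)).
    exact: ((integrable_mkcondR _ (@Rpos_measurable R)).2 i1).
  exact: ((integrable_mkcondR _ (@Rpos_measurable R)).2 i2).
have lgF : lg (F (ilg g)) = lg (Fformula (ilg g)).
  apply/funext => s; rewrite /lg !extE ?expR_gt0// FE//; apply/RposP; exact: expR_gt0.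
have UF := is_FT_Uop isU (FL _ lx); rewrite lgF in UF.
have [_ lU] := L2R_is_FT UF.
have DF n : is_FT (lg (damp n.+1%:R^-1 (Fformula (ilg g))))
    (FT (lg (damp n.+1%:R^-1 (Fformula (ilg g))))).
  by apply: is_FT_integrable; [apply: cintegrable_lg_damp; rewrite invr_gt0|exact/L2R_lg/L2pos_damp].
have C : n2_cvg (fun n => FT (lg (damp n.+1%:R^-1 (Fformula (ilg g))))) (gluing (U (F (ilg g)))).
  by apply: (n2_cvg_le cvg_lg_damp) => n; rewrite (is_FT_dist (DF n) UF).
have H1 := n2_cvg_pointwise (fun n => (L2R_is_FT (DF n)).2) lU C ccvg_FT_lg_damp.
have Ug := is_FT_Uop isU lx; rewrite lg_ilg in Ug.
have gF := is_FT_integrable g_int gL2.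
have H2 := ae_oppP (n2B_ae (L2R_is_FT Ug).2 (L2R_is_FT gF).2 (is_FT_uniq Ug gF)).
by apply: ae_imp (ae_and H1 H2) => m [-> ->].
Qed.

End Damped.

Lemma intertwining_lgtrunc U F n x : is_Uop U -> is_truncFourier F -> L2pos x ->
  {ae mu, forall m, gluing (U (F (lgtrunc n x))) m =
                    Fpm m * gluing (U (lgtrunc n x)) (- m)}.
Proof.
move=> isU isF /L2R_lg lx.
have lT := L2R_trunc n lx; have cT := cintegrable_trunc n lx.
suff H : integrableR (fun s => cabs (trunc n (lg x) s) * expR (s / 2)).
  exact: (intertwining_ilg lT cT H isU isF).
(* On the support s <= n, hence exp(s / 2) <= exp(n / 2). *)
have := integrableRZ (expR (n%:R / 2)) (integrable_cabs cT).
apply: integrableR_le => [|s].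
  by apply: measurable_funM; [apply: measurable_cabs; case: lT|exact: measurable_expR_half].
rewrite ger0_norm ?mulr_ge0 ?cabs_ge0 ?expR_ge0// mulrC /trunc /crestrict.
case: ifPn => [/set_mem /=|_]; last by rewrite cabs0 !mulr0.
rewrite in_itv/= => /andP[_ sn]; rewrite ler_wpM2r ?cabs_ge0// ler_expR.
by rewrite ler_wpM2r.
Qed.

Lemma L2R_bounded_mul (a h : R -> R[i]) (K : R) : cmeasurable a ->
  (forall m, cabs2 (a m) <= K) -> L2R h ->
  L2R (fun m => a m * h m) /\ n2 (fun m => a m * h m) <= K * n2 h.
Proof.
move=> ma aK [mh ih].
have B m : cabs2 (a m * h m) <= K * cabs2 (h m) by rewrite cabs2M ler_wpM2r ?cabs2_ge0.
have L : L2R (fun m => a m * h m).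
  by apply: (L2R_le _ B); [exact: cmeasurableM|exact: integrableRZ].
split=> //; rewrite /n2 -RintegralZl//.
by apply: n2_le => //; exact: integrableRZ.
Qed.

Lemma n2_cvg_bounded_mul (a h : R -> R[i]) (hs : nat -> R -> R[i]) (K : R) :
  cmeasurable a -> (forall m, cabs2 (a m) <= K) -> L2R h -> (forall n, L2R (hs n)) ->
  n2_cvg hs h -> n2_cvg (fun n m => a m * hs n m) (fun m => a m * h m).
Proof.
move=> ma aK lh lhs ch.
have Z : (fun n => K * n2 (fun m => hs n m - h m)) @ \oo --> (K * 0 : R).
  by apply: cvgM => //; exact: cvg_cst.
rewrite mulr0 in Z; apply: (n2_cvg_le Z) => n.
have [_] := L2R_bounded_mul ma aK (L2RB (lhs n) lh); apply: le_trans.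
by apply: eq_n2_le => m; rewrite mulrBr.
Qed.

(* [Fpm] grows exponentially at [-oo]; this weight makes it a bounded multiplier. *)
Definition weight m := expR (- (pi * `|m| / 2)).

Lemma measurable_weight : measurable_fun setT weight.
Proof.
apply: measurableT_comp; first exact: measurable_expR.
by apply: measurable_funN; apply: measurable_funM => //; apply: measurable_funM.
Qed.

Lemma cmeasurable_Fpm : cmeasurable (@Fpm R).
Proof.
apply: cmeasurableM; last exact: cmeasurable_CGamma.
apply: cmeasurableM; first exact: cmeasurable_cst.
apply: cmeasurable_RtoC; apply: measurableT_comp; first exact: measurable_expR.
by apply: measurable_funM => //; apply: measurable_funN; exact: measurable_funM.
Qed.

(** The exponent -pi |m| / 2 of the weight offsets -pi m / 2 for either sign of m, and
    [CGamma_bounded] controls the Gamma factor. *)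
Lemma weighted_Fpm_bounded : exists K, forall m, cabs2 (RtoC (weight m) * Fpm m) <= K.
Proof.
have [C C0 HC] := @CGamma_bounded R; exists ((c * C) ^+ 2) => m.
have c0 := isqrt2pi_gt0 (R := R).
rewrite -cabs_sqr ler_sqr ?nnegrE ?cabs_ge0 ?mulr_ge0 ?(ltW c0)//.
rewrite /Fpm !cabsM cabs_expi mulr1 !cabsR !ger0_norm ?expR_ge0 ?(ltW c0)//.
have H : weight m * expR (- (pi * m) / 2) <= 1.
  rewrite /weight -expRD -expR0 ler_expR.
  have H : pi * (- m) <= pi * `|m| by rewrite ler_wpM2l ?pi_ge0// -normrN ler_norm.
  by rewrite expR0; rewrite mulrN in H; lra.
rewrite (_ : weight m * (c * _ * _) = c * (weight m * expR (- (pi * m) / 2) * cabs (CGamma (Complex 2^-1 m)))).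
  rewrite ler_wpM2l ?(ltW c0)// -[leRHS]mul1r; apply: ler_pM => //.
    by rewrite mulr_ge0 ?expR_ge0.
  exact: cabs_ge0.
by ring.
Qed.

Lemma weight_le1 m : cabs2 (RtoC (weight m)) <= 1.
Proof.
rewrite cabs2R expr_le1// ?expR_ge0// -expR0 ler_expR oppr_le0.
by rewrite divr_ge0// mulr_ge0// pi_ge0.
Qed.

(** After multiplication by the weight both sides are L^2 limits along [lgtrunc n x]. Uniqueness of
    the limit gives equality a.e., and the weight cancels because it is positive. *)
Lemma intertwining U F x : is_Uop U -> is_truncFourier F -> L2pos x ->
  {ae mu, forall m, gluing (U (F x)) m = Fpm m * gluing (U x) (- m)}.
Proof.
move=> isU isF lx.
have BU := bounded_linear_U isU; have BF := bounded_linear_F isF.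
have [FL _ _ _ _] := isF; have [UL _ _] := BU.
pose xs n := lgtrunc n x.
have lxs n : L2pos (xs n) by exact: L2pos_lgtrunc.
have cU : n2_cvg (fun n => gluing (U (xs n))) (gluing (U x)).
  exact: (bounded_linear_cvg (T := fun x => gluing (U x)) BU lxs lx (cvg_lgtrunc lx)).
have cF : n2_cvg (fun n => lg (F (xs n))) (lg (F x)).
  have := bounded_linear_cvg (T := fun x => ext (F x)) BF lxs lx (cvg_lgtrunc lx).
  by move=> H; apply: (n2_cvg_le H) => n; rewrite -norm2B_lg//; exact: FL.
have cUF : n2_cvg (fun n => gluing (U (F (xs n)))) (gluing (U (F x))).
  exact: (bounded_linear_cvg (T := fun x => gluing (U x)) BU (fun n => FL _ (lxs n)) (FL _ lx) cF).
pose r y m := gluing (U y) (- m).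
have lr y : L2pos y -> L2R (r y) by move=> ly; exact/L2R_opp/UL.
have cr : n2_cvg (fun n => r (xs n)) (r x).
  apply: (n2_cvg_le cU) => n; rewrite /r (n2_opp (f := fun s => gluing (U (xs n)) s - gluing (U x) s))//.
  by case: (L2RB (UL _ (lxs n)) (UL _ lx)).
have mw : cmeasurable (fun m => RtoC (weight m)) by apply: cmeasurable_RtoC; exact: measurable_weight.
have mwF : cmeasurable (fun m => RtoC (weight m) * Fpm m) by apply: cmeasurableM => //; exact: cmeasurable_Fpm.
have [K HK] := weighted_Fpm_bounded.
have cw := n2_cvg_bounded_mul mw weight_le1 (UL _ (FL _ lx)) (fun n => UL _ (FL _ (lxs n))) cUF.
have cwF := n2_cvg_bounded_mul mwF HK (lr _ lx) (fun n => lr _ (lxs n)) cr.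
have lw y : L2pos y -> L2R (fun m => RtoC (weight m) * gluing (U (F y)) m).
  by move=> ly; exact: (L2R_bounded_mul mw weight_le1 (UL _ (FL _ ly))).1.
have lwF y : L2pos y -> L2R (fun m => RtoC (weight m) * Fpm m * r y m).
  by move=> ly; exact: (L2R_bounded_mul mwF HK (lr _ ly)).1.
have cw' : n2_cvg (fun n m => RtoC (weight m) * gluing (U (F (xs n))) m)
    (fun m => RtoC (weight m) * Fpm m * r x m).
  apply: (n2_cvg_le cwF) => n; rewrite le_eqVlt; apply/orP; left; apply/eqP.
  apply: ae_n2_eq; [by case: (L2RB (lw _ (lxs n)) (lwF _ lx))|by case: (L2RB (lwF _ (lxs n)) (lwF _ lx))|].
  by apply: ae_imp (intertwining_lgtrunc n isU isF lx) => m ->; rewrite mulrA.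
have H := n2B_ae (lw _ lx) (lwF _ lx)
  (n2_cvg_uniq (fun n => lw _ (lxs n)) (lw _ lx) (lwF _ lx) cw cw').
apply: ae_imp H => m; rewrite -mulrA => /mulfI; apply.
by apply/eqP => -[/eqP]; rewrite gt_eqF// expR_gt0.
Qed.

(** The second row of M_F is the first one read at negative arguments, so one relation on the line
    covers both components. *)
Lemma Fmp_opp m : Fmp m = Fpm (- m) :> R[i].
Proof. by rewrite /Fmp /Fpm mulrN opprK. Qed.

Lemma intertwining_MF U F x : is_Uop U -> is_truncFourier F -> L2pos x ->
  aeeqM (U (F x)) (MF (U x)).
Proof.
move=> isU isF lx; have H := intertwining isU isF lx; split.
  apply: (ae_imp _ H) => m + /RposP m0.
  by rewrite gluing_pos// gluing_neg ?oppr_lt0// opprK.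
apply: (ae_imp _ (ae_oppP H)) => m + /RposP m0.
by rewrite gluing_neg ?oppr_lt0// !opprK gluing_pos//= Fmp_opp.
Qed.

End Intertwining.

(** The existence clauses keep the universal one from being vacuous; since the latter holds for
    every pair meeting the specifications, nothing depends on the choice of representatives. *)
Theorem theorem3p5 (R : realType) :
  (exists Uop, @is_Uop R Uop) /\ (exists Fop, @is_truncFourier R Fop) /\
  forall (Uop : (R -> R[i]) -> (R -> R[i]) * (R -> R[i]))
         (Fop : (R -> R[i]) -> (R -> R[i])),
    is_Uop Uop -> is_truncFourier Fop ->
    (* U is unitary: isometric and onto M *)
    ((forall x, L2pos x -> normM2 (Uop x) = norm2 x) /\
     (forall y, Mspace y -> exists x, L2pos x /\ aeeqM (Uop x) y)) /\
    (* F_{R+} = U^{-1} M_F U, i.e. U F_{R+} = M_F U on L^2(R^+) *)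
    (forall x, L2pos x -> aeeqM (Uop (Fop x)) (MF (Uop x))).
Proof.
split; [exact: U_exists|split; [exact: F_exists|]].
move=> Uop Fop isU isF; split; last by move=> x lx; exact: (intertwining_MF isU isF lx).
by split=> [x lx|y My]; [exact: (Uop_isometry isU lx)|exact: (Uop_onto isU My)].
Qed.
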